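(* Let $G$ be a locally compact group and let $E$ be a large ideal of $B(G)$. The coaction functor $\tau_E:(A,\delta)\mapsto(A^E,\delta^E)$ is exact if and only if for every coaction $(A,\delta)$ of $G$ and every strongly invariant ideal $I$ of $A$, $$I+A_E\supset\{a\in A:E\cdot a\subset I\}.$$
   Context: **Conventions.** $G$ is a locally compact group; ideals of $C^*$-algebras are closed and two-sided; homomorphisms are $*$-homomorphisms; $\otimes$ is the minimal tensor product. For $C^*$-algebras $A,C$ put $\widetilde M(A\otimes C)=\{m\in M(A\otimes C): m(1\otimes C)\cup(1\otimes C)m\subset A\otimes C\}$; a homomorphism $\phi:A\to B$ has a canonical extension $\overline{\phi\otimes\mathrm{id}}:\widetilde M(A\otimes C)\to\widetilde M(B\otimes C)$ with $\overline{\phi\otimes\mathrm{id}}(m)(1\otimes c)=(\phi\otimes\mathrm{id})(m(1\otimes c))$. Let $\delta_G:C^*(G)\to M(C^*(G)\otimes C^*(G))$ be the comultiplication, $\delta_G(s)=s\otimes s$ for $s\in G$. **Coactions.** A coaction $(A,\delta)$ of $G$ is a $C^*$-algebra $A$ with an injective nondegenerate homomorphism $\delta:A\to \widetilde M(A\otimes C^*(G))\subset M(A\otimes C^*(G))$ such that $(\delta\otimes\mathrm{id})\circ\delta=(\mathrm{id}\otimes\delta_G)\circ\delta$ and $\overline{\mathrm{span}}\,\delta(A)(1\otimes C^*(G))=A\otimes C^*(G)$. The category $\mathbf{Coact}$ has coactions of $G$ as objects; a morphism $\phi:(A,\delta)\to(B,\epsilon)$ is a homomorphism $\phi:A\to B$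 (not into multipliers) with $\epsilon\circ\phi=\overline{\phi\otimes\mathrm{id}}\circ\delta$. A short exact sequence of coactions is a sequence $0\to(I,\gamma)\to(A,\delta)\to(B,\epsilon)\to0$ in $\mathbf{Coact}$ whose underlying sequence of $C^*$-algebras is exact. An ideal $I$ of $A$ is strongly ($\delta$-)invariant if $\overline{\mathrm{span}}\,\delta(I)(1\otimes C^*(G))=I\otimes C^*(G)$; then $\delta$ restricts to a coaction on $I$ and descends to a coaction on $A/I$. **Large ideals.** $B(G)=C^*(G)^*$ is the Fourier–Stieltjes algebra. For a coaction $(A,\delta)$, $f\in B(G)$, $a\in A$ put $f\cdot a=(\mathrm{id}\otimes f)(\delta(a))\in A$. A large ideal $E$ of $B(G)$ is an ideal that is nonzero, $G$-invariant (under left and right translation), and weak* closed (such an ideal contains $B_r(G)=C^*_r(G)^*$). Let ${}^\perp E\subset C^*(G)$ be its preannihilator and $q_E:C^*(G)\to C^*_E(G)=C^*(G)/{}^\perp E$ the quotient map. For a coaction $(A,\delta)$, $A_E:=\{a\in A:E\cdot a=\{0\}\}=\ker(\mathrm{id}\otimes q_E)\circ\delta$ is an ideal of $A$, $A^E:=A/A_E$, $Q^E_A:A\to A^E$ is the quotient map, and $\delta^E$ is the unique coaction on $A^E$ for which $Q^E_A$ is $\delta-\delta^E$ equivariant. The functor $\tau_E$ on $\mathbf{Coact}$ takes $(A,\delta)$ to $(A^E,\delta^E)$ and a morphism $\phi:(A,\delta)\to(B,\epsilon)$ to the unique morphism $\phi^E:(A^E,\delta^E)\to(B^E,\epsilon^E)$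 with $\phi^E\circ Q^E_A=Q^E_B\circ\phi$. It is exact if it takes every short exact sequence of coactions to a short exact sequence. *)

(* Defs.v *)
From HB Require Import structures.
From mathcomp Require Import all_boot all_order all_algebra.
From mathcomp Require Import sesquilinear.
From mathcomp Require Import all_classical all_reals all_analysis.
From mathcomp Require Import complex.

Set Implicit Arguments.
Unset Strict Implicit.
Unset Printing Implicit Defensive.

Import Order.TTheory GRing.Theory Num.Theory.
Import numFieldNormedType.Exports.

Local Open Scope classical_set_scope.
Local Open Scope ring_scope.

HB.mixin Record isTopGroup G & Group G & Topological G := {
  mulg_continuous : continuous (fun p : G * G => (p.1 * p.2)%g);
  invg_continuous : continuous (fun s : G => (s^-1)%g) }.

#[short(type="topGroupType")]
HB.structure Definition TopGroup :=
  {G of Group G & Topological G & isTopGroup G}.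

(* C*-algebras are not assumed unital, so the product cannot be the one of
   GRing.PzRing. *)
HB.mixin Record Lmodule_isStarAlgebra (R : realType) A
    & GRing.Lmodule R[i] A := {
  amul : A -> A -> A;
  amulA : associative amul;
  amulDl : left_distributive amul +%R;
  amulDr : right_distributive amul +%R;
  amulZl : forall (k : R[i]) a b, amul (k *: a) b = k *: amul a b;
  amulZr : forall (k : R[i]) a b, amul a (k *: b) = k *: amul a b;
  star : A -> A;
  starK : involutive star;
  starD : forall a b, star (a + b) = star a + star b;
  starZ : forall (k : R[i]) a, star (k *: a) = Num.conj k *: star a;
  starM : forall a b, star (amul a b) = amul (star b) (star a) }.

#[short(type="starAlgType")]
HB.structure Definition StarAlgebra (R : realType) :=
  {A of GRing.Lmodule R[i] A & Lmodule_isStarAlgebra R A}.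

Notation "a ** b" := (amul a b) (at level 40, left associativity) : ring_scope.

HB.mixin Record StarAlgebra_isCstarAlgebra (R : realType) A
    & StarAlgebra R A & CompleteNormedModule R[i] A := {
  norm_amul : forall a b : A, `|a ** b| <= `|a| * `|b|;
  norm_star_amul : forall a : A, `|star a ** a| = `|a| ^+ 2 }.

#[short(type="cstarAlgType")]
HB.structure Definition CstarAlgebra (R : realType) :=
  {A of StarAlgebra R A & CompleteNormedModule R[i] A
      & StarAlgebra_isCstarAlgebra R A}.

Section StarHom.
Context (R : realType).

Record starhom (A B : starAlgType R) (f : A -> B) : Prop := {
  starhom_linear : linear f;
  starhom_mul : forall a b, f (a ** b) = f a ** f b;
  starhom_star : forall a, f (star a) = star (f a) }.

Definition cspan (V : normedModType R[i]) (S : set V) : set V :=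
  closure [set v | exists s : seq (R[i] * V),
    (forall p, p \in s -> S p.2) /\ v = \sum_(p <- s) p.1 *: p.2].

Record ideal (A : cstarAlgType R) (I : set A) : Prop := {
  ideal0 : I 0;
  idealP : forall (k : R[i]) x y, I x -> I y -> I (k *: x + y);
  idealMl : forall a x, I x -> I (a ** x);
  idealMr : forall a x, I x -> I (x ** a);
  ideal_closed : closed I }.

Definition dual (A : cstarAlgType R) : set (A -> R[i]) :=
  [set f | scalar f /\ exists K : R[i], forall a, `|f a| <= K * `|a|].

End StarHom.

Section Multiplier.
Context (R : realType).

(* Double centralizers: [lm m a] is m a and [rm m a] is a m.  Linearity and
   boundedness of both maps are automatic. *)
Record multiplier (A : cstarAlgType R) := Multiplier {
  lm : A -> A;
  rm : A -> A;
  centralizer : forall a b, a ** lm b = rm a ** b }.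

Variable A : cstarAlgType R.
Implicit Types (a b : A) (m n : multiplier A).

Lemma amull_inj a b : (forall x, x ** a = x ** b) -> a = b.
Proof.
move=> e; apply/eqP; rewrite -subr_eq0 -normr_eq0 -sqrf_eq0 -norm_star_amul.
by rewrite amulDr e -amulDr subrr -(scale0r (0 : A)) amulZr scale0r normr0.
Qed.

Lemma amulr_inj a b : (forall x, a ** x = b ** x) -> a = b.
Proof.
move=> e; apply: (can_inj (@starK R A)); apply: amull_inj => x.
by rewrite -[x]starK -!starM e.
Qed.

Lemma multiplierP m n : lm m =1 lm n -> m = n.
Proof.
case: m n => [l r c] [l' r' c'] /= /funext ll'; subst l'.
have rr' : r = r' by apply/funext => a; apply: amulr_inj => x; rewrite -c -c'.
by subst r'; congr Multiplier; exact: Prop_irrelevance.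
Qed.

Lemma lmP m (k : R[i]) a b : lm m (k *: a + b) = k *: lm m a + lm m b.
Proof.
by apply: amull_inj => x; rewrite centralizer !amulDr !amulZr -!centralizer.
Qed.

Lemma rmP m (k : R[i]) a b : rm m (k *: a + b) = k *: rm m a + rm m b.
Proof.
by apply: amulr_inj => x; rewrite -centralizer !amulDl !amulZl !centralizer.
Qed.

Lemma lmA m a b : lm m (a ** b) = lm m a ** b.
Proof. by apply: amull_inj => x; rewrite centralizer !amulA -centralizer. Qed.

Fact madd_subproof m n a b :
  a ** (lm m b + lm n b) = (rm m a + rm n a) ** b.
Proof. by rewrite amulDr amulDl !centralizer. Qed.
Definition madd m n := Multiplier (madd_subproof m n).

Fact mscale_subproof (k : R[i]) m a b :
  a ** (k *: lm m b) = (k *: rm m a) ** b.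
Proof. by rewrite amulZr amulZl centralizer. Qed.
Definition mscale k m := Multiplier (mscale_subproof k m).

Fact mzero_subproof a b : a ** (0 : A) = (0 : A) ** b.
Proof. by rewrite -(scale0r (0 : A)) amulZl amulZr !scale0r. Qed.
Definition mzero := Multiplier mzero_subproof.

Fact mmul_subproof m n a b :
  a ** lm m (lm n b) = rm n (rm m a) ** b.
Proof. by rewrite !centralizer. Qed.
Definition mmul m n := Multiplier (mmul_subproof m n).

Fact mstar_subproof m a b :
  a ** star (rm m (star b)) = star (lm m (star a)) ** b.
Proof. by rewrite -{1}[a]starK -starM -centralizer starM starK. Qed.
Definition mstar m := Multiplier (mstar_subproof m).

Fact mone_subproof a b : a ** b = a ** b. Proof. by []. Qed.
Definition mone := Multiplier mone_subproof.

Fact membed_subproof c a b : a ** (c ** b) = (a ** c) ** b.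
Proof. by rewrite amulA. Qed.
(* the canonical embedding of A as an ideal of M(A) *)
Definition membed c := Multiplier (membed_subproof c).

HB.instance Definition _ := gen_eqMixin (multiplier A).
HB.instance Definition _ := gen_choiceMixin (multiplier A).

Fact maddA : associative madd.
Proof. by move=> m n p; apply: multiplierP => a /=; rewrite addrA. Qed.
Fact maddC : commutative madd.
Proof. by move=> m n; apply: multiplierP => a /=; rewrite addrC. Qed.
Fact madd0 : left_id mzero madd.
Proof. by move=> m; apply: multiplierP => a /=; rewrite add0r. Qed.
Fact maddN : left_inverse mzero (mscale (-1)) madd.
Proof.
by move=> m; apply: multiplierP => a /=; rewrite scaleN1r addNr.
Qed.
HB.instance Definition _ :=
  GRing.isZmodule.Build (multiplier A) maddA maddC madd0 maddN.

Fact mscaleA (k l : R[i]) m : mscale k (mscale l m) = mscale (k * l) m.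
Proof. by apply: multiplierP => a /=; rewrite scalerA. Qed.
Fact mscale1 : left_id 1 mscale.
Proof. by move=> m; apply: multiplierP => a /=; rewrite scale1r. Qed.
Fact mscaleDr : right_distributive mscale +%R.
Proof. by move=> k m n; apply: multiplierP => a /=; rewrite scalerDr. Qed.
Fact mscaleDl m : {morph mscale^~ m : k l / k + l}.
Proof. by move=> k l; apply: multiplierP => a /=; rewrite scalerDl. Qed.
HB.instance Definition _ := GRing.Zmodule_isLmodule.Build R[i] (multiplier A)
  mscaleA mscale1 mscaleDr mscaleDl.

Fact mmulA : associative mmul.
Proof. by move=> m n p; apply: multiplierP. Qed.
Fact mmulDl : left_distributive mmul +%R.
Proof. by move=> m n p; apply: multiplierP. Qed.
Fact mmulDr : right_distributive mmul +%R.
Proof.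
move=> m n p; apply: multiplierP => a /=.
by rewrite -[X in lm m (X + _)]scale1r lmP scale1r.
Qed.
Fact mmulZl (k : R[i]) m n : mmul (k *: m) n = k *: mmul m n.
Proof. by apply: multiplierP. Qed.
Fact mmulZr (k : R[i]) m n : mmul m (k *: n) = k *: mmul m n.
Proof.
apply: multiplierP => a /=.
have lm0 : lm m 0 = 0.
  by apply: (@addIr _ (lm m 0)); rewrite add0r -{1}[lm m 0]scale1r -lmP scale1r add0r.
by rewrite -[X in lm m X]addr0 lmP lm0 addr0.
Qed.
Fact mstarK : involutive mstar.
Proof. by move=> m; apply: multiplierP => a /=; rewrite !starK. Qed.
Fact mstarD m n : mstar (m + n) = mstar m + mstar n.
Proof. by apply: multiplierP => a /=; rewrite starD. Qed.
Fact mstarZ (k : R[i]) m : mstar (k *: m) = Num.conj k *: mstar m.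
Proof. by apply: multiplierP => a /=; rewrite starZ. Qed.
Fact mstarM m n : mstar (mmul m n) = mmul (mstar n) (mstar m).
Proof. by apply: multiplierP => a /=; rewrite starK. Qed.
HB.instance Definition _ := Lmodule_isStarAlgebra.Build R (multiplier A)
  mmulA mmulDl mmulDr mmulZl mmulZr mstarK mstarD mstarZ mstarM.

End Multiplier.

(* Throughout, [xget d P] is used as definite description: it is "the" element
   of P, the value d when there is none being irrelevant. *)
Section Extensions.
Context (R : realType).
Implicit Types A B : cstarAlgType R.

Definition nondegenerate A B (phi : A -> multiplier B) :=
  cspan [set x | exists a b, x = lm (phi a) b] = setT.

(* the extension M(A) -> M(B) of a nondegenerate homomorphism A -> M(B) *)
Definition mext A B (phi : A -> multiplier B) (m : multiplier A) :
    multiplier B :=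
  xget 0 [set n | forall a b, lm n (lm (phi a) b) = lm (phi (lm m a)) b].

(* The strictly continuous extension to M(A) of a bounded functional f: by
   Cohen's factorization theorem f = g(. c) for some g in A^* and c in A, and
   then f(m) = g(m c). *)
Definition fext A (f : A -> R[i]) (m : multiplier A) : R[i] :=
  xget 0 [set z | exists g c,
    [/\ dual g, forall a, f a = g (a ** c) & z = g (lm m c)]].

End Extensions.

Section Tensor.
Context (R : realType).

Record hilbert := Hilbert {
  hcar :> completeNormedModType R[i];
  hdot : {dot hcar for (@Num.conj R[i])};
  hnormE : forall x : hcar, `|x| ^+ 2 = hdot x x }.

(* a representation of A on H, i.e. a homomorphism A -> B(H); the adjoint
   forces each [pi a] to be bounded *)
Record representation (A : cstarAlgType R) (H : hilbert) (pi : A -> H -> H) :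
    Prop := {
  rep_linear : forall a, linear (pi a);
  rep_linearl : forall x, linear (pi^~ x);
  rep_mul : forall a b x, pi (a ** b) x = pi a (pi b x);
  rep_star : forall a x y, hdot H (pi a x) y = hdot H x (pi (star a) y) }.

(* Elements of algebraic tensor products are given by lists of pairs, a list s
   standing for the sum of the p.1 (x) p.2 for p in s: [tdot xi eta] is the
   inner product of H (x) K, and [tact pi rho t xi] is (pi (x) rho)(t) xi. *)
Definition tdot (H K : hilbert) (xi eta : seq (H * K)) : R[i] :=
  \sum_(p <- xi) \sum_(q <- eta) hdot H p.1 q.1 * hdot K p.2 q.2.

Definition tact (A C : cstarAlgType R) (H K : hilbert)
    (pi : A -> H -> H) (rho : C -> K -> K) (t : seq (A * C))
    (xi : seq (H * K)) : seq (H * K) :=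
  [seq (pi p.1 q.1, rho p.2 q.2) | p <- t, q <- xi].

Definition spatial_bound (A C : cstarAlgType R) (t : seq (A * C)) (r : R[i]) :=
  forall (H K : hilbert) (pi : A -> H -> H) (rho : C -> K -> K),
    representation pi -> representation rho ->
    forall xi, tdot (tact pi rho t xi) (tact pi rho t xi) <= r ^+ 2 * tdot xi xi.

(* The minimal tensor product: the C*-completion of the algebraic tensor product
   for the spatial norm, the supremum of the norms of (pi (x) rho)(t).  This
   determines it up to a unique isomorphism. *)
Record min_tensor (A C : cstarAlgType R) := MinTensor {
  tcar :> cstarAlgType R;
  tens : A -> C -> tcar;
  tens_linearl : forall c, linear (tens^~ c);
  tens_linearr : forall a, linear (tens a);
  tens_mul : forall a a' c c', tens a c ** tens a' c' = tens (a ** a') (c ** c');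
  tens_star : forall a c, star (tens a c) = tens (star a) (star c);
  tens_norm : forall (t : seq (A * C)) (r : R[i]), 0 <= r ->
    `|\sum_(p <- t) tens p.1 p.2| <= r <-> spatial_bound t r;
  tens_dense : cspan [set x | exists a c, x = tens a c] = setT }.

Definition min_tensors := forall A C : cstarAlgType R, min_tensor A C.

Variable T : min_tensors.
Implicit Types A B C D : cstarAlgType R.

Definition mtens A C (m : multiplier A) (n : multiplier C) :
    multiplier (T A C) :=
  xget 0 [set k | forall a c, lm k (tens (T A C) a c) =
                              tens (T A C) (lm m a) (lm n c)].

Definition mtens1 A C (c : C) : multiplier (T A C) := mtens (mone A) (membed c).

Definition homtens A B C D (phi : A -> multiplier B) (psi : C -> multiplier D) :
    T A C -> multiplier (T B D) :=
  xget (fun=> 0) [set Phi | starhom Phi /\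
    forall a c, Phi (tens (T A C) a c) = mtens (phi a) (psi c)].

Definition tens_assoc A C D : T A (T C D) -> T (T A C) D :=
  xget (fun=> 0) [set f | starhom f /\ forall a c d,
    f (tens (T A (T C D)) a (tens (T C D) c d)) =
    tens (T (T A C) D) (tens (T A C) a c) d].

Definition Mtilde A C : set (multiplier (T A C)) :=
  [set m | forall c, range (@membed R (T A C)) (m ** mtens1 A c) /\
                     range (@membed R (T A C)) (mtens1 A c ** m)].

Definition Mtilde_ext A B C (phi : A -> B) (m : multiplier (T A C)) :
    multiplier (T B C) :=
  xget 0 [set n | Mtilde n /\ forall c t, m ** mtens1 A c = membed t ->
    n ** mtens1 B c = homtens (fun a => membed (phi a)) (@membed R C) t].

Definition slice A C (g : C -> R[i]) (t : T A C) : A :=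
  xget 0 [set a | exists S : T A C -> A,
    [/\ linear S, continuous S,
        forall b c, S (tens (T A C) b c) = g c *: b & a = S t]].

(* id (x) f on M~(A (x) C), with f = g(. c) as in [fext] *)
Definition mslice A C (f : C -> R[i]) (m : multiplier (T A C)) : A :=
  xget 0 [set a | exists g c t,
    [/\ dual g, forall x, f x = g (x ** c), m ** mtens1 A c = membed t
      & a = slice g t]].

End Tensor.

Arguments mtens {R} T {A C} m n.
Arguments mtens1 {R} T A {C} c.
Arguments homtens {R} T {A B C D} phi psi _.
Arguments tens_assoc {R} T {A C D} _.
Arguments Mtilde {R} T A C _.
Arguments Mtilde_ext {R} T {A B C} phi m.
Arguments slice {R} T {A C} g t.
Arguments mslice {R} T {A C} f m.

Section GroupAlgebra.
Context (R : realType) (G : topGroupType).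

(* a strictly continuous homomorphism from G to the unitary group of M(B) *)
Record unitary_hom (B : cstarAlgType R) (v : G -> multiplier B) : Prop := {
  uhom1 : v 1%g = mone B;
  uhomM : forall s t, v (s * t)%g = v s ** v t;
  uhomV : forall s, v (s^-1)%g = star (v s);
  uhom_continuous : forall b, continuous (fun s => lm (v s) b) }.

(* C*(G), with the canonical map of G into UM(C*(G)), characterized up to a
   unique isomorphism as universal for strictly continuous unitary
   homomorphisms. *)
Record group_cstar := GroupCstar {
  gcar :> cstarAlgType R;
  gunit : G -> multiplier gcar;
  gunit_unitary : unitary_hom gunit;
  gunit_universal : forall (B : cstarAlgType R) (v : G -> multiplier B),
    unitary_hom v ->
    exists! phi : gcar -> multiplier B,
      [/\ starhom phi, nondegenerate phi & forall s, mext phi (gunit s) = v s] }.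

End GroupAlgebra.

Section Coaction.
Context (R : realType) (G : topGroupType).
Variables (CG : group_cstar R G) (T : min_tensors R).

Definition comult : CG -> multiplier (T CG CG) :=
  xget (fun=> 0) [set d | [/\ starhom d, nondegenerate d &
    forall s, mext d (gunit CG s) = mtens T (gunit CG s) (gunit CG s)]].

(* The coaction identity is stated in M((A (x) C*(G)) (x) C*(G)). *)
Record coaction := Coaction {
  ccar :> cstarAlgType R;
  cdelta : ccar -> multiplier (T ccar CG);
  cdelta_hom : starhom cdelta;
  cdelta_inj : injective cdelta;
  cdelta_nondeg : nondegenerate cdelta;
  cdelta_tilde : forall a, Mtilde T ccar CG (cdelta a);
  cdelta_coassoc : forall a,
    mext (homtens T cdelta (@membed R CG)) (cdelta a) =
    mext (fun t => membed (tens_assoc T t))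
      (mext (homtens T (@membed R ccar) comult) (cdelta a));
  cdelta_dense : cspan [set t : T ccar CG | exists a c,
    membed t = cdelta a ** mtens1 T ccar c] = setT }.

Record coact_hom (X Y : coaction) := CoactHom {
  chom :> X -> Y;
  chom_hom : starhom chom;
  chom_equiv : forall a, cdelta (chom a) = Mtilde_ext T chom (cdelta a) }.

Definition strongly_invariant (X : coaction) (I : set X) :=
  cspan [set t : T X CG | exists a c,
           I a /\ membed t = cdelta a ** mtens1 T X c] =
  cspan [set t : T X CG | exists a c, I a /\ t = tens (T X CG) a c].

Definition short_exact (X Y Z : coaction) (phi : coact_hom X Y)
    (psi : coact_hom Y Z) :=
  [/\ injective phi, range phi = [set b | psi b = 0] & range psi = setT].

(* The functor laws are stated extensionally, so that no proof is needed that
   identities and composites are morphisms. *)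
Record coact_functor := CoactFunctor {
  fobj :> coaction -> coaction;
  fmor : forall X Y, coact_hom X Y -> coact_hom (fobj X) (fobj Y);
  fmor_id : forall X (i : coact_hom X X), i =1 id -> fmor i =1 id;
  fmor_comp : forall X Y Z (f : coact_hom X Y) (g : coact_hom Y Z)
    (h : coact_hom X Z), h =1 g \o f -> fmor h =1 fmor g \o fmor f }.

Definition exact_functor (F : coact_functor) :=
  forall X Y Z (phi : coact_hom X Y) (psi : coact_hom Y Z),
    short_exact phi psi -> short_exact (fmor F phi) (fmor F psi).

(* f . a *)
Definition cdot (X : coaction) (f : CG -> R[i]) (a : X) : X :=
  mslice T f (cdelta a).

(* The elements of B(G) are taken in C*(G)^*; the corresponding functions on G
   are s |-> fext f (gunit CG s), and the product of B(G) is pointwise. *)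
Record large_ideal (E : set (CG -> R[i])) : Prop := {
  large_sub : E `<=` dual (A := CG);
  large_lin : forall (k : R[i]) f g, E f -> E g -> E (fun x => k * f x + g x);
  large_mul : forall f g h, E f -> dual g -> dual h ->
    (forall s, fext h (gunit CG s) =
               fext f (gunit CG s) * fext g (gunit CG s)) -> E h;
  large_neq0 : exists2 f, E f & exists x, f x != 0;
  large_left : forall f s, E f -> E (fun x => f (lm (gunit CG s) x));
  large_right : forall f s, E f -> E (fun x => f (rm (gunit CG s) x));
  large_wclosed : forall f, dual f ->
    (forall (s : seq CG) (e : R[i]), 0 < e ->
       exists2 g, E g & forall x, x \in s -> `|f x - g x| < e) -> E f }.

Definition annihilated (E : set (CG -> R[i])) (X : coaction) : set X :=
  [set a | forall f, E f -> cdot f a = 0].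

(* tau_E: [tauQ X] is the quotient map X -> X^E = X / X_E. *)
Record tau_functor (E : set (CG -> R[i])) := TauFunctor {
  tau :> coact_functor;
  tauQ : forall X, coact_hom X (tau X);
  tauQ_surj : forall X, range (tauQ X) = setT;
  tauQ_ker : forall X, [set a | tauQ X a = 0] = annihilated E (X := X);
  tauQ_natural : forall X Y (phi : coact_hom X Y) a,
    fmor tau phi (tauQ X a) = tauQ Y (phi a) }.

End Coaction.

(* Main.v *)
Require Import Defs.
From HB Require Import structures.
From mathcomp Require Import all_boot all_order all_algebra.
From mathcomp Require Import sesquilinear.
From mathcomp Require Import all_classical all_reals all_analysis.
From mathcomp Require Import complex.
From mathcomp Require Import ring lra.
Set Implicit Arguments.
Unset Strict Implicit.
Unset Printing Implicit Defensive.
Import Order.TTheory GRing.Theory Num.Theory.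
Import numFieldNormedType.Exports.
Local Open Scope classical_set_scope.
Local Open Scope ring_scope.

(* (<=) Slicing is natural: f . phi(a) = phi(f . a) for f in E and a morphism phi
   of an exact sequence 0 -> X -> Y -> Z -> 0.  So, with I the image of X, the
   class of b in Y^E dies in Z^E iff E . b is contained in I, whereas it comes
   from X^E iff b lies in I + Y_E.

   (=>) A strongly invariant ideal I gives a short exact sequence of coactions
   I -> A -> A/I, and the inclusion is the exactness of its image in the middle.
   The coaction on I restricts multipliers of A (x) C*(G) to the ideal
   I (x) C*(G); the one on A/I extends them along q (x) id.  The latter is
   injective because (id (x) eps) o delta = id for the trivial representation eps
   of G, which follows from the coaction identity and injectivity of delta.

   Both need functoriality and associativity of the minimal tensor product, which
   rest on the fact that its norm may be computed from any norming family of
   representations pi of A: if all (pi (x) rho)(t) are bounded by r, then the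
   slices of (t* t)^(2^m) by vector functionals are bounded by multiples of
   r^(2^(m+1)), and taking roots bounds (pi (x) rho)(t) by r for every pi. *)

(** * Real-valued norms, sequences and total families *)

(** Positivity is developed without spectra or functional calculus, from one square root: the limit
    of the polynomial iteration in [msqrt]. It is run in M(A), which supplies a unit without
    adjoining one, and the limit lies in A when the data do. Positivity of x^* x, approximate units,
    contractivity of homomorphisms and of representations, and states are all derived from it. The
    spatial norm is a supremum over representations, so estimates in a tensor product pass through
    Hilbert spaces, and norms in a factor are compared with it by the Gelfand-Naimark theorem. All
    Hilbert spaces are produced by one construction from positive kernels. The maps [mtens],
    [homtens], [mext], [slice], [tens_assoc], [comult] are definite descriptions, which say nothing
    until an element with the defining property has been exhibited; hence the many bounds on
    generators. Identities between extended homomorphisms are then proved by letting multipliers act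
    on vectors and pushing the vectors through an intertwining map. *)

Section Norm.
Context (R : realType).
Local Notation C := R[i].

(** Norms over [R[i]] take values in [R[i]]; this real copy lets estimates be closed by [lra] and
    [nra]. *)
Definition nr (V : normedZmodType C) (x : V) : R := complex.Re `|x|.

Section nr.
Variable V : normedZmodType C.
Implicit Types x y : V.

Lemma nrE x : `|x| = (nr x)%:C%C.
Proof. by rewrite RRe_real// normr_real. Qed.

Lemma nr_ge0 x : 0 <= nr x.
Proof. by rewrite -ler0c -nrE. Qed.

Lemma nr0 : nr (0 : V) = 0.
Proof. by rewrite /nr normr0. Qed.

Lemma nr_eq0 x : nr x = 0 -> x = 0.
Proof. by move=> h; apply/eqP; rewrite -normr_eq0 nrE h. Qed.

Lemma nrD x y : nr (x + y) <= nr x + nr y.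
Proof. by rewrite -lecR rmorphD /= -!nrE ler_normD. Qed.

Lemma nrN x : nr (- x) = nr x.
Proof. by rewrite /nr normrN. Qed.

Lemma nrBC x y : nr (x - y) = nr (y - x).
Proof. by rewrite -nrN opprB. Qed.

Lemma nrB x y : nr (x - y) <= nr x + nr y.
Proof. by rewrite (le_trans (nrD _ _))// nrN. Qed.

Lemma nr_tri z x y : nr (x - y) <= nr (x - z) + nr (z - y).
Proof. by rewrite (le_trans _ (nrD _ _))// addrA subrK. Qed.

Lemma nr_leD x y : nr x <= nr y + nr (x - y).
Proof. by rewrite (le_trans _ (nrD _ _))// addrC subrK. Qed.

Lemma nr_sum I (s : seq I) (f : I -> V) :
  nr (\sum_(i <- s) f i) <= \sum_(i <- s) nr (f i).
Proof.
elim: s => [|i s IH]; first by rewrite !big_nil nr0.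
by rewrite !big_cons (le_trans (nrD _ _))// lerD2l.
Qed.

Lemma nr_small_eq0 x : (forall e : R, 0 < e -> nr x <= e) -> x = 0.
Proof.
move=> h; apply: nr_eq0; apply/eqP; rewrite eq_le nr_ge0 andbT.
by rewrite leNgt; apply/negP => x0; have := h _ (divr_gt0 x0 (ltr0n _ 2)); lra.
Qed.

End nr.

Lemma nrZ (V : normedModType C) (k : C) (x : V) : nr (k *: x) = nr k * nr x.
Proof. by apply: complexI; rewrite rmorphM /= -!nrE normrZ. Qed.

Lemma nrM (k l : C) : nr (k * l) = nr k * nr l.
Proof. by apply: complexI; rewrite rmorphM /= -!nrE normrM. Qed.

Lemma nrR (x : R) : nr (x%:C%C : C) = `|x|.
Proof. by rewrite /nr normc_def /= expr0n /= addr0 sqrtr_sqr. Qed.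

Lemma nr1 : nr (1 : C) = 1.
Proof. by rewrite -[1]/((1 : R)%:C%C) nrR normr1. Qed.

Lemma nr_conj (k : C) : nr (Num.conj k) = nr k.
Proof. by rewrite /nr norm_conjC. Qed.

Lemma abs_Re_le_nr (k : C) : `|complex.Re k| <= nr k.
Proof.
rewrite /nr normc_def /= -[X in X <= _]sqrtr_sqr ler_wsqrtr//.
by rewrite lerDl sqr_ge0.
Qed.

Lemma Re_le_nr (k : C) : complex.Re k <= nr k.
Proof. exact: le_trans (ler_norm _) (abs_Re_le_nr k). Qed.

Lemma Im_le_nr (k : C) : `|complex.Im k| <= nr k.
Proof.
rewrite /nr normc_def /= -[X in X <= _]sqrtr_sqr ler_wsqrtr//.
by rewrite lerDr sqr_ge0.
Qed.

Lemma nr_Re_Im (k : C) : nr k <= `|complex.Re k| + `|complex.Im k|.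
Proof.
case: k => a b.
rewrite [X in nr X]complexE /= (le_trans (nrD _ _))// nrM !nrR.
have -> : nr ('i%C : C) = 1 by rewrite /nr normc_def /= expr0n /= add0r expr1n sqrtr1.
by rewrite mul1r.
Qed.

Lemma ge0_nrE (k : C) : 0 <= k -> k = (nr k)%:C%C.
Proof. by move=> k0; rewrite -nrE ger0_norm. Qed.

Lemma Re_ge0 (k : C) : 0 <= k -> 0 <= complex.Re k.
Proof. by move=> k0; rewrite (ge0_nrE k0) nr_ge0. Qed.

(** The constant [K] absorbs whatever factor an approximation argument produces, so that errors
    never have to be normalized. *)
Lemma le_eps (a b K : R) : (forall d, 0 < d -> a <= b + K * d) -> a <= b.
Proof.
move=> h; apply/ler_addgt0Pr => e e0.
have K1 : 0 < `|K| + 1 by rewrite ltr_wpDl.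
apply: le_trans (h _ (divr_gt0 e0 K1)) _; rewrite lerD2l mulrCA.
rewrite -[leRHS]mulr1 ler_pM2l// ler_pdivrMr// mul1r (le_trans (ler_norm _))//.
by rewrite lerDl.
Qed.

Lemma divS_lt (e x : R) : 0 < e -> 0 <= x -> e / (x + 1) * x < e.
Proof.
move=> e0 x0; have x1 : 0 < x + 1 by rewrite ltr_wpDl.
by rewrite mulrAC ltr_pdivrMr// ltr_pM2l// ltrDl.
Qed.

Definition iv (n : nat) : R := n.+1%:R^-1.

Lemma iv_gt0 n : 0 < iv n.
Proof. by rewrite invr_gt0. Qed.

Lemma iv_le m n : (m <= n)%N -> iv n <= iv m.
Proof. by move=> mn; rewrite lef_pV2 ?posrE// ler_nat ltnS. Qed.

Lemma iv_small (e : R) : 0 < e -> exists n : nat, iv n < e.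
Proof.
move=> e0; exists (Num.bound e^-1).
rewrite -[e in _ < e]invrK ltf_pV2 ?posrE ?invr_gt0 ?ltr0n//.
rewrite (lt_trans (archi_boundP _))// ?invr_ge0 ?ltW//.
by rewrite ltr_nat.
Qed.

(** Convergence of sequences makes sense on a bare normed group, before completeness has been
    established; [seq_complete] goes back to filters when a completeness instance is declared. *)
Definition cvs (V : normedZmodType C) (u : nat -> V) (l : V) :=
  forall e : R, 0 < e -> exists N, forall n, (N <= n)%N -> nr (u n - l) < e.

Definition cau (V : normedZmodType C) (u : nat -> V) :=
  forall e : R, 0 < e -> exists N, forall m n, (N <= m)%N -> (N <= n)%N ->
    nr (u m - u n) < e.

Section topology.
Variable V : normedModType C.

Lemma posC (e : C) : 0 < e -> exists2 d : R, 0 < d & e = d%:C%C.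
Proof.
move=> e0; have E := ge0_nrE (ltW e0).
by exists (nr e) => //; rewrite -(ltcR _ (nr e)) -E.
Qed.

Lemma nbhs_nrP (x : V) (S : set V) :
  nbhs x S <-> exists2 e : R, 0 < e & forall y, nr (x - y) < e -> S y.
Proof.
split.
  move=> /nbhs_ballP[_ /posC[e e0 ->] h]; exists e => // y xy; apply: h.
  by rewrite -ball_normE /ball_ /= nrE ltcR.
move=> [e e0 h]; apply/nbhs_ballP; exists e%:C%C; first by rewrite /= ltcR.
by move=> y; rewrite -ball_normE /ball_ /= nrE ltcR => /h.
Qed.

Lemma closureP (S : set V) x :
  closure S x <-> forall e : R, 0 < e -> exists2 y, S y & nr (x - y) < e.
Proof.
split=> [h e e0|h B /nbhs_nrP[e e0 hB]].
  have /h[y [Sy By]] : nbhs x [set y | nr (x - y) < e].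
    by apply/nbhs_nrP; exists e.
  by exists y.
by have [y Sy xy] := h _ e0; exists y; split => //; apply: hB.
Qed.

Lemma closedP (S : set V) : closed S <->
  forall x, (forall e : R, 0 < e -> exists2 y, S y & nr (x - y) < e) -> S x.
Proof.
by split=> h x hx; apply: h => //; apply/closureP.
Qed.

Lemma continuous_nrP (W : normedModType C) (f : V -> W) : continuous f <->
  forall x (e : R), 0 < e -> exists2 d : R, 0 < d &
    forall y, nr (x - y) < d -> nr (f x - f y) < e.
Proof.
split=> [cf x e e0|h x B].
  have : nbhs (f x) [set y | nr (f x - y) < e].
    apply/nbhs_ballP; exists e%:C%C; first by rewrite /= ltcR.
    by move=> y; rewrite -ball_normE /ball_ /= nrE ltcR.
  by move=> /cf /nbhs_nrP[d d0 hd]; exists d.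
move=> /nbhs_ballP[_ /posC[e e0 ->] hB].
have [d d0 hd] := h x _ e0; apply/nbhs_nrP; exists d => // y /hd xy.
by apply: hB; rewrite -ball_normE /ball_ /= nrE ltcR.
Qed.

(** Points x_n whose balls of radius 1/(n+1) belong to the filter form a Cauchy sequence, because
    two members of a proper filter meet, and the filter converges to its limit. *)
Lemma seq_complete : (forall u : nat -> V, cau u -> exists l, cvs u l) ->
  forall F : set_system V, ProperFilter F -> cauchy F -> cvg F.
Proof.
move=> h F FF /(cauchyP F) cF.
have /choice[u hu] : forall n : nat, exists x : V, F [set y | nr (x - y) < iv n].
  move=> n; have [|x Fx] := cF (iv n)%:C%C; first by rewrite /= ltcR iv_gt0.
  exists x; apply: filterS Fx => y.
  by rewrite -ball_normE /ball_ /= nrE ltcR.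
have [|l hl] := h u.
  move=> e e0; have [N hN] := iv_small (divr_gt0 e0 (ltr0n _ 2)).
  exists N => m n Nm Nn.
  have [y [/= ym yn]] := @filter_ex _ F FF _ (filterI (hu m) (hu n)).
  have := @nr_tri _ y (u m) (u n); rewrite (nrBC y).
  by have := iv_le Nm; have := iv_le Nn; lra.
apply/cvg_ex; exists l; move=> B /nbhs_nrP[e e0 hB].
have [N hN] := iv_small (divr_gt0 e0 (ltr0n _ 2)).
have [N' hN'] := hl _ (divr_gt0 e0 (ltr0n _ 2)).
have := hu (maxn N N'); apply: filterS => y /= hy; apply: hB.
have := hN' _ (leq_maxr N N'); have := iv_le (leq_maxl N N').
have := @nr_tri _ (u (maxn N N')) l y; have := nrBC l (u (maxn N N')).
by lra.
Qed.

End topology.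

Lemma complete_cvs (V : completeNormedModType C) (u : nat -> V) :
  cau u -> exists l, cvs u l.
Proof.
move=> cu.
have cF : cauchy (u @ \oo).
  apply/cauchyP => _ /posC[e e0 ->]; have [N hN] := cu _ e0.
  exists (u N); exists N => // n /= Nn.
  by rewrite -ball_normE /ball_ /= nrE ltcR; apply: hN.
have /cvg_ex[l hl] : cvg (u @ \oo) by exact: cauchy_cvg.
exists l => e e0.
have /hl [N _ hN] : nbhs l [set y | nr (l - y) < e].
  by apply/nbhs_nrP; exists e.
by exists N => n /hN /=; rewrite nrBC.
Qed.

Lemma complete_cvsC (u : nat -> C) : cau u -> exists l, cvs u l.
Proof.
move=> cu.
have hr (v : nat -> R) : (forall e : R, 0 < e -> exists N, forall m n,
    (N <= m)%N -> (N <= n)%N -> `|v m - v n| < e) ->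
    exists l, forall e : R, 0 < e -> exists N, forall n, (N <= n)%N -> `|v n - l| < e.
  move=> cv.
  have cF : cauchy (v @ \oo).
    apply/cauchyP => e e0; have [N hN] := cv _ e0.
    exists (v N); exists N => // n /= Nn.
    by rewrite -ball_normE /ball_ /=; apply: hN.
  have /cvg_ex[l hl] : cvg (v @ \oo) by exact: cauchy_cvg.
  exists l => e e0.
  have /hl [N _ hN] : nbhs l [set y | `|l - y| < e].
    by apply/nbhs_ballP; exists e => // y; rewrite -ball_normE.
  by exists N => n /hN /=; rewrite distrC.
have [|a ha] := hr (fun n => complex.Re (u n)).
  move=> e /cu[N hN]; exists N => m n mN nN; apply: le_lt_trans (hN _ _ mN nN).
  by have := abs_Re_le_nr (u m - u n); rewrite !raddfB.
have [|b hb] := hr (fun n => complex.Im (u n)).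
  move=> e /cu[N hN]; exists N => m n mN nN; apply: le_lt_trans (hN _ _ mN nN).
  by have := Im_le_nr (u m - u n); rewrite !raddfB.
exists (a +i* b)%C => e e0; have e2 := divr_gt0 e0 (ltr0n R 2).
have [N hN] := ha _ e2; have [M hM] := hb _ e2; exists (maxn N M) => n.
rewrite geq_max => /andP[/hN h1 /hM h2].
rewrite (le_lt_trans (nr_Re_Im _))// !raddfB /= ?raddfN.
by move: h1 h2 => /=; lra.
Qed.

Section cvs.
Variable V : normedZmodType C.
Implicit Types u v : nat -> V.

Lemma cvs_uniq u l l' : cvs u l -> cvs u l' -> l = l'.
Proof.
move=> h h'; apply/eqP; rewrite -subr_eq0; apply/eqP/nr_small_eq0 => e e0.
have e2 := divr_gt0 e0 (ltr0n R 2).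
have [N hN] := h _ e2; have [M hM] := h' _ e2.
have := hN _ (leq_maxl N M); have := hM _ (leq_maxr N M).
by have := nr_tri (u (maxn N M)) l l'; have := nrBC l (u (maxn N M)); lra.
Qed.

Lemma cvs_cau u l : cvs u l -> cau u.
Proof.
move=> h e e0; have e2 := divr_gt0 e0 (ltr0n R 2).
have [N hN] := h _ e2; exists N => m n /hN hm /hN hn.
by have := nr_tri l (u m) (u n); have := nrBC l (u n); lra.
Qed.

Lemma cvs_cst (l : V) : cvs (fun=> l) l.
Proof. by move=> e e0; exists 0%N => n _; rewrite subrr nr0. Qed.

Lemma cvsD u v l m : cvs u l -> cvs v m -> cvs (fun n => u n + v n) (l + m).
Proof.
move=> h h' e e0; have e2 := divr_gt0 e0 (ltr0n R 2).
have [N hN] := h _ e2; have [M hM] := h' _ e2; exists (maxn N M) => n.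
rewrite geq_max => /andP[/hN h1 /hM h2].
rewrite opprD addrACA (le_lt_trans (nrD _ _))//; lra.
Qed.

Lemma cvs_lip (W : normedZmodType C) (f : V -> W) K u l :
  (forall x y, nr (f x - f y) <= K * nr (x - y)) -> cvs u l ->
  cvs (f \o u) (f l).
Proof.
move=> hf h e e0; have K1 : 0 < `|K| + 1 by rewrite ltr_wpDl.
have [N hN] := h _ (divr_gt0 e0 K1); exists N => n /hN.
rewrite ltr_pdivlMr// => hn; apply: le_lt_trans (hf _ _) _.
apply: le_lt_trans hn; rewrite mulrC ler_wpM2l ?nr_ge0//.
by rewrite (le_trans (ler_norm _))// lerDl.
Qed.

Lemma cvs_le u l (c : R) : (forall n, nr (u n) <= c) -> cvs u l -> nr l <= c.
Proof.
move=> h hu; rewrite leNgt; apply/negP => cl.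
have /hu[N hN] : 0 < nr l - c by rewrite subr_gt0.
by have := hN _ (leqnn N); have := h N; have := nr_leD l (u N); rewrite nrBC; lra.
Qed.


End cvs.

Section total.
Variable I : Type.
Implicit Types (s t : seq (C * I)).

(** Keeping the list of coefficients apart from its value allows one list to be evaluated in two
    spaces; a linear map prescribed on generators is controlled by comparing the two values. *)
Definition lci (V : lmodType C) (f : I -> V) s := \sum_(p <- s) p.1 *: f p.2.

Definition scs (k : C) s := [seq (k * p.1, p.2) | p <- s].

Lemma lci_cat (V : lmodType C) (f : I -> V) s t :
  lci f (s ++ t) = lci f s + lci f t.
Proof. by rewrite /lci big_cat. Qed.

Lemma lci_scs (V : lmodType C) (f : I -> V) k s :
  lci f (scs k s) = k *: lci f s.
Proof.
by rewrite /lci big_map scaler_sumr; apply: eq_bigr => p _; rewrite scalerA.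
Qed.

Lemma lci1 (V : lmodType C) (f : I -> V) i : lci f [:: (1, i)] = f i.
Proof. by rewrite /lci big_seq1 scale1r. Qed.

Lemma lci_lin (V W : lmodType C) (L : V -> W) (f : I -> V) s :
  linear L -> L (lci f s) = lci (L \o f) s.
Proof.
move=> lL; have L0 : L 0 = 0.
  by have := lL (-1) 0 0; rewrite scaleN1r oppr0 addr0 scaleN1r addNr.
rewrite /lci; elim: s => [|p s IH]; first by rewrite !big_nil.
by rewrite !big_cons lL IH.
Qed.

Definition total (V : normedModType C) (f : I -> V) :=
  forall (x : V) (e : R), 0 < e -> exists s, nr (x - lci f s) < e.

Lemma total_ind (V : normedModType C) (f : I -> V) (P : V -> Prop) :
  total f ->
  (forall x, (forall e : R, 0 < e -> exists2 y, P y & nr (x - y) < e) -> P x) ->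
  P 0 -> (forall k x y, P x -> P y -> P (k *: x + y)) ->
  (forall i, P (f i)) -> forall x, P x.
Proof.
move=> tf cP P0 PD Pf x; apply: cP => e e0; have [s hs] := tf x e e0.
exists (lci f s) => //; elim: s {hs} => [|p s IH]; first by rewrite /lci big_nil.
by rewrite /lci big_cons; apply: PD.
Qed.

(** The bound makes the prescription well defined on the span, since a combination that is small for
    [f] is small for [g]; completeness of [W] extends it to the closure. *)
Lemma ext_total (V : normedModType C) (W : completeNormedModType C)
    (f : I -> V) (g : I -> W) (M : R) :
  total f -> 0 <= M -> (forall s, nr (lci g s) <= M * nr (lci f s)) ->
  exists L : V -> W, [/\ linear L, forall x, nr (L x) <= M * nr x &
    forall i, L (f i) = g i].
Proof.
move=> tf M0 hM.
have gs (x : V) s t : nr (lci g s - lci g t) <=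
    M * (nr (x - lci f s) + nr (x - lci f t)).
  rewrite -scaleN1r -lci_scs -lci_cat (le_trans (hM _))// ler_wpM2l//.
  rewrite lci_cat lci_scs scaleN1r (le_trans (nr_tri x _ _))//.
  by rewrite (nrBC x (lci f s)).
(* The value at x is pinned down by lists that approximate x through [f] and the value through [g]
   at the same time. *)
have /choice[L hL] : forall x, exists y, forall e : R, 0 < e ->
    exists2 s, nr (x - lci f s) < e & nr (y - lci g s) < e.
  move=> x.
  have /choice[s hs] : forall n : nat, exists s, nr (x - lci f s) < iv n.
    by move=> n; apply: tf; exact: iv_gt0.
  have [|y hy] := @complete_cvs W (fun n => lci g (s n)).
    have M1 : 0 < M + 1 by rewrite ltr_wpDl.
    move=> e e0; have e2 : 0 < e / 2 / (M + 1) by rewrite !divr_gt0.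
    have [N hN] := iv_small e2; exists N => m n Nm Nn.
    rewrite (le_lt_trans (gs x _ _))//.
    have h1 := ltW (lt_le_trans (hs m) (iv_le Nm)).
    have h2 := ltW (lt_le_trans (hs n) (iv_le Nn)).
    rewrite (le_lt_trans (ler_wpM2l M0 (lerD h1 h2)))//.
    by move: hN; rewrite ltr_pdivlMr// mulrDr mulr1; have := iv_gt0 N; lra.
  exists y => e e0; have [N hN] := iv_small e0; have [N' hN'] := hy _ e0.
  exists (s (maxn N N')).
    apply: lt_trans (hs _) _; apply: le_lt_trans hN.
    by apply: iv_le; rewrite leq_maxl.
  by rewrite nrBC hN'// leq_maxr.
have A x s : nr (L x - lci g s) <= M * nr (x - lci f s).
  apply: (@le_eps _ _ (1 + M)) => d d0; have [t h1 h2] := hL x d d0.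
  have := nr_tri (lci g t) (L x) (lci g s); have := gs x t s.
  have := ler_wpM2l M0 (ltW h1); rewrite mulrDr mulrDl mul1r.
  by lra.
have lL : linear L.
  move=> k x x'; apply/eqP; rewrite -subr_eq0; apply/eqP/nr_eq0/le_anti.
  rewrite nr_ge0 andbT.
  apply: (@le_eps _ _ (2 * (M * (nr k + 1)))) => d d0; rewrite add0r.
  have [s hs] := tf x d d0; have [s' hs'] := tf x' d d0.
  have dist (U : normedModType C) (h : I -> U) (y y' : U) :
      nr (k *: y + y' - lci h (scs k s ++ s')) <=
      nr k * nr (y - lci h s) + nr (y' - lci h s').
    by rewrite lci_cat lci_scs opprD addrACA -scalerBr -nrZ nrD.
  have := A (k *: x + x') (scs k s ++ s').
  have := ler_wpM2l M0 (dist _ f x x').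
  have := dist _ g (L x) (L x').
  have := nr_tri (lci g (scs k s ++ s')) (L (k *: x + x')) (k *: L x + L x').
  rewrite (nrBC (lci g (scs k s ++ s'))).
  have h1 := ler_wpM2l M0 (ltW hs); have h2 := ler_wpM2l M0 (ltW hs').
  have h3 := ler_wpM2l (nr_ge0 k) (le_trans (A x s) h1).
  have h4 := le_trans (A x' s') h2.
  have h5 := ler_wpM2l M0 (ler_wpM2l (nr_ge0 k) (ltW hs)).
  move: h3 h4 h5 h2; rewrite !mulrDr !mulrDl !mul1r.
  by lra.
have lB x y : L (x - y) = L x - L y.
  by have := lL (-1) y x; rewrite !scaleN1r [in L x - _]addrC [x - _]addrC.
exists L; split => //.
  move=> x; apply: (@le_eps _ _ (2 * M)) => d d0; have [s hs] := tf x d d0.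
  have := nr_leD (L x) (lci g s); have := A x s; have := hM s.
  have := nr_leD (lci f s) x; rewrite (nrBC _ x) => h1.
  have := ler_wpM2l M0 h1; have := ler_wpM2l M0 (ltW hs); rewrite mulrDr.
  by lra.
move=> i; apply/eqP; rewrite -subr_eq0; apply/eqP/nr_eq0/le_anti.
rewrite nr_ge0 andbT; have := A (f i) [:: (1, i)]; rewrite !lci1.
by rewrite [f i - _]subrr nr0 mulr0.
Qed.

End total.
End Norm.

(** * Multipliers *)

(* Identities in the K-module V are ring identities in the square-zero extension
   K (+) V, where [ring] applies. *)
Section Triv.
Variables (K : comNzRingType) (V : lmodType K).

Definition triv := (K * V)%type.
HB.instance Definition _ := GRing.Zmodule.on triv.
Definition triv_mul (x y : triv) : triv := (x.1 * y.1, x.1 *: y.2 + y.1 *: x.2).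
Definition triv_one : triv := (1, 0).

Fact triv_mulA : associative triv_mul.
Proof.
move=> [a x] [b y] [c z]; rewrite /triv_mul /=; congr (_, _); first exact: mulrA.
by rewrite !scalerDr !scalerA addrA (mulrC c a) (mulrC c b).
Qed.
Fact triv_mulC : commutative triv_mul.
Proof.
move=> [a x] [b y]; rewrite /triv_mul /=; congr (_, _); first exact: mulrC.
by rewrite addrC.
Qed.
Fact triv_mul1 : left_id triv_one triv_mul.
Proof.
move=> [a x]; rewrite /triv_mul /=; congr (_, _); first exact: mul1r.
by rewrite scale1r scaler0 addr0.
Qed.
Fact triv_mulDl : left_distributive triv_mul +%R.
Proof.
move=> [a x] [b y] [c z]; rewrite /triv_mul /=; congr (_, _); first exact: mulrDl.
by rewrite scalerDl scalerDr addrACA.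
Qed.
Fact triv_neq0 : triv_one != 0.
Proof. by apply/eqP => -[/eqP]; rewrite oner_eq0. Qed.
HB.instance Definition _ := GRing.Zmodule_isComNzRing.Build triv
  triv_mulA triv_mulC triv_mul1 triv_mulDl triv_neq0.

Definition tinj (v : V) : triv := (0, v).
Definition tcst (k : K) : triv := (k, 0).
Fact tcst_zmod : zmod_morphism tcst.
Proof. by move=> a b; rewrite /tcst; congr (_, _); rewrite /= subr0. Qed.
HB.instance Definition _ := GRing.isZmodMorphism.Build K triv tcst tcst_zmod.
Fact tcst_mul : monoid_morphism tcst.
Proof.
split=> // a b; rewrite /tcst; congr (_, _); rewrite /=.
by rewrite !scaler0 addr0.
Qed.
HB.instance Definition _ := GRing.isMonoidMorphism.Build K triv tcst tcst_mul.

Lemma tinjI x y : tinj x = tinj y -> x = y.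
Proof. by case. Qed.
Lemma tinjD x y : tinj (x + y) = tinj x + tinj y.
Proof. by rewrite /tinj; congr (_, _); rewrite /= addr0. Qed.
Lemma tinjN x : tinj (- x) = - tinj x.
Proof. by rewrite /tinj; congr (_, _); rewrite /= oppr0. Qed.
Lemma tinj0 : tinj 0 = 0.
Proof. by []. Qed.
Lemma tinjZ k x : tinj (k *: x) = tcst k * tinj x.
Proof.
rewrite /tinj /tcst; congr (_, _); first by rewrite /= mulr0.
by rewrite /= scale0r addr0.
Qed.
Lemma tinjMn x n : tinj (x *+ n) = tinj x *+ n.
Proof. by elim: n => // n IH; rewrite !mulrS tinjD IH. Qed.
Definition tinjE := (tinjD, tinjN, tinj0, tinjZ, tinjMn).
End Triv.

Ltac lmod := apply: tinjI; rewrite ?tinjE; ring.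

(** * Elementary identities and norm equalities in C*-algebras *)

Section StarAlg.
Context (R : realType).
Local Notation C := R[i].

Section basic.
Variable A : starAlgType R.
Implicit Types (a b : A) (k : C).

Lemma amul0l a : 0 ** a = 0.
Proof. by rewrite -{1}(scale0r (0 : A)) amulZl scale0r. Qed.
Lemma amul0r a : a ** 0 = 0.
Proof. by rewrite -{1}(scale0r (0 : A)) amulZr scale0r. Qed.
Lemma amulNl a b : (- a) ** b = - (a ** b).
Proof. by rewrite -scaleN1r amulZl scaleN1r. Qed.
Lemma amulNr a b : a ** (- b) = - (a ** b).
Proof. by rewrite -scaleN1r amulZr scaleN1r. Qed.
Lemma amulBl a b c : (a - b) ** c = a ** c - b ** c.
Proof. by rewrite amulDl amulNl. Qed.
Lemma amulBr a b c : a ** (b - c) = a ** b - a ** c.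
Proof. by rewrite amulDr amulNr. Qed.
Lemma star0 : star (0 : A) = 0.
Proof. by rewrite -{1}(scale0r (0 : A)) starZ conjC0 scale0r. Qed.
Lemma starN a : star (- a) = - star a.
Proof. by rewrite -scaleN1r starZ rmorphN rmorph1 scaleN1r. Qed.
Lemma starB a b : star (a - b) = star a - star b.
Proof. by rewrite starD starN. Qed.
Lemma conjR (r : R) : Num.conj (r%:C%C : C) = r%:C%C.
Proof. by rewrite conj_Creal// complex_real eqxx. Qed.
Lemma starZR (r : R) a : star (r%:C%C *: a) = r%:C%C *: star a.
Proof. by rewrite starZ conjR. Qed.

Lemma amul_sumr I (s : seq I) (f : I -> A) a :
  a ** (\sum_(i <- s) f i) = \sum_(i <- s) a ** f i.
Proof. by elim/big_rec2: _ => [|i x y _ <-]; rewrite ?amul0r ?amulDr. Qed.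
Lemma amul_suml I (s : seq I) (f : I -> A) a :
  (\sum_(i <- s) f i) ** a = \sum_(i <- s) f i ** a.
Proof. by elim/big_rec2: _ => [|i x y _ <-]; rewrite ?amul0l ?amulDl. Qed.
Lemma star_sum I (s : seq I) (f : I -> A) :
  star (\sum_(i <- s) f i) = \sum_(i <- s) star (f i).
Proof. by elim/big_rec2: _ => [|i x y _ <-]; rewrite ?star0 ?starD. Qed.

Definition amulE := (@amulDl R A, @amulDr R A, amulNl, amulNr, @amulZl R A, @amulZr R A, amul0l, amul0r).

End basic.

Section cstar.
Variable A : cstarAlgType R.
Implicit Types (a b : A).

Lemma nr_amul a b : nr (a ** b) <= nr a * nr b.
Proof. by rewrite -lecR rmorphM /= -!nrE norm_amul. Qed.
Lemma nr_star_amul a : nr (star a ** a) = nr a ^+ 2.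
Proof. by apply: complexI; rewrite rmorphXn /= -!nrE norm_star_amul. Qed.
Lemma nr_star_le a : nr a <= nr (star a).
Proof.
have [->|a0] := eqVneq a 0; first by rewrite star0.
have h : 0 < nr a.
  by rewrite lt_def nr_ge0 andbT; apply: contraNneq a0 => /nr_eq0 ->.
by rewrite -(ler_pM2r h) -expr2 -nr_star_amul nr_amul.
Qed.
Lemma nr_star a : nr (star a) = nr a.
Proof. by apply/le_anti; rewrite nr_star_le -{2}[a]starK nr_star_le. Qed.
Lemma nr_amul_star a : nr (a ** star a) = nr a ^+ 2.
Proof. by rewrite -{1}[a]starK nr_star_amul nr_star. Qed.

End cstar.
End StarAlg.

(** * Bounds, limits and square roots of multipliers *)

Section Mult.
Context (R : realType) (A : cstarAlgType R).
Local Notation C := R[i].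
Local Notation M := (multiplier A).
Local Notation "1m" := (mone A).
Implicit Types (m n k x y : M) (a b : A) (r s : R).

Lemma mul1m m : 1m ** m = m.
Proof. exact: multiplierP. Qed.
Lemma mulm1 m : m ** 1m = m.
Proof. exact: multiplierP. Qed.
Lemma star1m : star 1m = 1m.
Proof. by apply: multiplierP => a /=; rewrite starK. Qed.

Lemma lmM m n a : lm (m ** n) a = lm m (lm n a). Proof. by []. Qed.
Lemma lmD m n a : lm (m + n) a = lm m a + lm n a. Proof. by []. Qed.
Lemma lmZ (c : C) m a : lm (c *: m) a = c *: lm m a. Proof. by []. Qed.
Lemma lmN m a : lm (- m) a = - lm m a. Proof. by rewrite -scaleN1r lmZ scaleN1r. Qed.
Lemma lmB m n a : lm (m - n) a = lm m a - lm n a. Proof. by rewrite lmD lmN. Qed.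
Lemma lm_zero a : lm (0 : M) a = 0. Proof. by []. Qed.
Lemma lm0 m : lm m 0 = 0.
Proof. by have := lmP m (-1) 0 0; rewrite scaleN1r oppr0 addr0 scaleN1r addNr. Qed.
Lemma lm_D m a b : lm m (a + b) = lm m a + lm m b.
Proof. by rewrite -[a]scale1r lmP !scale1r. Qed.
Lemma lm_Z m (c : C) a : lm m (c *: a) = c *: lm m a.
Proof. by rewrite -[c *: a]addr0 lmP lm0 addr0. Qed.
Lemma lm_N m a : lm m (- a) = - lm m a.
Proof. by rewrite -scaleN1r lm_Z scaleN1r. Qed.
Lemma lm_B m a b : lm m (a - b) = lm m a - lm m b.
Proof. by rewrite lm_D lm_N. Qed.
Lemma lm_star m a b : star a ** lm m b = star (lm (star m) a) ** b.
Proof. by rewrite centralizer /= starK. Qed.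
Lemma rmE m a : rm m a = star (lm (star m) (star a)).
Proof. by rewrite /= !starK. Qed.

Lemma membed_lm m a : m ** membed a = membed (lm m a).
Proof. by apply: multiplierP => b /=; rewrite lmA. Qed.
Lemma membed_rm m a : membed a ** m = membed (rm m a).
Proof. by apply: multiplierP => b /=; rewrite centralizer. Qed.
Lemma membed_hom : starhom (@membed R A).
Proof.
split=> [k a b|a b|a]; apply: multiplierP => c /=.
- by rewrite amulDl amulZl.
- by rewrite amulA.
- by rewrite starM !starK.
Qed.
Lemma membed_inj : injective (@membed R A).
Proof. by move=> a b e; apply: amulr_inj => c; have := congr1 (fun m => lm m c) e. Qed.

(* Boundedness is automatic for double centralizers, but it is cheaper to carry it
   along, with an explicit bound, than to prove the closed graph theorem. *)
Definition bnd m r := forall b, nr (lm m b) <= r * nr b.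
Definition bd m := exists2 r, 0 <= r & bnd m r.

Lemma bnd_le m r s : r <= s -> bnd m r -> bnd m s.
Proof. by move=> rs h b; rewrite (le_trans (h b))// ler_wpM2r ?nr_ge0. Qed.
Lemma bndD m n r s : bnd m r -> bnd n s -> bnd (m + n) (r + s).
Proof. by move=> h h' b; rewrite mulrDl (le_trans (nrD _ _))// lerD. Qed.
Lemma bndZ (c : C) m r : bnd m r -> bnd (c *: m) (nr c * r).
Proof. by move=> h b; rewrite lmZ nrZ -mulrA ler_wpM2l ?nr_ge0. Qed.
Lemma bndN m r : bnd m r -> bnd (- m) r.
Proof. by move=> h b; rewrite lmN nrN. Qed.
Lemma bndB m n r s : bnd m r -> bnd n s -> bnd (m - n) (r + s).
Proof. by move=> h h'; apply: bndD => //; apply: bndN. Qed.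
Lemma bndM m n r s : 0 <= r -> bnd m r -> bnd n s -> bnd (m ** n) (r * s).
Proof.
by move=> r0 h h' b; rewrite lmM (le_trans (h _))// -mulrA ler_wpM2l.
Qed.
Lemma bnd1 : bnd 1m 1. Proof. by move=> b; rewrite mul1r. Qed.
Lemma bnd0 : bnd 0 0. Proof. by move=> b; rewrite lm_zero nr0 mul0r. Qed.
Lemma bnd_eq0 m : bnd m 0 -> m = 0.
Proof.
move=> h; apply: multiplierP => b; apply: nr_eq0; apply/le_anti.
by rewrite nr_ge0 andbT (le_trans (h b))// mul0r.
Qed.
Lemma bnd_membed a : bnd (membed a) (nr a).
Proof. by move=> b; rewrite nr_amul. Qed.
Lemma bnd_membed_le a r : 0 <= r -> bnd (membed a) r -> nr a <= r.
Proof.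
move=> r0 h; have := h (star a); rewrite /= nr_amul_star nr_star expr2.
have [-> //|a0] := eqVneq (nr a) 0.
by rewrite ler_pM2r// lt_def a0 nr_ge0.
Qed.

Lemma nr_lm_sq m b : nr (lm m b) ^+ 2 = nr (star b ** lm (star m ** m) b).
Proof. by rewrite -nr_star_amul lmM [in RHS]lm_star starK. Qed.
Lemma bnd_sq m r : 0 <= r -> bnd (star m ** m) (r ^+ 2) -> bnd m r.
Proof.
move=> r0 h b; rewrite -ler_sqr ?nnegrE ?mulr_ge0 ?nr_ge0// nr_lm_sq.
rewrite (le_trans (nr_amul _ _))// nr_star exprMn mulrC expr2 [in leRHS]expr2.
by rewrite [leRHS]mulrA ler_wpM2r ?nr_ge0// -expr2.
Qed.
Lemma bnd_star m r : 0 <= r -> bnd m r -> bnd (star m) r.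
Proof.
move=> r0 h b; have := nr_lm_sq (star m) b; rewrite starK lmM.
set c := lm (star m) b => e.
have : nr c ^+ 2 <= (r * nr b) * nr c.
  rewrite e (le_trans (nr_amul _ _))// nr_star (mulrC r) -mulrA.
  by rewrite ler_wpM2l ?nr_ge0.
have [->|c0] := eqVneq (nr c) 0; first by rewrite mulr_ge0 ?nr_ge0.
by rewrite expr2 ler_pM2r// lt_def c0 nr_ge0.
Qed.
Lemma mstar_mul0 m : star m ** m = 0 -> m = 0.
Proof.
move=> h; apply: bnd_eq0; apply: bnd_sq => //; rewrite h expr0n.
exact: bnd0.
Qed.

Lemma bdD m n : bd m -> bd n -> bd (m + n).
Proof. by move=> [r r0 h] [s s0 h']; exists (r + s); [exact: addr_ge0|exact: bndD]. Qed.
Lemma bdZ (c : C) m : bd m -> bd (c *: m).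
Proof. by move=> [r r0 h]; exists (nr c * r); [rewrite mulr_ge0 ?nr_ge0|exact: bndZ]. Qed.
Lemma bdN m : bd m -> bd (- m).
Proof. by move=> [r r0 h]; exists r => //; exact: bndN. Qed.
Lemma bdM m n : bd m -> bd n -> bd (m ** n).
Proof. by move=> [r r0 h] [s s0 h']; exists (r * s); [exact: mulr_ge0|exact: bndM]. Qed.
Lemma bd_star m : bd m -> bd (star m).
Proof. by move=> [r r0 h]; exists r => //; exact: bnd_star. Qed.
Lemma bd1 : bd 1m. Proof. by exists 1 => //; exact: bnd1. Qed.
Lemma bd_membed a : bd (membed a).
Proof. by exists (nr a); [exact: nr_ge0|exact: bnd_membed]. Qed.

(** Moving m to the left factor gives continuity without a bound on m. *)
Lemma lm_lim m (u : nat -> A) l c : cvs u l -> cvs (fun i => c ** lm m (u i)) (c ** lm m l).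
Proof.
move=> h; rewrite centralizer.
have -> : (fun i => c ** lm m (u i)) = (fun x : A => rm m c ** x) \o u.
  by apply/funext => i /=; rewrite centralizer.
apply: (@cvs_lip R _ _ _ (nr (rm m c))) h => x y.
by rewrite -amulBr nr_amul.
Qed.

(** Pointwise limits of the left actions exist by completeness. The adjoints are Cauchy too, and
    their limit provides the right action that makes the first limit a double centralizer. *)
Lemma mlim (u : nat -> M) :
  (forall e : R, 0 < e -> exists N, forall i j, (N <= i)%N -> (N <= j)%N ->
    bnd (u i - u j) e) ->
  exists l, forall e : R, 0 < e -> exists N, forall i, (N <= i)%N -> bnd (u i - l) e.
Proof.
move=> hu.
have cu (v : nat -> M) : (forall e : R, 0 < e -> exists N, forall i j,
    (N <= i)%N -> (N <= j)%N -> bnd (v i - v j) e) ->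
    forall b, exists l, cvs (fun i => lm (v i) b) l.
  move=> hv b; apply: complete_cvs => e e0.
  have b1 : 0 < nr b + 1 by rewrite ltr_wpDl ?nr_ge0.
  have [N hN] := hv _ (divr_gt0 e0 b1); exists N => i j Ni Nj.
  by rewrite -lmB (le_lt_trans (hN _ _ Ni Nj b))// divS_lt// nr_ge0.
have hu' e : 0 < e -> exists N, forall i j,
    (N <= i)%N -> (N <= j)%N -> bnd (star (u i) - star (u j)) e.
  move=> e0; have [N hN] := hu e e0; exists N => i j Ni Nj.
  by rewrite -starB; apply: bnd_star (hN _ _ Ni Nj); exact: ltW.
have [f hf] := choice (cu u hu); have [g hg] := choice (cu _ hu').
have cent a b : a ** f b = star (g (star a)) ** b.
  apply: (@cvs_uniq R _ (fun i => a ** lm (u i) b)).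
    apply: (@cvs_lip R _ _ _ (nr a)) (hf b) => x y.
    by rewrite -amulBr nr_amul.
  have -> : (fun i => a ** lm (u i) b) =
      (fun x : A => star x ** b) \o (fun i => lm (star (u i)) (star a)).
    by apply/funext => i /=; rewrite starK centralizer starK.
  apply: (@cvs_lip R _ _ _ (nr b)) (hg (star a)) => x y.
  by rewrite -amulBl -starB (le_trans (nr_amul _ _))// nr_star mulrC.
exists (Multiplier cent) => e e0; have [N hN] := hu e e0; exists N => i Ni b.
rewrite lmB /=.
apply: (@cvs_le R _ (fun j => lm (u i) b - lm (u (j + N)%N) b)).
  by move=> j; rewrite -lmB hN// leq_addl.
move=> d d0; have [K hK] := hf b d d0; exists K => j Kj.
rewrite (_ : _ - _ = - (lm (u (j + N)%N) b - f b)); last by lmod.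
by rewrite nrN hK// (leq_trans Kj)// leq_addr.
Qed.

Lemma bnd_closed m (u : nat -> M) r :
  (forall i, bnd (u i) r) ->
  (forall e : R, 0 < e -> exists N, forall i, (N <= i)%N -> bnd (u i - m) e) ->
  bnd m r.
Proof.
move=> hu hm b; apply: (@le_eps _ _ _ (nr b)) => d d0.
have [N hN] := hm d d0; have := hN N (leqnn N) b; have := hu N b.
by rewrite lmB; have := nr_leD (lm m b) (lm (u N) b); rewrite nrBC mulrC; lra.
Qed.

Lemma mlim_uniq (u : nat -> M) l l' :
  (forall e : R, 0 < e -> exists N, forall i, (N <= i)%N -> bnd (u i - l) e) ->
  (forall e : R, 0 < e -> exists N, forall i, (N <= i)%N -> bnd (u i - l') e) ->
  l = l'.
Proof.
move=> h h'; apply/eqP; rewrite -subr_eq0; apply/eqP/bnd_eq0 => b.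
rewrite mul0r; apply: (@le_eps _ _ _ (2 * nr b)) => d d0.
have [N hN] := h d d0; have [N' hN'] := h' d d0.
have := hN _ (leq_maxl N N') b; have := hN' _ (leq_maxr N N') b; rewrite !lmB.
by have := nr_tri (lm (u (maxn N N')) b) (lm l b) (lm l' b); rewrite (nrBC (lm l b)
  (lm (u _) b)); lra.
Qed.

Definition sR r : M := (r%:C%C : C) *: 1m.

Lemma bnd_sR r : 0 <= r -> bnd (sR r) r.
Proof. by move=> r0 b; rewrite lmZ nrZ nrR ger0_norm. Qed.
Lemma star_sR r : star (sR r) = sR r.
Proof. by rewrite starZR star1m. Qed.

Fixpoint sqs (s : nat) : R := if s is t.+1 then (1 + sqs t ^+ 2) / 2 else 0.
Lemma sqs_ge0 i : 0 <= sqs i.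
Proof. by case: i => //= i; rewrite divr_ge0// addr_ge0// sqr_ge0. Qed.
Lemma sqs_le1 i : sqs i <= 1.
Proof.
elim: i => //= i IH; have := sqs_ge0 i => h; rewrite ler_pdivrMr// mul1r.
by have := ler_pM h h IH IH; rewrite mulr1 expr2; lra.
Qed.
Lemma sqs_nd i : sqs i <= sqs i.+1.
Proof. by have := sqr_ge0 (1 - sqs i); rewrite /= sqrrB expr1n mul1r; lra. Qed.
Lemma sqs_cau : forall e : R, 0 < e ->
  exists N, forall i, (N <= i)%N -> forall j, (i <= j)%N -> sqs j - sqs i < e.
Proof.
have nd : {homo sqs : i j / (i <= j)%N >-> i <= j}.
  move=> i j /subnK <-; elim: (j - i)%N => // k IH.
  by rewrite addSn (le_trans IH)// sqs_nd.
have cv : cvgn sqs.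
  apply: nondecreasing_is_cvgn; first exact: nd.
  by exists 1 => _ [i _ <-]; exact: sqs_le1.
move=> e e0; have /cvgrPdist_lt/(_ e e0)[N _ hN] := cv; exists N => i Ni j ij.
have := hN i Ni; rewrite ger0_norm; last first.
  by rewrite subr_ge0; exact: nondecreasing_cvgn_le.
have := nondecreasing_cvgn_le nd cv j.
by rewrite /=; lra.
Qed.

Lemma half2 : (2^-1 : R)%:C%C + (2^-1 : R)%:C%C = 1 :> C.
Proof. by rewrite -rmorphD /= (_ : 2^-1 + 2^-1 = 1 :> R) ?rmorph1//; lra. Qed.

Lemma halfD m : (2^-1 : R)%:C%C *: (m + m) = m :> M.
Proof. by rewrite scalerDr -scalerDl half2 scale1r. Qed.

(* The iteration y <- (g + y^2)/2 from 0 has the power series of 1 - sqrt(1 - g)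
   as its limit, and is dominated by its scalar instance g = 1. *)
Lemma msqrt g : star g = g -> bnd g 1 ->
  exists y, [/\ star y = y, bnd y 1, (1m - y) ** (1m - y) = 1m - g,
    forall x, x ** g = g ** x -> x ** y = y ** x &
    forall h, g = membed h -> exists z, y = membed z].
Proof.
move=> gs g1; pose h2 : C := (2^-1 : R)%:C%C.
have nh : nr h2 = 2^-1 by rewrite nrR ger0_norm// invr_ge0.
pose y := fix y (i : nat) : M := if i is j.+1 then h2 *: (g + y j ** y j) else 0.
have yS i : y i.+1 = h2 *: (g + y i ** y i) by [].
have ys i : star (y i) = y i.
  by elim: i => [|i IH]; rewrite ?star0// yS starZR starD starM IH gs.
have yc x : x ** g = g ** x -> forall i, x ** y i = y i ** x.
  move=> xg; elim=> [|i IH]; first by rewrite amul0l amul0r.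
  by rewrite yS amulZr amulZl amulDr amulDl xg amulA IH -!amulA IH.
have yy i j : y i ** y j = y j ** y i by rewrite yc// yc.
have yb i : bnd (y i) (sqs i).
  elim: i => [|i IH]; first exact: bnd0.
  rewrite yS; apply: bnd_le (bndZ h2 (bndD g1 (bndM (sqs_ge0 i) IH IH))).
  by rewrite nh /= expr2; lra.
(* The iterates commute, so y_{i+2} - y_{i+1} is half of (y_{i+1} + y_i)(y_{i+1} - y_i); the bounds
   of the two factors multiply to the corresponding increment of [sqs]. *)
have yd i : bnd (y i.+1 - y i) (sqs i.+1 - sqs i).
  elim: i => [|i IH].
    rewrite subr0 subr0; exact: (yb 1).
  have -> : y i.+2 - y i.+1 = h2 *: ((y i.+1 + y i) ** (y i.+1 - y i)).
    rewrite (yS i.+1) {3}(yS i) -scalerBr; congr (_ *: _).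
    by rewrite amulBr !amulDl (yy i i.+1); lmod.
  apply: bnd_le (bndZ h2 (bndM _ (bndD (yb _) (yb _)) IH)); last first.
    by rewrite addr_ge0 ?sqs_ge0.
  rewrite nh; have: sqs i.+2 = (1 + sqs i.+1 ^+ 2) / 2 by [].
  have: sqs i.+1 = (1 + sqs i ^+ 2) / 2 by [].
  by move: (sqs i.+2) (sqs i.+1) (sqs i) => c a b; lra.
have ydd i j : bnd (y (i + j)%N - y i) (sqs (i + j) - sqs i).
  elim: j => [|j IH]; first by rewrite addn0 !subrr; exact: bnd0.
  rewrite addnS; have := bndD (yd (i + j)%N) IH.
  by rewrite addrA subrK addrA subrK.
have [l hl] : exists l, forall e : R, 0 < e ->
    exists N, forall i, (N <= i)%N -> bnd (y i - l) e.
  apply: mlim => e e0; have [N hN] := sqs_cau e0.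
  exists N => i j Ni Nj; wlog ij : i j Ni Nj / (i <= j)%N.
    move=> h; case/orP: (leq_total i j) => ij; first exact: h.
    by rewrite -opprB; apply: bndN; exact: h.
  rewrite -opprB; apply: bndN; have := ydd i (j - i)%N; rewrite subnKC//.
  by apply: bnd_le; apply/ltW/hN.
have yc1 b : cvs (fun i => lm (y i) b) (lm l b).
  move=> e e0; have b1 : 0 < nr b + 1 by rewrite ltr_wpDl ?nr_ge0.
  have [N hN] := hl _ (divr_gt0 e0 b1); exists N => i Ni.
  by rewrite -lmB (le_lt_trans (hN _ Ni b))// divS_lt// nr_ge0.
have l1 : bnd l 1.
  apply: bnd_closed hl => i; exact: bnd_le (sqs_le1 i) (yb i).
have ls : star l = l.
  apply: (mlim_uniq (u := y) _ hl) => e e0; have [N hN] := hl e e0.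
  exists N => i Ni; rewrite -{1}ys -starB; apply: bnd_star (hN _ Ni).
  exact: ltW.
have leq : l = h2 *: (g + l ** l).
  apply: (mlim_uniq (u := fun i => y i.+1)) => e e0.
    have [N hN] := hl e e0; exists N => i Ni; apply: hN.
    exact: leq_trans Ni (leqnSn _).
  have [N hN] := hl e e0; exists N => i Ni.
  have -> : y i.+1 - h2 *: (g + l ** l) =
      h2 *: (y i ** (y i - l) + (y i - l) ** l).
    by rewrite yS amulBr amulBl; lmod.
  apply: bnd_le (bndZ h2 (bndD (bndM ler01 (bnd_le (sqs_le1 i) (yb i)) (hN _ Ni))
    (bndM (ltW e0) (hN _ Ni) l1))).
  by rewrite nh; lra.
exists l; split => //.
- rewrite amulBl !amulBr !mul1m mulm1.
  have : h2 *: (g + l ** l) + h2 *: (g + l ** l) = g + l ** l.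
    by rewrite -scalerDr halfD.
  rewrite -leq => e; have -> : l ** l = l + l - g by rewrite e; lmod.
  by lmod.
- move=> x xg; apply: multiplierP => b; apply: amull_inj => c.
  apply: (@cvs_uniq R _ (fun i => c ** lm x (lm (y i) b))).
    exact: lm_lim (yc1 b).
  have := @cvs_lip R _ _ (fun z : A => c ** z) (nr c) _ _ _ (yc1 (lm x b)).
  have -> : (fun z : A => c ** z) \o (fun i => lm (y i) (lm x b)) =
     (fun i => c ** lm x (lm (y i) b)).
    by apply/funext => i /=; rewrite -!lmM yc.
  by apply=> u v; rewrite -amulBr nr_amul.
(* If g lies in A, so do all iterates, and convergence in the multiplier bound is convergence in the
   norm of A. *)
- move=> h gh.
  have /choice[z yz] : forall i, exists z, y i = membed z.
    elim=> [|i [z yz]]; first by exists 0; apply: multiplierP => b /=; rewrite amul0l.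
    exists (h2 *: (h + z ** z)); rewrite yS yz gh; apply: multiplierP => b /=.
    by rewrite amulZl amulDl amulA.
  have [|w zw] := @complete_cvs R A z.
    move=> e e0; have e2 : 0 < e / 2 / 2 by rewrite !divr_gt0.
    have [N hN] := hl _ e2; exists N => i j Ni Nj.
    have := bndB (hN _ Ni) (hN _ Nj); rewrite opprB addrA subrK !yz => hb.
    have {}hb : bnd (membed (z i - z j)) (e / 2 / 2 + e / 2 / 2).
      by move=> b; have := hb b; rewrite lmB /= amulBl.
    have := bnd_membed_le _ hb; have : 0 < e / 2 / 2 by [].
    by move=> h1 /(_ (addr_ge0 (ltW h1) (ltW h1))); lra.
  exists w; apply: multiplierP => b /=.
  apply: (@cvs_uniq R _ (fun i => lm (y i) b)) => //.
  have -> : (fun i => lm (y i) b) = (fun x : A => x ** b) \o z.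
    by apply/funext => i /=; rewrite yz.
  apply: (@cvs_lip R _ _ _ (nr b)) zw => u v.
  by rewrite -amulBl mulrC nr_amul.
Qed.

End Mult.

(** * Positivity and approximate units *)

Section Pos.
Context (R : realType) (A : cstarAlgType R).
Local Notation C := R[i].
Local Notation M := (multiplier A).
Local Notation "1m" := (mone A).
Implicit Types (m n k x y : M) (a b : A) (r s t : R).

Lemma sR1 : sR A 1 = 1m. Proof. exact: scale1r. Qed.
Lemma sRD r s : sR A (r + s) = sR A r + sR A s.
Proof. by rewrite /sR rmorphD scalerDl. Qed.

Lemma conj_i : Num.conj ('i%C : C) = - 'i%C.
Proof. by rewrite /Num.conj /= /conjc /=; apply/eqP; rewrite eq_complex /= oppr0 !eqxx. Qed.
Lemma mul_ii : ('i%C : C) * 'i%C = -1.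
Proof. by rewrite -expr2 sqr_i. Qed.

(* k + iw is r times a unitary *)
Lemma unitary_bnd r k (w : M) : 0 <= r -> star k = k -> star w = w ->
  k ** w = w ** k -> k ** k + w ** w = sR A (r ^+ 2) -> bnd k r.
Proof.
move=> r0 ks ws kw e; pose i : C := 'i%C.
have ii : i * i = -1 := mul_ii.
have H (u v : M) : star u = v -> v ** u = sR A (r ^+ 2) -> bnd u r.
  by move=> <- h; apply: bnd_sq => //; rewrite h; apply: bnd_sR; exact: sqr_ge0.
have su : star (k + i *: w) = k - i *: w.
  by rewrite starD starZ ks ws conj_i scaleNr.
have hu : bnd (k + i *: w) r.
  apply: (H _ _ su); rewrite !amulE scalerA ii kw -e; lmod.
have hv : bnd (k - i *: w) r.
  by rewrite -su; apply: bnd_star.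
have -> : k = (2^-1 : R)%:C%C *: ((k + i *: w) + (k - i *: w)).
  by rewrite addrACA subrr addr0 halfD.
apply: bnd_le (bndZ _ (bndD hu hv)).
by rewrite nrR ger0_norm ?invr_ge0//; lra.
Qed.

(** Positivity is being a square; that sums and the elements x^* x have this form remains to be
    proved. *)
Definition pos m := exists k, [/\ star k = k, bd k & m = k ** k].

Lemma pos_sa m : pos m -> star m = m.
Proof. by move=> [k [ks _ ->]]; rewrite starM ks. Qed.
Lemma pos_bd m : pos m -> bd m.
Proof. by move=> [k [_ kb ->]]; exact: bdM. Qed.
Lemma pos0 : pos 0.
Proof. by exists 0; split; rewrite ?star0 ?amul0l//; exists 0 => //; exact: bnd0. Qed.
Lemma posZ r m : 0 <= r -> pos m -> pos (r%:C%C *: m).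
Proof.
move=> r0 [k [ks kb ->]]; exists ((Num.sqrt r)%:C%C *: k); split.
- by rewrite starZR ks.
- exact: bdZ.
- by rewrite amulZl amulZr scalerA -rmorphM /= -expr2 sqr_sqrtr.
Qed.

Lemma bd_pos m : bd m -> exists2 r, 0 < r & bnd m r.
Proof.
by move=> [r r0 h]; exists (r + 1); [rewrite ltr_wpDl|apply: bnd_le h; rewrite lerDl].
Qed.

Lemma RCK r : r != 0 -> (r%:C%C : C) * (r^-1)%:C%C = 1.
Proof. by move=> r0; rewrite -rmorphM /= mulfV. Qed.

(** The bound |r - m| <= r is an order-free criterion for positivity: 1 - m/r is a contraction, and
    sqrt(r)(1 - y) is a root of m, with y from [msqrt]. The bound on the root has the same shape, so
    that roots can be iterated. *)
Lemma pos_of_bnd m r : 0 < r -> star m = m -> bnd (sR A r - m) r ->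
  exists k, [/\ star k = k, bd k, m = k ** k, bnd (sR A (Num.sqrt r) - k) (Num.sqrt r) &
    forall x, x ** m = m ** x -> x ** k = k ** x].
Proof.
move=> r0 ms mb; have rn : r != 0 by rewrite gt_eqF.
have [||y [ys y1 yy yc _]] := @msqrt R A (1m - (r^-1)%:C%C *: m).
- by rewrite starB star1m starZR ms.
- have -> : 1m - (r^-1)%:C%C *: m = (r^-1)%:C%C *: (sR A r - m).
    by rewrite scalerBr scalerA mulrC RCK// scale1r.
  apply: bnd_le (bndZ _ mb); rewrite nrR ger0_norm ?mulVf ?invr_ge0 ?(ltW r0)//.
exists ((Num.sqrt r)%:C%C *: (1m - y)); split.
- by rewrite starZR starB star1m ys.
- by apply: bdZ; apply: bdD; [exact: bd1|apply: bdN; exists 1].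
- rewrite amulZl amulZr scalerA -rmorphM /= -expr2 sqr_sqrtr ?ltW// yy.
  by rewrite opprB addrC subrK scalerA RCK// scale1r.
- rewrite /sR -scalerBr opprB addrC subrK.
  apply: bnd_le (bndZ _ y1); rewrite nrR ger0_norm ?mulr1//; exact: sqrtr_ge0.
- move=> x xm; rewrite amulZl amulZr !amulE mul1m mulm1 yc//.
  by rewrite !amulE xm mul1m mulm1.
Qed.

(** Converse of [pos_of_bnd]: w = sqrt(r)(1 - y) commutes with k and satisfies w^2 + k^2 = r, so
    [unitary_bnd] gives |w| <= sqrt(r), and r - k^2 = w^2. *)
Lemma bnd_of_sq k r : 0 < r -> star k = k -> bnd (k ** k) r -> bnd (sR A r - k ** k) r.
Proof.
move=> r0 ks kb; have rn : r != 0 by rewrite gt_eqF.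
pose c : C := (r^-1)%:C%C.
have [||y [ys y1 yy yc _]] := @msqrt R A (c *: (k ** k)).
- by rewrite starZR starM ks.
- apply: bnd_le (bndZ _ kb); rewrite nrR ger0_norm ?mulVf ?invr_ge0 ?(ltW r0)//.
have yk : k ** y = y ** k by apply: yc; rewrite amulZl amulZr amulA.
have h : bnd ((Num.sqrt r)%:C%C *: (1m - y)) (Num.sqrt r).
  apply: (@unitary_bnd _ _ k); rewrite ?sqrtr_ge0//.
  - by rewrite starZR starB star1m ys.
  - by rewrite amulZl amulZr !amulE mul1m mulm1 yk.
  - rewrite amulZl amulZr scalerA -rmorphM /= -expr2 sqr_sqrtr ?ltW// yy.
    by rewrite scalerBr scalerA RCK// scale1r subrK.
have := bndM (sqrtr_ge0 _) h h; rewrite -expr2 sqr_sqrtr ?ltW//.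
rewrite amulZl amulZr scalerA -rmorphM /= -expr2 sqr_sqrtr ?ltW// yy.
by rewrite scalerBr scalerA RCK// scale1r.
Qed.

Lemma pos_bnd m r : 0 < r -> pos m -> bnd m r -> bnd (sR A r - m) r.
Proof. by move=> r0 [k [ks kb ->]]; exact: bnd_of_sq. Qed.

Lemma pos_root m : pos m -> exists k, [/\ star k = k, bd k, m = k ** k &
  forall x, x ** m = m ** x -> x ** k = k ** x].
Proof.
move=> pm; have [r r0 mb] := bd_pos (pos_bd pm).
have [k [h1 h2 h3 _ h4]] := pos_of_bnd r0 (pos_sa pm) (pos_bnd r0 pm mb).
by exists k.
Qed.

(** The criteria |r - m| <= r and |s - n| <= s add up. *)
Lemma posD m n : pos m -> pos n -> pos (m + n).
Proof.
move=> pm pn; have [r r0 mr] := bd_pos (pos_bd pm); have [s s0 ns] := bd_pos (pos_bd pn).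
have [|||k [h1 h2 h3 _ _]] := @pos_of_bnd (m + n) (r + s).
- exact: addr_gt0.
- by rewrite starD !pos_sa.
- by rewrite sRD opprD addrACA; apply: bndD; exact: pos_bnd.
by exists k.
Qed.

Lemma pos_sRB m r : 0 < r -> star m = m -> bnd m r -> pos (sR A r - m).
Proof.
move=> r0 ms mr; have [||k [h1 h2 h3 _ _]] := @pos_of_bnd (sR A r - m) r r0.
- by rewrite starB star_sR ms.
- by rewrite opprB addrC subrK.
by exists k.
Qed.

(** With k a root of m and w a root of r - m, k + iw is sqrt(r) times a unitary. *)
Lemma pos_le_bnd m r : 0 <= r -> pos m -> pos (sR A r - m) -> bnd m r.
Proof.
move=> r0 [k [ks kb ->]] /pos_root[w [ws wb e wc]].
have kw : k ** w = w ** k.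
  by apply: wc; rewrite !amulE amulA mul1m mulm1.
have h : bnd k (Num.sqrt r).
  apply: (@unitary_bnd _ _ w); rewrite ?sqrtr_ge0//.
  by rewrite sqr_sqrtr// -e addrC subrK.
by have := bndM (sqrtr_ge0 _) h h; rewrite -expr2 sqr_sqrtr.
Qed.

(** r + d - m is the sum of r + d - (m + n) and n. The slack d provides the strictly positive radius
    that [pos_sRB] asks for. *)
Lemma posD_bnd m n r : 0 <= r -> pos m -> pos n -> bnd (m + n) r -> bnd m r.
Proof.
move=> r0 pm pn h b; apply: (@le_eps _ _ _ (nr b)) => d d0.
suff /(_ b) : bnd m (r + d) by rewrite mulrDl (mulrC d).
have rd : 0 < r + d by rewrite ltr_wpDl.
apply: pos_le_bnd => //; first exact: ltW.
have -> : sR A (r + d) - m = (sR A (r + d) - (m + n)) + n by lmod.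
apply: posD => //; apply: pos_sRB => //; first by rewrite starD !pos_sa.
by apply: bnd_le h; rewrite lerDl ltW.
Qed.

Lemma sa_sq0 m : star m = m -> m ** m = 0 -> m = 0.
Proof. by move=> ms m0; apply: mstar_mul0; rewrite ms. Qed.

Lemma bnd_natZ0 m r : (forall i : nat, bnd ((i%:R : R)%:C%C *: m) r) -> m = 0.
Proof.
move=> h; apply: bnd_eq0 => b; rewrite mul0r; apply: (@le_eps _ _ _ (r * nr b)) => d d0.
have [i hi] := iv_small d0; have := h i.+1 b; rewrite lmZ nrZ nrR ger0_norm// add0r.
rewrite -ler_pdivlMl// => /le_trans; apply; rewrite mulrC ler_wpM2l//; last exact: ltW.
by have := h 0%N b; rewrite lmZ nrZ nrR normr0 mul0r.
Qed.

(* z* z = - e^2 and z z* >= 0 intertwine via z; comparing the powers of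
   1 - zz*/t and 1 + e^2/t bounds e^2 (1 + e^2/t)^i uniformly in i. *)
Lemma star_mul_npos (z e : M) : bd z -> star e = e -> bd e ->
  star z ** z = - (e ** e) -> pos (z ** star z) -> e = 0.
Proof.
move=> zb es eb ze pz; have [t t0 zt] := bd_pos (pos_bd pz).
have tn : t != 0 by rewrite gt_eqF.
pose c : C := (t^-1)%:C%C; pose sc : C := (Num.sqrt t^-1)%:C%C.
have scE : sc * sc = c by rewrite -rmorphM /= -expr2 sqr_sqrtr// invr_ge0 ltW.
pose E := c *: (e ** e); pose K := 1m - c *: (z ** star z).
have K1 : bnd K 1.
  have -> : K = c *: (sR A t - z ** star z).
    by rewrite scalerBr scalerA mulrC RCK// scale1r.
  apply: bnd_le (bndZ _ (pos_bnd t0 pz zt)); rewrite nrR ger0_norm ?mulVf ?invr_ge0 ?(ltW t0)//.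
have Kz : K ** z = z + z ** E.
  rewrite !amulE mul1m -amulA ze !amulE; lmod.
pose y := sc *: e.
have yy x : x ** y ** (x ** y) = x ** y ** (x ** y) by [].
(* [D x i] is x^2 (1 + E)^i with E = e^2/t, built by additions only. A factor E is absorbed into x
   as y^2, where y = e/sqrt(t), so that every summand stays a square. *)
pose D := fix D (x : M) (i : nat) : M := if i is j.+1 then D x j + D x j ** E else x ** x.
have DD x i : star x = x -> x ** e = e ** x -> D x i ** E = D (x ** y) i.
  move=> xs xe; elim: i => [|i IH] /=; last by rewrite amulDl !IH.
  rewrite /E /y !amulZr !amulZl scalerA scE -!amulA; congr (_ *: (_ ** _)).
  by rewrite !amulA xe.
have step x : star x = x -> x ** e = e ** x -> bd x ->
    [/\ star (x ** y) = x ** y, x ** y ** e = e ** (x ** y) & bd (x ** y)].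
  move=> xs xe xb; split.
  - by rewrite starM starZR xs es amulZl amulZr xe.
  - by rewrite /y !(amulZr, amulZl) amulA -xe.
  - by apply: bdM => //; exact: bdZ.
have pD i : forall x, star x = x -> x ** e = e ** x -> bd x -> pos (D x i).
  elim: i => [|i IH] x xs xe xb /=; first by exists x.
  by apply: posD; [exact: IH|rewrite DD//; have [? ? ?] := step x xs xe xb; exact: IH].
have pD1 i : forall x, star x = x -> x ** e = e ** x -> bd x -> pos (D x i - x ** x).
  elim: i => [|i IH] x xs xe xb /=; first by rewrite subrr; exact: pos0.
  rewrite addrAC; apply: posD; first exact: IH.
  by rewrite DD//; have [? ? ?] := step x xs xe xb; exact: pD.
(* w is e^2 E, and [pD2] expresses e^2 (1 + E)^i >= i w. *)
pose w := e ** y ** (e ** y).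
have [es' ee' eb'] := step e es erefl eb.
have pD2 i : pos (D e i - (i%:R : R)%:C%C *: w).
  elim: i => [|i IH] /=; first by rewrite scale0r subr0; exact: (pD 0%N).
  have -> : D e i + D e i ** E - (i.+1%:R : R)%:C%C *: w =
    (D e i - (i%:R : R)%:C%C *: w) + (D e i ** E - w).
    by rewrite -natr1 rmorphD /= scalerDl scale1r; lmod.
  by apply: posD => //; rewrite DD//; exact: pD1.
have [r r0 zr] := zb.
have Dz i : bnd (z ** E - z ** E) 0 by rewrite subrr; exact: bnd0.
(* f i = K^i z = z (1 + E)^i is bounded uniformly in i because |K| <= 1; hence so is z^* f i = - e^2
   (1 + E)^i. *)
have bz : exists f : nat -> M, forall i, bnd (f i) r /\ star z ** f i = - D e i.
  pose f := fix f (i : nat) : M := if i is j.+1 then K ** f j else z.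
  have fE i : K ** f i = f i + f i ** E.
    elim: i => [|i IH]; first exact: Kz.
    have fS : f i.+1 = K ** f i by [].
    by rewrite fS {1}IH amulDr amulA.
  exists f; elim=> [|i [IH1 IH2]] //=; split.
    by rewrite -[r]mul1r; apply: bndM.
  by rewrite fE amulDr amulA IH2 amulNl opprD.
have [f hf] := bz.
have w0 : w = 0.
  apply: (@bnd_natZ0 _ (r * r)) => i.
  apply: (@posD_bnd _ (D e i - (i%:R : R)%:C%C *: w)).
  - by rewrite mulr_ge0.
  - by apply: posZ => //; exists (e ** y).
  - exact: pD2.
  - rewrite addrC subrK -[D e i]opprK -(hf i).2; apply: bndN.
    by apply: bndM => //; [exact: bnd_star|exact: (hf i).1].
have /sa_sq0 : e ** y ** (e ** y) = 0 by [].
move=> /(_ es'); rewrite amulZr => h.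
have sn : sc != 0.
  by apply/eqP => s0; move: scE; rewrite s0 mul0r => /esym/complexI/eqP;
  rewrite invr_eq0 (negbTE tn).
have : sc^-1 *: (sc *: (e ** e)) = 0 by rewrite h scaler0.
by rewrite scalerA mulVf// scale1r => /sa_sq0; apply.
Qed.

(** Kaplansky's argument. With h = x^* x, c = |h| and v = (c - h)/2 its negative part, z = x v
    satisfies z^* z = - v^3. Since z z^* + z^* z is a sum of squares, z z^* is positive, so
    [star_mul_npos] applies and yields v = 0, that is, h = c. *)
Lemma pos_star_mul x : bd x -> pos (star x ** x).
Proof.
move=> xb; pose h := star x ** x.
have hs : star h = h by rewrite starM starK.
have hb : bd h by apply: bdM => //; exact: bd_star.
have p2 : pos (h ** h) by exists h.
have [t t0 ht] := bd_pos (pos_bd p2).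
have [c [cs cb e ct cc]] := pos_of_bnd t0 (pos_sa p2) (pos_bnd t0 p2 ht).
have st : 0 < Num.sqrt t by rewrite sqrtr_gt0.
(* A root r of |h| is taken in order to write v^3 as the square of the self-adjoint element v r. *)
have [r [rs rb rr _ rc]] := pos_of_bnd st cs ct.
have hc : h ** c = c ** h by apply: cc; rewrite amulA.
have hr : h ** r = r ** h by apply: rc.
have cr : c ** r = r ** c by rewrite rr amulA.
pose v := (2^-1 : R)%:C%C *: (c - h).
have vs : star v = v by rewrite starZR starB cs hs.
have vb : bd v by apply: bdZ; apply: bdD => //; exact: bdN.
have vr : v ** r = r ** v by rewrite amulZl amulZr !amulE hr cr.
have vh : v ** h = - (v ** v).
  have uu : (c - h) ** (c - h) = - ((c - h) ** h + (c - h) ** h).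
    by rewrite !amulE e hc; lmod.
  by rewrite /v !amulZl !amulZr uu !scalerN opprK halfD.
have vv : v ** v = v ** c.
  have : v ** (c + h) = 0.
    by rewrite amulZl !amulE e hc; lmod.
  rewrite amulDr vh => /eqP; rewrite subr_eq0 => /eqP.
  by [].
have v3 : v ** h ** v = - (v ** r ** (v ** r)).
  rewrite vh amulNl vv -amulA rr vr; congr (- _).
  by rewrite !amulA vr.
have e0 : v ** r = 0.
  apply: (@star_mul_npos (x ** v)).
  - exact: bdM.
  - by rewrite starM rs vs vr.
  - exact: bdM.
  - by rewrite -v3 starM vs !amulA.
  - pose z := x ** v; pose i : C := 'i%C.
    (* Twice the real and imaginary parts of z, so that p^2 + q^2 is twice z z^* + z^* z. *)
    pose p := z + star z; pose q := i *: (star z - z).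
    have ps : star p = p by rewrite starD starK addrC.
    have qs : star q = q.
      by rewrite starZ conj_i starB starK scaleNr -scalerN opprB.
    have zb : bd z by exact: bdM.
    have zs : star z ** z = - (v ** r ** (v ** r)).
      by rewrite -v3 starM vs !amulA.
    have -> : z ** star z = (2^-1 : R)%:C%C *: (p ** p + q ** q) + v ** r ** (v ** r).
      have -> : v ** r ** (v ** r) = - (star z ** z) by rewrite zs opprK.
      have -> : p ** p + q ** q = (z ** star z + star z ** z) + (z ** star z + star z ** z).
        by rewrite /q amulZl amulZr scalerA mul_ii /p !amulE; lmod.
      by rewrite halfD; lmod.
    have sb : bd (star z) by exact: bd_star.
    apply: posD; last first.
      by exists (v ** r); split => //; [rewrite starM rs vs vr|exact: bdM].
    apply: posZ; first by rewrite invr_ge0.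
    apply: posD; first by exists p; split => //; exact: bdD.
    by exists q; split => //; apply: bdZ; apply: bdD => //; exact: bdN.
have v20 : v ** v = 0.
  apply: sa_sq0; first by rewrite starM vs.
  rewrite {2}vv -amulA (amulA v v) vv -amulA. 
  by rewrite rr !amulA e0 !amul0l.
have v0 := sa_sq0 vs v20.
have ch : c = h.
  apply/eqP; rewrite -subr_eq0; apply/eqP.
  by rewrite -[c - h]halfD scalerDr -/v v0 addr0.
by exists r; split => //; rewrite -rr ch.
Qed.

Lemma pos_conj m x : pos m -> bd x -> pos (star x ** m ** x).
Proof.
move=> [k [ks kb ->]] xb.
have -> : star x ** (k ** k) ** x = star (k ** x) ** (k ** x).
  by rewrite starM ks !amulA.
by apply: pos_star_mul; exact: bdM.
Qed.

Lemma pos_membed_star a : pos (membed (star a ** a)).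
Proof.
have -> : membed (star a ** a) = star (membed a) ** membed a.
  have [_ hm hs] := membed_hom A; by rewrite hm hs.
by apply: pos_star_mul; exact: bd_membed.
Qed.

Lemma membed0 : membed (0 : A) = 0.
Proof. by apply: multiplierP => b /=; rewrite amul0l. Qed.
Lemma membedD a b : membed (a + b) = membed a + membed b.
Proof. by apply: multiplierP => c /=; rewrite amulDl. Qed.
Lemma membedZ (c : C) a : membed (c *: a) = c *: membed a.
Proof. by apply: multiplierP => b /=; rewrite amulZl. Qed.
Lemma membedN a : membed (- a) = - membed a.
Proof. by rewrite -scaleN1r membedZ scaleN1r. Qed.
Lemma membedB a b : membed (a - b) = membed a - membed b.
Proof. by rewrite membedD membedN. Qed.
Lemma membedM a b : membed (a ** b) = membed a ** membed b.
Proof. by have [_ h _] := membed_hom A; rewrite h. Qed.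
Lemma membed_star a : membed (star a) = star (membed a).
Proof. by have [_ _ h] := membed_hom A; rewrite h. Qed.
Lemma membed_sum I (s : seq I) (f : I -> A) :
  membed (\sum_(i <- s) f i) = \sum_(i <- s) membed (f i).
Proof. by elim/big_rec2: _ => [|i x y _ <-]; rewrite ?membed0 ?membedD. Qed.

Lemma pos_sum I (s : seq I) (f : I -> M) :
  (forall i, pos (f i)) -> pos (\sum_(i <- s) f i).
Proof.
by move=> h; elim/big_ind: _ => // [|x y]; [exact: pos0|exact: posD].
Qed.

Lemma nr_le_addpos a (m : M) r : 0 <= r -> pos (membed a) -> pos m ->
  bnd (membed a + m) r -> nr a <= r.
Proof. by move=> r0 pa pm h; apply: bnd_membed_le => //; apply: posD_bnd h. Qed.

(** Positivity of x^* x enters the norm here; it makes a^* a attain its norm under the gauge from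
    which states are constructed. *)
Lemma nr_star_mul_cone a (s : seq A) :
  nr (star a ** a) <= nr (star a ** a + \sum_(x <- s) star x ** x).
Proof.
apply: (nr_le_addpos (m := membed (\sum_(x <- s) star x ** x))).
- exact: nr_ge0.
- exact: pos_membed_star.
- by rewrite membed_sum; apply: pos_sum => x; exact: pos_membed_star.
- by rewrite -membedD; exact: bnd_membed.
Qed.


(** With h = t^-1 sum c c^*, the element u = 1 - (1 - h)^i is a polynomial in h without constant
    term, hence in I. Positivity gives i h (1 - h)^i <= 1, and c c^* <= t h turns this into |c - u
    c|^2 <= t/i. The finite list and [e] take the place of a net. *)
Lemma approx_unit (I : set A) (s : seq A) (e : R) : ideal I -> 0 < e ->
  (forall c, c \in s -> I c) ->
  exists u, [/\ I u, star u = u, bnd (1m - membed u) 1, nr u <= 1 &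
    forall c, c \in s -> nr (c - u ** c) < e].
Proof.
move=> hI e0 sI.
pose h0 := \sum_(c <- s) c ** star c.
have Ih0 : I h0.
  rewrite /h0; elim: s sI {h0} => [|c s IH] sI; first by rewrite big_nil; exact: (ideal0 hI).
  rewrite big_cons -[c ** _]scale1r; apply: (idealP hI) => //.
    have Ic : I c by apply: sI; rewrite mem_head.
    exact: (Defs.idealMr hI).
  by apply: IH => d ds; apply: sI; rewrite in_cons ds orbT.
have ph0 : pos (membed h0).
  rewrite membed_sum; apply: pos_sum => c.
  by rewrite -{1}[c]starK; exact: pos_membed_star.
pose t := nr h0 + 1.
have t0 : 0 < t by rewrite ltr_wpDl// nr_ge0.
have tn : t != 0 by rewrite gt_eqF.
pose h := (t^-1)%:C%C *: h0.
have Ih : I h by rewrite -[h]addr0; apply: (idealP hI) => //; exact: (ideal0 hI).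
have hs : star h = h.
  by apply: membed_inj; rewrite starZR membedZ membed_star (pos_sa ph0) -membedZ.
have ph : pos (membed h).
  by rewrite membedZ; apply: posZ => //; rewrite invr_ge0 ltW.
have hb : bnd (membed h) 1.
  apply: bnd_le (bnd_membed h); rewrite nrZ nrR ger0_norm ?invr_ge0 ?(ltW t0)//.
  by rewrite mulrC ler_pdivrMr// mul1r lerDl.
pose W := 1m - membed h.
have W1 : bnd W 1 by rewrite /W -sR1; exact: pos_bnd.
have pW : pos W by rewrite /W -sR1; apply: pos_sRB => //; exact: pos_sa.
have [k [ks kb kk kc]] := pos_root ph.
have [w [ws wb ww wc]] := pos_root pW.
have Wh : W ** membed h = membed h ** W by rewrite !amulE mul1m mulm1.
have kw : k ** w = w ** k.
  apply: wc; rewrite /W !amulE mul1m mulm1 kk; congr (_ - _).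
  by rewrite amulA.
have hw : membed h ** w = w ** membed h by apply: wc; rewrite Wh.
pose V := fix V (i : nat) : M := if i is j.+1 then W ** V j else 1m.
have Vc i x : x ** W = W ** x -> x ** V i = V i ** x.
  move=> xW; elim: i => [|i IH] /=; first by rewrite mul1m mulm1.
  by rewrite amulA xW -!amulA IH.
have V1 i : bnd (V i) 1.
  elim: i => [|i IH] /=; first exact: bnd1.
  by rewrite -[1]mulr1; apply: bndM.
have Vs i : star (V i) = V i.
  elim: i => [|i IH] /=; first exact: star1m.
  by rewrite starM IH (pos_sa pW) -Vc.
have pV i : forall x, star x = x -> x ** w = w ** x -> bd x -> pos (x ** x ** V i).
  elim: i => [|i IH] x xs xw xb /=; first by rewrite mulm1; exists x.
  have -> : x ** x ** (W ** V i) = (x ** w) ** (x ** w) ** V i.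
    rewrite amulA ww; congr (_ ** _); rewrite -!amulA; congr (_ ** _).
    by rewrite !amulA xw.
  apply: IH; first by rewrite starM ws xs xw.
    by rewrite amulA -xw.
  exact: bdM.
have pd i : pos (membed h ** V i - membed h ** V i.+1).
  have -> : membed h ** V i - membed h ** V i.+1 = membed h ** membed h ** V i.
    by rewrite /= /W !amulE mul1m amulA; lmod.
  by apply: pV => //; [exact: pos_sa|exact: bd_membed].
(* This is i h V_i + V_i <= 1. The sum of h V_j = V_j - V_{j+1} over j < i is 1 - V_i and h V_j
   decreases with j; the induction carries this out on increments. *)
have P i : pos (1m - (i%:R : R)%:C%C *: (membed h ** V i) - V i).
  elim: i => [|i IH].
    by rewrite scale0r subr0 subrr; exact: pos0.
  have -> : 1m - (i.+1%:R : R)%:C%C *: (membed h ** V i.+1) - V i.+1 =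
    (1m - (i%:R : R)%:C%C *: (membed h ** V i) - V i) +
    (i.+1%:R : R)%:C%C *: (membed h ** V i - membed h ** V i.+1).
    have eV : V i = V i.+1 + membed h ** V i by rewrite /= /W amulBl mul1m subrK.
    set a := membed h ** V i in eV *; set b := membed h ** V i.+1; rewrite eV.
    rewrite -natr1 !rmorphD /= rmorph1.
    by lmod.
  by apply: posD => //; apply: posZ.
have hV i : bnd ((i%:R : R)%:C%C *: (membed h ** V i)) 1.
  apply: (@posD_bnd _ (1m - (i%:R : R)%:C%C *: (membed h ** V i))) => //.
  - apply: posZ => //; rewrite kk; apply: pV => //; exact: kw.
  - rewrite -[X in pos X](subrK (V i)); apply: posD => //.
    by rewrite -[V i]mul1m -[1m]mul1m; apply: pV; rewrite ?star1m ?mul1m ?mulm1//; exact: bd1.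
  - by rewrite addrC subrK; exact: bnd1.
(* The recursion computes 1 - V_i inside A, without using a unit of A. *)
pose u := fix u (i : nat) : A := if i is j.+1 then u j + h - h ** u j else 0.
have uV i : 1m - membed (u i) = V i.
  elim: i => [|i IH] /=; first by rewrite membed0 subr0.
  by rewrite -IH /W membedB membedD membedM !amulE !mul1m !mulm1; lmod.
have Iu i : I (u i).
  elim: i => [|i IH] /=; first exact: (ideal0 hI).
  rewrite addrC -scaleN1r; apply: (idealP hI) => //; first exact: (Defs.idealMr hI).
  by rewrite -[u i]scale1r; apply: idealP.
have us i : star (u i) = u i.
  apply: membed_inj; rewrite membed_star; have := Vs i.
  by rewrite -uV starB star1m => /addrI/oppr_inj.
have small i c : c \in s -> (i%:R) * nr (c - u i ** c) ^+ 2 <= t.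
  move=> cs; have -> : c - u i ** c = lm (V i) c by rewrite -uV lmB.
  rewrite -nr_amul_star -[i%:R]ger0_norm// -nrR -nrZ.
  apply: bnd_membed_le; first exact: ltW.
  have e1 : membed (lm (V i) c ** star (lm (V i) c)) =
     star (V i) ** membed (c ** star c) ** V i.
    by rewrite !membedM !membed_star -!membed_lm starM !amulA !Vs.
  have [m pm hm] : exists2 m, pos m & membed h0 = membed (c ** star c) + m.
    rewrite /h0 (big_rem c cs) /= membedD; eexists; last by [].
    rewrite membed_sum; apply: pos_sum => d.
    by rewrite -{1}[d]starK; exact: pos_membed_star.
  have Vb : bd (V i) by exists 1.
  rewrite membedZ e1.
  apply: (@posD_bnd _ ((i%:R : R)%:C%C *: (star (V i) ** m ** V i))).
  - exact: ltW.
  - apply: posZ => //; apply: pos_conj => //.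
    by rewrite -{1}[c]starK; exact: pos_membed_star.
  - by apply: posZ => //; exact: pos_conj.
  - rewrite -scalerDr -amulDl -amulDr -hm.
    have -> : (i%:R : R)%:C%C *: (star (V i) ** membed h0 ** V i) =
      t%:C%C *: (V i ** ((i%:R : R)%:C%C *: (membed h ** V i))).
      rewrite Vs membedZ !amulZl !amulZr !scalerA -!amulA; congr (_ *: _).
      by rewrite mulrC -mulrA [_^-1%:C%C * _]mulrC RCK// mulr1.
    apply: bnd_le (bndZ _ (bndM _ (V1 i) (hV i))) => //.
    by rewrite nrR ger0_norm ?(ltW t0)// !mulr1.
have e20 : 0 < e ^+ 2 / t by rewrite divr_gt0// exprn_gt0.
have [i hi] := iv_small e20; exists (u i.+1); split => //.
- by rewrite uV.
- apply: bnd_membed_le => //; rewrite -[membed _](subKr 1m) uV -sR1.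
  apply: pos_bnd => //; rewrite -[V i.+1]mul1m -[1m]mul1m; apply: pV; rewrite ?star1m ?mul1m ?mulm1//; exact: bd1.
- move=> c cs; rewrite -ltr_sqr ?nnegrE ?nr_ge0 ?(ltW e0)//.
  have := small i.+1 c cs; rewrite mulrC -ler_pdivlMr// => /le_lt_trans; apply.
  by rewrite mulrC -ltr_pdivlMr.
Qed.

End Pos.

(** * Hilbert spaces from positive kernels *)

Section RawCS.
Context (R : realType).
Local Notation C := R[i].

Lemma mulJ_nr (z : C) : z * Num.conj z = (nr z ^+ 2)%:C%C.
Proof. by rewrite -normCK nrE rmorphXn. Qed.

Lemma ReD (x y : C) : complex.Re (x + y) = complex.Re x + complex.Re y.
Proof. by case: x y => a b [c d]. Qed.
Lemma ReRM (x : R) (y : C) : complex.Re (x%:C%C * y) = x * complex.Re y.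
Proof. by case: y => c d /=; rewrite mul0r subr0. Qed.
Lemma ReR (x : R) : complex.Re (x%:C%C : C) = x.
Proof. by []. Qed.

(** Cauchy-Schwarz on bare scalars serves inner products, the form of a kernel and its completion
    alike. The test value is c = - z/(Y + e), where e keeps the denominator positive when Y = 0. *)
Lemma CS_raw (X Y z : C) : 0 <= Y ->
  (forall c, 0 <= X + Num.conj c * z + c * Num.conj z + c * Num.conj c * Y) ->
  nr z ^+ 2 <= complex.Re X * complex.Re Y.
Proof.
move=> Y0 h; have RY := Re_ge0 Y0.
have RX : 0 <= complex.Re X.
  by have := Re_ge0 (h 0); rewrite rmorph0 !mul0r !addr0.
apply: (@le_eps _ _ _ (complex.Re X)) => e e0; rewrite -mulrDr.
have Ye : 0 < complex.Re Y + e by rewrite ltr_wpDl.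
pose l := (complex.Re Y + e)^-1; have l0 : 0 < l by rewrite invr_gt0.
have := Re_ge0 (h ((- l)%:C%C * z)).
have -> : X + Num.conj ((- l)%:C%C * z) * z + (- l)%:C%C * z * Num.conj z +
    (- l)%:C%C * z * Num.conj ((- l)%:C%C * z) * Y =
   X + (- l)%:C%C * (z * Num.conj z) + (- l)%:C%C * (z * Num.conj z) +
   ((- l)%:C%C * (- l)%:C%C) * (z * Num.conj z) * Y.
  by rewrite rmorphM /= conjR; ring.
rewrite mulJ_nr -!rmorphM /= !ReD !ReR ReRM -ler_pdivrMr//.
rewrite -/l; have lY : l * complex.Re Y <= 1.
  by rewrite mulrC ler_pdivrMr// mul1r lerDl ltW.
have := ler_wpM2l (mulr_ge0 (sqr_ge0 (nr z)) (ltW l0)) lY.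
by nra.
Qed.
End RawCS.

Section Hdot.
Context (R : realType) (H : hilbert R).
Local Notation C := R[i].
Implicit Types (x y z : H) (k : C).
Local Notation ip := (hdot H).

Lemma ipJ x y : ip x y = Num.conj (ip y x).
Proof. by rewrite hermC /= expr0 mul1r. Qed.
Lemma ipDl x y z : ip (x + y) z = ip x z + ip y z.
Proof. exact: linearDl. Qed.
Lemma ipZl k x z : ip (k *: x) z = k * ip x z.
Proof. exact: linearZl_LR. Qed.
Lemma ip0l z : ip 0 z = 0.
Proof. exact: linear0l. Qed.
Lemma ipDr x y z : ip z (x + y) = ip z x + ip z y.
Proof. by rewrite ipJ ipDl rmorphD (ipJ z x) (ipJ z y). Qed.
Lemma ipZr k x z : ip z (k *: x) = Num.conj k * ip z x.
Proof. by rewrite ipJ ipZl rmorphM (ipJ z x). Qed.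
Lemma ip0r z : ip z 0 = 0.
Proof. by rewrite ipJ ip0l rmorph0. Qed.
Lemma ipBl x y z : ip (x - y) z = ip x z - ip y z.
Proof. by rewrite -scaleN1r ipDl ipZl mulN1r. Qed.
Lemma ipBr x y z : ip z (x - y) = ip z x - ip z y.
Proof. by rewrite ipJ ipBl rmorphB (ipJ z x) (ipJ z y). Qed.
Lemma ipNr x z : ip z (- x) = - ip z x.
Proof. by rewrite -sub0r ipBr ip0r sub0r. Qed.
Lemma ip_suml I (s : seq I) (f : I -> H) z :
  ip (\sum_(i <- s) f i) z = \sum_(i <- s) ip (f i) z.
Proof. by elim/big_rec2: _ => [|i u v _ <-]; rewrite ?ip0l ?ipDl. Qed.
Lemma ip_sumr I (s : seq I) (f : I -> H) z :
  ip z (\sum_(i <- s) f i) = \sum_(i <- s) ip z (f i).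
Proof. by elim/big_rec2: _ => [|i u v _ <-]; rewrite ?ip0r ?ipDr. Qed.
Lemma ipxx x : ip x x = (nr x ^+ 2)%:C%C.
Proof. by rewrite -hnormE nrE rmorphXn. Qed.
Lemma ip_CS x y : nr (ip x y) <= nr x * nr y.
Proof.
rewrite -ler_sqr ?nnegrE ?mulr_ge0 ?nr_ge0// exprMn.
rewrite -[nr x ^+ 2]ReR -[nr y ^+ 2]ReR -!ipxx; apply: CS_raw.
  by rewrite ipxx ler0c sqr_ge0.
move=> c; have : 0 <= ip (x + c *: y) (x + c *: y) by rewrite ipxx ler0c sqr_ge0.
rewrite !ipDl !ipDr !ipZl !ipZr (ipJ y x).
by congr (_ <= _); ring.
Qed.
Lemma nr_le_ip x r : 0 <= r -> (forall y, nr (ip x y) <= r * nr y) -> nr x <= r.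
Proof.
move=> r0 h; have := h x; rewrite ipxx nrR ger0_norm ?sqr_ge0// expr2.
have [-> //|x0] := eqVneq (nr x) 0.
by rewrite ler_pM2r// lt_def x0 nr_ge0.
Qed.

End Hdot.

Section SubL.
Context (R : realType).
Local Notation C := R[i].
Variables (V : lmodType C) (P : set V).

Record is_sub : Prop := IsSub {
  is_sub0 : P 0;
  is_subP : forall (k : C) x y, P x -> P y -> P (k *: x + y) }.

Variable hP : is_sub.

Lemma is_subD x y : P x -> P y -> P (x + y).
Proof. by move=> Px Py; rewrite -[x]scale1r; apply: (is_subP hP). Qed.
Lemma is_subZ k x : P x -> P (k *: x).
Proof. by move=> Px; rewrite -[_ *: x]addr0; apply: (is_subP hP) => //; exact: is_sub0 hP. Qed.
Lemma is_subN x : P x -> P (- x).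
Proof. by move=> Px; rewrite -scaleN1r; exact: is_subZ. Qed.

(** The proof is a parameter of the type, so that the instances below apply to every subspace; both
    the kernel Hilbert spaces and the closed ideals are built on it. *)
Record subL_of (h : is_sub) : Type := Smk { subv : V; subvP : P subv }.
Local Notation subL := (subL_of hP).
Definition smk x (Px : P x) : subL := Smk hP Px.

Lemma subv_inj : injective (@subv hP).
Proof.
move=> [x Px] [y Py] /= e; subst y.
by congr Smk; exact: Prop_irrelevance.
Qed.

HB.instance Definition _ := gen_eqMixin subL.
HB.instance Definition _ := gen_choiceMixin subL.

Definition sadd (x y : subL) := smk (is_subD (subvP x) (subvP y)).
Definition szero : subL := smk (is_sub0 hP).
Definition sopp (x : subL) := smk (is_subN (subvP x)).
Definition sscale (k : C) (x : subL) := smk (is_subZ k (subvP x)).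

Fact saddA : associative sadd.
Proof. by move=> x y z; apply: subv_inj; exact: addrA. Qed.
Fact saddC : commutative sadd.
Proof. by move=> x y; apply: subv_inj; exact: addrC. Qed.
Fact sadd0 : left_id szero sadd.
Proof. by move=> x; apply: subv_inj; exact: add0r. Qed.
Fact saddN : left_inverse szero sopp sadd.
Proof. by move=> x; apply: subv_inj; exact: addNr. Qed.
HB.instance Definition _ := GRing.isZmodule.Build subL saddA saddC sadd0 saddN.
Fact sscaleA (k l : C) x : sscale k (sscale l x) = sscale (k * l) x.
Proof. by apply: subv_inj; exact: scalerA. Qed.
Fact sscale1 : left_id 1 sscale.
Proof. by move=> x; apply: subv_inj; exact: scale1r. Qed.
Fact sscaleDr : right_distributive sscale +%R.
Proof. by move=> k x y; apply: subv_inj; exact: scalerDr. Qed.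
Fact sscaleDl x : {morph sscale^~ x : k l / k + l}.
Proof. by move=> k l; apply: subv_inj; exact: scalerDl. Qed.
HB.instance Definition _ := GRing.Zmodule_isLmodule.Build C subL
  sscaleA sscale1 sscaleDr sscaleDl.


End SubL.

(** * Positive semidefinite kernels and their forms on formal combinations *)

Section Form.
Context (R : realType) (I : Type) (k : I -> I -> R[i]).
Local Notation C := R[i].
Implicit Types (s t u : seq (C * I)).

Definition kform s t : C := \sum_(p <- s) \sum_(q <- t) p.1 * Num.conj q.1 * k p.2 q.2.

Local Notation frm := kform.

Definition kernel := (forall i j, k j i = Num.conj (k i j)) /\ (forall s, 0 <= frm s s).

Lemma frm_catl s s' t : frm (s ++ s') t = frm s t + frm s' t.
Proof. by rewrite /kform big_cat. Qed.
Lemma frm_scsl c s t : frm (scs c s) t = c * frm s t.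
Proof.
rewrite /kform big_map mulr_sumr; apply: eq_bigr => p _.
by rewrite mulr_sumr; apply: eq_bigr => q _ /=; rewrite !mulrA.
Qed.

Hypothesis hk : kernel.

Lemma frmJ s t : frm s t = Num.conj (frm t s).
Proof.
rewrite /kform exchange_big rmorph_sum; apply: eq_bigr => p _.
rewrite rmorph_sum; apply: eq_bigr => q _; rewrite !rmorphM /= conjCK hk.1.
by congr (_ * _); rewrite mulrC.
Qed.
Lemma frm_catr s s' t : frm t (s ++ s') = frm t s + frm t s'.
Proof. by rewrite frmJ frm_catl rmorphD (frmJ t s) (frmJ t s'). Qed.
Lemma frm_scsr c s t : frm t (scs c s) = Num.conj c * frm t s.
Proof. by rewrite frmJ frm_scsl rmorphM (frmJ t s). Qed.
Lemma frm1 i j : frm [:: (1, i)] [:: (1, j)] = k i j.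
Proof. by rewrite /kform !big_seq1 rmorph1 !mul1r. Qed.

Definition fn s : R := Num.sqrt (complex.Re (frm s s)).
Lemma fn_ge0 s : 0 <= fn s. Proof. exact: sqrtr_ge0. Qed.
Lemma fn_sq s : frm s s = (fn s ^+ 2)%:C%C.
Proof.
have h := hk.2 s; rewrite sqr_sqrtr; last exact: Re_ge0.
by rewrite {1}(ge0_nrE h) {2}(ge0_nrE h).
Qed.
Lemma frm_CS s t : nr (frm s t) <= fn s * fn t.
Proof.
rewrite -ler_sqr ?nnegrE ?mulr_ge0 ?fn_ge0 ?nr_ge0// exprMn.
rewrite -[fn s ^+ 2]ReR -[fn t ^+ 2]ReR -!fn_sq; apply: CS_raw; first exact: hk.2.
move=> c; have := hk.2 (s ++ scs c t).
rewrite !frm_catl !frm_catr !frm_scsl !frm_scsr (frmJ t s).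
by congr (_ <= _); ring.
Qed.

Definition dif s t := s ++ scs (-1) t.
Lemma frm_difl s t u : frm (dif s t) u = frm s u - frm t u.
Proof. by rewrite frm_catl frm_scsl mulN1r. Qed.
Lemma frm_difr s t u : frm u (dif s t) = frm u s - frm u t.
Proof. by rewrite frm_catr frm_scsr rmorphN rmorph1 mulN1r. Qed.

Lemma fn_tri s t u : fn (dif s u) <= fn (dif s t) + fn (dif t u).
Proof.
rewrite -ler_sqr ?nnegrE ?addr_ge0 ?fn_ge0//.
have -> : fn (dif s u) ^+ 2 = complex.Re (frm (dif s t) (dif s t) +
   frm (dif t u) (dif t u) + (frm (dif s t) (dif t u) + frm (dif t u) (dif s t))).
  rewrite -[LHS]ReR -fn_sq !frm_difl !frm_difr; congr complex.Re; ring.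
rewrite !fn_sq !ReD !ReR sqrrD.
have := Re_le_nr (frm (dif s t) (dif t u)); have := frm_CS (dif s t) (dif t u).
have := Re_le_nr (frm (dif t u) (dif s t)); have := frm_CS (dif t u) (dif s t).
by rewrite (mulrC (fn (dif t u))) mulr2n; lra.
Qed.
Lemma fn_scs c s : fn (scs c s) = nr c * fn s.
Proof.
apply: (@pexpIrn R 2); rewrite ?nnegrE ?mulr_ge0 ?fn_ge0 ?nr_ge0//; apply: complexI.
by rewrite -fn_sq frm_scsl frm_scsr mulrA mulJ_nr fn_sq -rmorphM exprMn.
Qed.
Lemma fn_cat s t : fn (s ++ t) <= fn s + fn t.
Proof.
have := fn_tri s [::] (scs (-1) t).
have e1 : fn (dif s (scs (-1) t)) = fn (s ++ t).
  rewrite /fn !frm_difl !frm_difr !frm_catl !frm_catr !frm_scsl !frm_scsr.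
  by rewrite rmorphN rmorph1; congr (Num.sqrt (complex.Re _)); ring.
have e2 : fn (dif s [::]) = fn s by rewrite /dif cats0.
have e3 : fn (dif [::] (scs (-1) t)) = fn t.
  by rewrite /dif cat0s !fn_scs nrN nr1 !mul1r.
by rewrite e1 e2 e3.
Qed.
Lemma fn_le_dif s t : fn s <= fn t + fn (dif s t).
Proof. 
have := fn_tri s t [::]; rewrite {1 3}/dif cats0 /= => h.
have -> : fn t = fn (dif t [::]) by rewrite /dif cats0.
by rewrite addrC; apply: le_trans h _; rewrite /dif !cats0.
Qed.

Definition fcau (u : nat -> seq (C * I)) := forall e : R, 0 < e ->
  exists N, forall m n, (N <= m)%N -> (N <= n)%N -> fn (dif (u m) (u n)) < e.

Lemma fcau_bd (u : nat -> seq (C * I)) : fcau u -> exists2 K : R, 0 < K & forall n, fn (u n) <= K.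
Proof.
move=> cu; have [N hN] := cu 1 ltr01.
exists (1 + \sum_(i < N.+1) fn (u i)).
  by rewrite ltr_wpDr// sumr_ge0// => i _; exact: fn_ge0.
move=> n; have [nN|Nn] := leqP n N.
  rewrite (bigD1 (Ordinal (nN : (n < N.+1)%N)))//= addrCA lerDl addr_ge0//.
  by rewrite sumr_ge0// => i _; exact: fn_ge0.
apply: le_trans (fn_le_dif (u n) (u N)) _; rewrite addrC lerD//.
  by apply/ltW/hN => //; exact: ltnW.
rewrite (bigD1 ord_max)//= lerDl.
by rewrite sumr_ge0// => i _; exact: fn_ge0.
Qed.

Lemma frm_dist s t s' t' : nr (frm s t - frm s' t') <=
  fn (dif s s') * fn t + fn s' * fn (dif t t').
Proof.
have -> : frm s t - frm s' t' = frm (dif s s') t + frm s' (dif t t').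
  by rewrite frm_difl frm_difr; ring.
by rewrite (le_trans (nrD _ _))// lerD// frm_CS.
Qed.

Lemma fcau_frm (u v : nat -> seq (C * I)) : fcau u -> fcau v -> cau (fun n => frm (u n) (v n)).
Proof.
move=> cu cv e e0; have [K K0 hK] := fcau_bd cu; have [L L0 hL] := fcau_bd cv.
have KL : 0 < K + L by exact: addr_gt0.
have [N hN] := cu _ (divr_gt0 e0 KL); have [N' hN'] := cv _ (divr_gt0 e0 KL).
exists (maxn N N') => m n; rewrite !geq_max => /andP[m1 m2] /andP[n1 n2].
apply: le_lt_trans (frm_dist _ _ _ _) _.
have h1 : fn (dif (u m) (u n)) * fn (v m) <= fn (dif (u m) (u n)) * L.
  by rewrite ler_wpM2l// fn_ge0.
have h2 : fn (u n) * fn (dif (v m) (v n)) <= K * fn (dif (v m) (v n)).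
  by rewrite ler_wpM2r// fn_ge0.
have h3 : fn (dif (u m) (u n)) * L < e / (K + L) * L by rewrite ltr_pM2r// hN.
have h4 : K * fn (dif (v m) (v n)) < K * (e / (K + L)) by rewrite ltr_pM2l// hN'.
have h5 : e / (K + L) * L + K * (e / (K + L)) = e.
  by rewrite [K * _]mulrC -mulrDr [L + K]addrC divfK// gt_eqF.
by lra.
Qed.

Definition fev s i := frm s [:: (1, i)].

Lemma fev_frm s t : frm s t = \sum_(q <- t) Num.conj q.1 * fev s q.2.
Proof.
rewrite /kform exchange_big; apply: eq_bigr => q _.
rewrite /fev /kform mulr_sumr; apply: eq_bigr => p _.
by rewrite big_seq1 rmorph1 mulr1 !mulrA [_ * p.1]mulrC.
Qed.

Lemma cvs_fev_frm (u : nat -> seq (C * I)) t : (forall i, cvs (fun n => fev (u n) i) 0) ->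
  cvs (fun n => frm (u n) t) 0.
Proof.
move=> h; elim: t => [|q t IH].
  rewrite (_ : (fun _ => _) = fun=> 0); first exact: cvs_cst.
  by apply/funext => n; rewrite /kform big1// => p _; rewrite big_nil.
rewrite (_ : (fun _ => _) = fun n => Num.conj q.1 * fev (u n) q.2 + frm (u n) t).
  rewrite -[0]addr0; apply: cvsD => //; rewrite -(mulr0 (Num.conj q.1)).
  apply: (@cvs_lip R _ _ (fun x => Num.conj q.1 * x) (nr (Num.conj q.1)) _ _ _ (h q.2)) => x y.
  by rewrite -mulrBr nrM.
by apply/funext => n; rewrite !fev_frm big_cons.
Qed.

(** |u_n|^2 is at most |<u_n, u_n - u_N>| + |<u_n, u_N>|: the first term is small by the Cauchy
    property, the second by pointwise convergence. Thus the limit function determines the class of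
    the sequence in the completion. *)
Lemma fcau0 (u : nat -> seq (C * I)) : fcau u -> (forall i, cvs (fun n => fev (u n) i) 0) ->
  forall e : R, 0 < e -> exists N, forall n, (N <= n)%N -> fn (u n) < e.
Proof.
move=> cu h e e0; have [K K0 hK] := fcau_bd cu.
have d0 : 0 < e ^+ 2 / (K + 1) by rewrite divr_gt0 ?exprn_gt0// addr_gt0.
have [N hN] := cu _ d0.
have [N' hN'] := cvs_fev_frm (u N) h d0.
exists (maxn N N') => n; rewrite geq_max => /andP[n1 n2].
rewrite -ltr_sqr ?nnegrE ?fn_ge0 ?(ltW e0)//.
have : fn (u n) ^+ 2 <= nr (frm (u n) (dif (u n) (u N))) + nr (frm (u n) (u N)).
  rewrite -[fn (u n) ^+ 2]ReR -fn_sq (le_trans (Re_le_nr _))//.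
  by rewrite (le_trans _ (nrD _ _))// frm_difr subrK.
have := frm_CS (u n) (dif (u n) (u N)).
have : fn (u n) * fn (dif (u n) (u N)) <= K * fn (dif (u n) (u N)).
  by rewrite ler_wpM2r ?fn_ge0.
have : K * fn (dif (u n) (u N)) <= K * (e ^+ 2 / (K + 1)).
  by rewrite ler_pM2l// ltW// hN.
have := hN' n n2; rewrite subr0.
have : K * (e ^+ 2 / (K + 1)) + e ^+ 2 / (K + 1) = e ^+ 2.
  by rewrite -{2}[_ / _]mul1r -mulrDl mulrC divfK// gt_eqF// addr_gt0.
by lra.
Qed.

End Form.

(** * The reproducing kernel Hilbert space *)

Section KH.
Context (R : realType) (I : Type) (k : I -> I -> R[i]) (hk : kernel k).
Local Notation C := R[i].
Local Notation frm := (kform k).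
Local Notation fn := (fn k).

(** Moore-Aronszajn: a vector is a function on I, the pointwise limit of a form-Cauchy sequence of
    combinations. Null combinations vanish as functions, so no quotient is formed. *)
Definition repr (f : I -> C) (u : nat -> seq (C * I)) :=
  fcau k u /\ forall i, cvs (fun n => fev k (u n) i) (f i).

Lemma cvsM (c : C) (u : nat -> C) l : cvs u l -> cvs (fun n => c * u n) (c * l).
Proof.
move=> h; apply: (@cvs_lip R _ _ (fun x => c * x) (nr c) _ _ _ h) => x y.
by rewrite -mulrBr nrM.
Qed.

Lemma repr_lin f g u v (c : C) : repr f u -> repr g v ->
  repr (fun i => c * f i + g i) (fun n => scs c (u n) ++ v n).
Proof.
move=> [cu hu] [cv hv]; split.
  move=> e e0; have e2 := divr_gt0 e0 (ltr0n R 2).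
  have c1 : 0 < nr c + 1 by rewrite ltr_wpDl ?nr_ge0.
  have [N hN] := cu _ (divr_gt0 e2 c1); have [N' hN'] := cv _ e2.
  exists (maxn N N') => m n; rewrite !geq_max => /andP[m1 m2] /andP[n1 n2].
  have -> : fn (dif (scs c (u m) ++ v m) (scs c (u n) ++ v n)) =
     fn (scs c (dif (u m) (u n)) ++ dif (v m) (v n)).
    rewrite /fn !(frm_difl, frm_difr hk, frm_catl, frm_catr hk, frm_scsl, frm_scsr hk).
    by congr (Num.sqrt (complex.Re _)); ring.
  apply: le_lt_trans (fn_cat hk _ _) _; rewrite fn_scs//.
  have := hN' _ _ m2 n2.
  have : nr c * fn (dif (u m) (u n)) <= e / 2 / (nr c + 1) * nr c.
    by rewrite mulrC ler_wpM2r ?nr_ge0// ltW// hN.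
  by have := divS_lt e2 (nr_ge0 c); lra.
move=> i.
rewrite (_ : (fun n => _) = fun n => c * fev k (u n) i + fev k (v n) i); last first.
  by apply/funext => n; rewrite /fev frm_catl frm_scsl.
by apply: cvsD (hv i); apply: cvsM; exact: hu.
Qed.

Definition kP : set (I -> C) := [set f | exists u, repr f u].

Lemma repr0 : repr (fun=> 0) (fun=> [::]).
Proof.
have f0 t : frm [::] t = 0 by rewrite /kform big_nil.
split=> [e e0|i]; first by exists 0%N => m n _ _; rewrite /fn /= f0 raddf0 sqrtr0.
rewrite (_ : (fun n => _) = fun=> 0); first exact: cvs_cst.
by apply/funext => n; rewrite /fev f0.
Qed.

Lemma kP_sub : is_sub (kP : set (I -> C)).
Proof.
split; first by exists (fun=> [::]); exact: repr0.
by move=> c f g [u hu] [v hv]; exists (fun n => scs c (u n) ++ v n); exact: repr_lin.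
Qed.

Definition kH := subL_of kP_sub.
HB.instance Definition _ := GRing.Lmodule.on kH.

Definition rp (f : kH) := proj1_sig (cid (subvP f)).
Lemma rpP f : repr (subv f) (rp f). Proof. exact: proj2_sig (cid (subvP f)). Qed.

Definition kdot (f g : kH) : C :=
  proj1_sig (cid (complete_cvsC (fcau_frm hk (rpP f).1 (rpP g).1))).

Lemma fcau_dif u v : fcau k u -> fcau k v -> fcau k (fun n => dif (u n) (v n)).
Proof.
move=> cu cv e e0; have e2 := divr_gt0 e0 (ltr0n R 2).
have [N hN] := cu _ e2; have [N' hN'] := cv _ e2.
exists (maxn N N') => m n; rewrite !geq_max => /andP[m1 m2] /andP[n1 n2].
have -> : fn (dif (dif (u m) (v m)) (dif (u n) (v n))) =
   fn (dif (u m) (u n) ++ dif (v n) (v m)).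
  rewrite /fn !(frm_difl, frm_difr hk, frm_catl, frm_catr hk).
  by congr (Num.sqrt (complex.Re _)); ring.
apply: le_lt_trans (fn_cat hk _ _) _.
by have := hN _ _ m1 n1; have := hN' _ _ n2 m2; lra.
Qed.

Lemma repr_uniq f u v : repr f u -> repr f v ->
  forall e : R, 0 < e -> exists N, forall n, (N <= n)%N -> fn (dif (u n) (v n)) < e.
Proof.
move=> [cu hu] [cv hv]; apply: fcau0 => //; first exact: fcau_dif.
move=> i; rewrite (_ : (fun n => _) = fun n => fev k (u n) i + (-1) * fev k (v n) i).
  by rewrite -[0](subrr (f i)) -[- f i]mulN1r; apply: cvsD (hu i) (cvsM _ (hv i)).
by apply/funext => n; rewrite /fev frm_difl// mulN1r.
Qed.

(** [kdot] is a limit along chosen representatives; this frees it from the choice. *)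
Lemma kdotP u v (f g : kH) : repr (subv f) u -> repr (subv g) v ->
  cvs (fun n => frm (u n) (v n)) (kdot f g).
Proof.
move=> hu hv; rewrite /kdot; case: cid => z /= hz e e0.
have e2 := divr_gt0 e0 (ltr0n R 2); have e4 := divr_gt0 e2 (ltr0n R 2).
have [N hN] := hz _ e2.
have [K K0 hK] := fcau_bd hk hv.1; have [L L0 hL] := fcau_bd hk (rpP f).1.
have [N1 hN1] := repr_uniq hu (rpP f) (divr_gt0 e4 K0).
have [N2 hN2] := repr_uniq hv (rpP g) (divr_gt0 e4 L0).
exists (maxn N (maxn N1 N2)) => n; rewrite !geq_max => /and3P[n0 n1 n2].
have := frm_dist hk (u n) (v n) (rp f n) (rp g n).
have h1 : fn (dif (u n) (rp f n)) * fn (v n) <= e / 2 / 2.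
  apply: le_trans (ler_wpM2l (fn_ge0 _ _) (hK n)) _.
  by rewrite -ler_pdivlMr// ltW// hN1.
have h2 : fn (rp f n) * fn (dif (v n) (rp g n)) <= e / 2 / 2.
  apply: le_trans (ler_wpM2r (fn_ge0 _ _) (hL n)) _.
  by rewrite mulrC -ler_pdivlMr// ltW// hN2.
have := hN n n0; have := nr_tri (frm (rp f n) (rp g n)) (frm (u n) (v n)) z.
by lra.
Qed.

Lemma kdot_linl (c : C) f g h : kdot (c *: f + g) h = c * kdot f h + kdot g h.
Proof.
have := kdotP (f := c *: f + g) (repr_lin c (rpP f) (rpP g)) (rpP h).
move/cvs_uniq; apply.
rewrite (_ : (fun n => _) = fun n => c * frm (rp f n) (rp h n) + frm (rp g n) (rp h n)).
  by apply: cvsD; [apply: cvsM|]; apply: kdotP; exact: rpP.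
by apply/funext => n; rewrite frm_catl frm_scsl.
Qed.

Lemma kdotJ f g : kdot f g = Num.conj (kdot g f).
Proof.
apply: cvs_uniq (kdotP (rpP f) (rpP g)) _.
rewrite (_ : (fun n => _) = Num.conj \o (fun n => frm (rp g n) (rp f n))).
  apply: (@cvs_lip R _ _ (Num.conj : C -> C) 1) (kdotP (rpP g) (rpP f)) => x y.
  by rewrite mul1r -rmorphB /= nr_conj.
by apply/funext => n /=; rewrite frmJ.
Qed.

Lemma kdot_linr (c : C) f g h : kdot h (c *: f + g) = Num.conj c * kdot h f + kdot h g.
Proof. by rewrite kdotJ kdot_linl rmorphD rmorphM (kdotJ h f) (kdotJ h g). Qed.

Definition kn (f : kH) : R := Num.sqrt (complex.Re (kdot f f)).

Lemma kdot_cvs_fn u (f : kH) : repr (subv f) u -> cvs (fun n => ((fn (u n)) ^+ 2)%:C%C) (kdot f f).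
Proof.
move=> hu; have := kdotP hu hu; congr (cvs _ _).
by apply/funext => n; rewrite fn_sq.
Qed.

Lemma kdot_ge0 f : 0 <= kdot f f.
Proof.
have h := kdot_cvs_fn (rpP f).
have re : 0 <= complex.Re (kdot f f).
  rewrite leNgt; apply/negP => lt0.
  have /h[N hN] : 0 < - complex.Re (kdot f f) by rewrite oppr_gt0.
  have := hN N (leqnn N); have := abs_Re_le_nr ((fn (rp f N) ^+ 2)%:C%C - kdot f f).
  have := ler_norm (complex.Re ((fn (rp f N) ^+ 2)%:C%C - kdot f f)).
  by have := sqr_ge0 (fn (rp f N)); rewrite !raddfB /=; lra.
have := kdotJ f f; move: re; case: (kdot f f) => a b /= a0.
rewrite /Num.conj /= => -[] b0; rewrite lecE /= a0 andbT.
by apply/eqP; move: b0; lra.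
Qed.

Lemma kn_sq f : kdot f f = (kn f ^+ 2)%:C%C.
Proof.
have h := kdot_ge0 f; rewrite sqr_sqrtr; last exact: Re_ge0.
by rewrite {1}(ge0_nrE h) {2}(ge0_nrE h).
Qed.
Lemma kn_ge0 f : 0 <= kn f. Proof. exact: sqrtr_ge0. Qed.

Lemma kdotDl f g h : kdot (f + g) h = kdot f h + kdot g h.
Proof. by rewrite -[f]scale1r kdot_linl mul1r scale1r. Qed.
Lemma kdotDr f g h : kdot h (f + g) = kdot h f + kdot h g.
Proof. by rewrite -[f]scale1r kdot_linr rmorph1 mul1r scale1r. Qed.
Lemma kdot0l h : kdot 0 h = 0.
Proof. by have := kdotDl 0 0 h; rewrite addr0 => /eqP; rewrite -subr_eq0 opprD addrA subrr sub0r oppr_eq0 => /eqP. Qed.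
Lemma kdotZl c f h : kdot (c *: f) h = c * kdot f h.
Proof. by rewrite -[c *: f]addr0 kdot_linl kdot0l addr0. Qed.
Lemma kdotZr c f h : kdot h (c *: f) = Num.conj c * kdot h f.
Proof. by rewrite kdotJ kdotZl rmorphM (kdotJ h f). Qed.

Lemma kdot_CS f g : nr (kdot f g) <= kn f * kn g.
Proof.
rewrite -ler_sqr ?nnegrE ?mulr_ge0 ?kn_ge0 ?nr_ge0// exprMn.
rewrite -[kn f ^+ 2]ReR -[kn g ^+ 2]ReR -!kn_sq; apply: CS_raw; first exact: kdot_ge0.
move=> c; have := kdot_ge0 (f + c *: g).
rewrite !kdotDl !kdotDr !kdotZl !kdotZr (kdotJ g f).
by congr (_ <= _); ring.
Qed.

Lemma kn_tri f g : kn (f + g) <= kn f + kn g.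
Proof.
rewrite -ler_sqr ?nnegrE ?addr_ge0 ?kn_ge0//.
rewrite -[_ ^+ 2]ReR -kn_sq kdotDl !kdotDr !ReD !kn_sq !ReR sqrrD.
have := Re_le_nr (kdot f g); have := kdot_CS f g.
have := Re_le_nr (kdot g f); have := kdot_CS g f.
by rewrite (mulrC (kn g)) mulr2n; lra.
Qed.
Lemma knZ (c : C) f : kn (c *: f) = nr c * kn f.
Proof.
apply: (@pexpIrn R 2); rewrite ?nnegrE ?mulr_ge0 ?kn_ge0 ?nr_ge0//; apply: complexI.
by rewrite -kn_sq kdotZl kdotZr mulrA mulJ_nr kn_sq -rmorphM exprMn.
Qed.

Lemma repr1 i : repr (fun j => k i j) (fun=> [:: (1, i)]).
Proof.
split=> [e e0|j].
  by exists 0%N => m n _ _; rewrite /fn !frm_difl// !subrr raddf0 sqrtr0.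
rewrite (_ : (fun n => _) = fun=> k i j); first exact: cvs_cst.
by apply/funext => n; rewrite /fev frm1.
Qed.

Definition kio (i : I) : kH := Smk kP_sub (ex_intro _ _ (repr1 i)).

Lemma kdot_kio i j : kdot (kio i) (kio j) = k i j.
Proof.
apply: cvs_uniq (kdotP (f := kio i) (g := kio j) (repr1 i) (repr1 j)) _.
by rewrite frm1; exact: cvs_cst.
Qed.

Lemma kdot_ev f i : subv f i = kdot f (kio i).
Proof.
exact: cvs_uniq ((rpP f).2 i) (kdotP (g := kio i) (rpP f) (repr1 i)).
Qed.

Lemma kn_eq0 f : kn f = 0 -> f = 0.
Proof.
move=> h; apply: subv_inj; apply/funext => i; rewrite kdot_ev.
apply: nr_eq0; apply/le_anti; rewrite nr_ge0 andbT.
by rewrite (le_trans (kdot_CS _ _))// h mul0r.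
Qed.

Definition knorm (f : kH) : C := (kn f)%:C%C.
Fact knormD f g : knorm (f + g) <= knorm f + knorm g.
Proof. by rewrite /knorm -rmorphD lecR kn_tri. Qed.
Fact knormZ (c : C) f : knorm (c *: f) = `|c| * knorm f.
Proof. by rewrite /knorm knZ rmorphM /= -nrE. Qed.
Fact knorm_eq0 f : knorm f = 0 -> f = 0.
Proof. by move=> /complexI; exact: kn_eq0. Qed.
HB.instance Definition _ := Lmodule_isNormed.Build C kH knormD knormZ knorm_eq0.

Lemma nr_kn (f : kH) : nr f = kn f. Proof. by []. Qed.

Lemma kdot_lci s t : kdot (lci kio s) (lci kio t) = frm s t.
Proof.
have h i t' : kdot (kio i) (lci kio t') = frm [:: (1, i)] t'.
  elim: t' => [|q t' IH].
    rewrite /lci big_nil kdotJ kdot0l rmorph0.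
    by rewrite /kform big_seq1 big_nil.
  have -> : q :: t' = scs q.1 [:: (1, q.2)] ++ t' by rewrite /= mulr1; case: q.
  by rewrite lci_cat kdotDr IH frm_catr// lci_scs lci1 kdotZr kdot_kio frm_scsr// frm1.
elim: s => [|p s IH].
  by rewrite /lci big_nil kdot0l /kform big_nil.
have -> : p :: s = scs p.1 [:: (1, p.2)] ++ s by rewrite /= mulr1; case: p.
by rewrite lci_cat kdotDl IH frm_catl lci_scs lci1 kdotZl h frm_scsl.
Qed.

Lemma nr_lci s : nr (lci kio s) = fn s.
Proof. by rewrite nr_kn /kn kdot_lci. Qed.

Lemma repr_cst s : repr (fun i => fev k s i) (fun=> s).
Proof.
split=> [e e0|j]; last exact: cvs_cst.
by exists 0%N => m n _ _; rewrite /fn !frm_difl// !subrr raddf0 sqrtr0.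
Qed.

Lemma repr_kio s : repr (subv (lci kio s)) (fun=> s).
Proof.
have -> : subv (lci kio s) = fun i => fev k s i.
  by apply/funext => i; rewrite kdot_ev -(lci1 kio) kdot_lci.
exact: repr_cst.
Qed.

Lemma kio_total : total kio.
Proof.
move=> f e e0; have e2 := divr_gt0 e0 (ltr0n R 2).
have [cu hu] := rpP f; have [N hN] := cu _ e2.
exists (rp f N); apply: le_lt_trans (_ : e / 2 < e); last by lra.
have hr : repr (subv (f - lci kio (rp f N))) (fun n => scs (-1) (rp f N) ++ rp f n).
  have -> : f - lci kio (rp f N) = (-1) *: lci kio (rp f N) + f.
    by rewrite scaleN1r addrC.
  exact: (repr_lin (-1) (repr_kio (rp f N)) (rpP f)).
have := kdot_cvs_fn hr; rewrite kn_sq => h.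
rewrite nr_kn -ler_sqr ?nnegrE ?kn_ge0 ?(ltW e2)//.
apply: (@le_eps _ _ _ 1) => d d0; have [M hM] := h d d0.
have /= := hM _ (leq_maxr N M); have := hN _ _ (leq_maxl N M) (leqnn N).
rewrite -rmorphB nrR; set a := fn _.
have -> : fn (scs (-1) (rp f N) ++ rp f (maxn N M)) = a.
  rewrite /a /fn /dif !(frm_catl, frm_catr hk, frm_scsl, frm_scsr hk).
  by congr (Num.sqrt (complex.Re _)); ring.
move=> ae; rewrite ltr_norml => /andP[ha _].
have : a ^+ 2 <= (e / 2) ^+ 2 by rewrite ler_sqr ?nnegrE ?fn_ge0 ?(ltW e2)// ltW.
by rewrite mul1r; lra.
Qed.

(** Combinations within 1/(n+1) of u_n form a single form-Cauchy sequence, which represents its own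
    pointwise limit. *)
Lemma kH_complete (u : nat -> kH) : cau u -> exists l, cvs u l.
Proof.
move=> cu.
have /choice[s hs] : forall n, exists s, nr (u n - lci kio s) < iv R n.
  by move=> n; apply: kio_total; exact: iv_gt0.
have cs : fcau k s.
  move=> e e0; have e3 : 0 < e / 3 by rewrite divr_gt0.
  have [N hN] := cu _ e3; have [N' hN'] := iv_small e3.
  exists (maxn N N') => m n; rewrite !geq_max => /andP[m1 m2] /andP[n1 n2].
  rewrite -nr_lci lci_cat lci_scs scaleN1r.
  apply: le_lt_trans (le_trans (nr_tri (u m) _ _) (lerD (lexx _) (nr_tri (u n) _ _))) _.
  rewrite (nrBC _ (u m)); have -> : e = e / 3 + (e / 3 + e / 3) by lra.
  apply: ltrD; first exact: lt_trans (hs m) (le_lt_trans (iv_le R m2) hN').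
  by apply: ltrD; [exact: hN|exact: lt_trans (hs n) (le_lt_trans (iv_le R n2) hN')].
have hf i : exists z, cvs (fun n => fev k (s n) i) z.
  apply: complete_cvsC; apply: (fcau_frm hk cs (v := fun=> [:: (1, i)])).
  exact: (repr1 i).1.
have [f hf'] := choice hf.
have rf : repr f s by [].
pose l : kH := Smk kP_sub (ex_intro _ _ rf).
exists l => e e0; have e4 : 0 < e / 4 by rewrite divr_gt0.
have [N hN] := cs _ e4; have [N' hN'] := iv_small e4.
exists (maxn N N') => n; rewrite geq_max => /andP[n1 n2].
have lb : nr (lci kio (s n) - l) <= e / 2.
  have hr : repr (subv (lci kio (s n) - l)) (fun m => scs (-1) (s m) ++ s n).
    have -> : lci kio (s n) - l = (-1) *: l + lci kio (s n).
      by rewrite scaleN1r addrC.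
    exact: (repr_lin (-1) (rf : repr (subv l) s) (repr_kio (s n))).
  have := kdot_cvs_fn hr; rewrite kn_sq => h.
  have e2 : 0 < e / 2 by rewrite divr_gt0.
  rewrite nr_kn -ler_sqr ?nnegrE ?kn_ge0 ?(ltW e2)//.
  apply: (@le_eps _ _ _ 1) => d d0; have [M hM] := h d d0.
  have /= := hM _ (leq_maxr N M); have := hN _ _ n1 (leq_maxl N M).
  rewrite -rmorphB nrR; set a := fn _.
  have -> : fn (scs (-1) (s (maxn N M)) ++ s n) = a.
    rewrite /a /fn /dif !(frm_catl, frm_catr hk, frm_scsl, frm_scsr hk).
    by congr (Num.sqrt (complex.Re _)); ring.
  move=> ae; rewrite ltr_norml => /andP[ha _].
  have : a ^+ 2 <= (e / 2) ^+ 2.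
    by rewrite ler_sqr ?nnegrE ?fn_ge0 ?(ltW e2)// (le_trans (ltW ae))//; lra.
  by rewrite mul1r; lra.
apply: le_lt_trans (nr_tri (lci kio (s n)) _ _) _.
apply: le_lt_trans (lerD (lexx _) lb) _.
have e2 : e / 2 + e / 2 <= e by lra.
apply: lt_le_trans e2; rewrite ltrD2r; apply: lt_le_trans (hs n) _.
by apply: le_trans (iv_le R n2) _; apply: ltW; apply: lt_trans hN' _; lra.
Qed.

HB.instance Definition _ := Uniform_isComplete.Build kH (seq_complete kH_complete).

Fact kdotBl h : zmod_morphism (fun f => kdot f h).
Proof. by move=> f g; rewrite -scaleN1r kdotDl kdotZl mulN1r. Qed.
Fact kdotBr h : zmod_morphism (kdot h).
Proof. by move=> f g; rewrite -scaleN1r kdotDr kdotZr rmorphN rmorph1 mulN1r. Qed.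
HB.instance Definition _ := isBilinear.Build C kH kH C *%R (Num.conj \; *%R) kdot
  kdotBl kdotBr (fun h c f => kdotZl c f h) (fun h c f => kdotZr c f h).
Fact kdot_herm f g : kdot f g = (-1) ^+ false * Num.conj (kdot g f).
Proof. by rewrite expr0 mul1r -kdotJ. Qed.
HB.instance Definition _ := isHermitianSesquilinear.Build C kH false (@Num.conj C) kdot kdot_herm.
Fact kdot_pos f : f != 0 -> 0 < kdot f f.
Proof.
move=> f0; rewrite lt_def kdot_ge0 andbT kn_sq; apply: contraNneq f0 => /complexI/eqP.
by rewrite sqrf_eq0 => /eqP/kn_eq0 ->.
Qed.
HB.instance Definition _ := isDotProduct.Build C kH kdot kdot_pos.
Fact knormE (f : kH) : `|f| ^+ 2 = kdot f f.
Proof. by rewrite kn_sq nrE rmorphXn. Qed.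
Definition khilb : hilbert R := @Hilbert R kH (kdot : {dot kH for (@Num.conj C)}) knormE.


(** GNS spaces, tensor products of Hilbert spaces and the closures of pi(B)H in [pull_rep] are all
    instances of this. *)
Theorem kernel_hilbert : exists (H : hilbert R) (i : I -> H),
  total i /\ forall a b, hdot H (i a) (i b) = k a b.
Proof. by exists khilb, kio; split; [exact: kio_total|exact: kdot_kio]. Qed.

End KH.

(** * Representations and the Gelfand-Naimark theorem *)

Section Lin.
Context (R : realType) (U V : lmodType R[i]) (f : U -> V).
Hypothesis lf : linear f.
Lemma linD x y : f (x + y) = f x + f y.
Proof. by rewrite -[x]scale1r lf !scale1r. Qed.
Lemma lin0 : f 0 = 0.
Proof. by have := lf (-1) 0 0; rewrite scaleN1r oppr0 addr0 scaleN1r addNr. Qed.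
Lemma linZ (k : R[i]) x : f (k *: x) = k *: f x.
Proof. by rewrite -[k *: x]addr0 lf lin0 addr0. Qed.
Lemma linN x : f (- x) = - f x.
Proof. by rewrite -scaleN1r linZ scaleN1r. Qed.
Lemma linB x y : f (x - y) = f x - f y.
Proof. by rewrite linD linN. Qed.
Lemma lin_sum I (s : seq I) (g : I -> U) : f (\sum_(i <- s) g i) = \sum_(i <- s) f (g i).
Proof. by elim/big_rec2: _ => [|i x y _ <-]; rewrite ?lin0 ?linD. Qed.
End Lin.

Section Blin.
Context (R : realType).
Local Notation C := R[i].

Definition blin (V W : normedModType C) (L : V -> W) :=
  linear L /\ exists2 K : R, 0 <= K & forall x, nr (L x) <= K * nr x.

Lemma blinP (V W : normedModType C) (L : V -> W) (K : R) :
  linear L -> (forall x, nr (L x) <= K * nr x) -> blin L.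
Proof.
move=> lL h; split=> //; exists `|K| => // x.
by apply: le_trans (h x) _; rewrite ler_wpM2r ?nr_ge0// ler_norm.
Qed.

Lemma closed_eq (V W : normedModType C) (L L' : V -> W) x : blin L -> blin L' ->
  (forall e : R, 0 < e -> exists2 y, L y = L' y & nr (x - y) < e) -> L x = L' x.
Proof.
move=> [lL [K K0 hK]] [lL' [K' K0' hK']] h.
apply/eqP; rewrite -subr_eq0; apply/eqP/nr_small_eq0 => e e0.
apply: (@le_eps _ _ _ (K + K')) => d d0; have [y hy xy] := h d d0.
have -> : L x - L' x = L (x - y) - L' (x - y).
  by rewrite (linB lL) (linB lL') hy; lmod.
apply: le_trans (nrB _ _) _; apply: le_trans (lerD (hK _) (hK' _)) _.
rewrite -mulrDl -[leLHS]add0r lerD ?(ltW e0)// ler_wpM2l ?addr_ge0//.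
exact: ltW.
Qed.

Lemma total_eq I (V W : normedModType C) (f : I -> V) (L L' : V -> W) : total f ->
  blin L -> blin L' -> (forall i, L (f i) = L' (f i)) -> L =1 L'.
Proof.
move=> tf bL bL' e; apply: (total_ind tf) => //.
- by move=> x; apply: closed_eq.
- by rewrite (lin0 bL.1) (lin0 bL'.1).
- by move=> k x y hx hy; rewrite bL.1 bL'.1 hx hy.
Qed.

Lemma blin_comp (V W U : normedModType C) (L : V -> W) (M : W -> U) :
  blin L -> blin M -> blin (M \o L).
Proof.
move=> [lL [K K0 hK]] [lM [K' K0' hK']]; split.
  by move=> k x y /=; rewrite lL lM.
exists (K' * K); first exact: mulr_ge0.
by move=> x /=; rewrite (le_trans (hK' _))// -mulrA ler_wpM2l.
Qed.

Lemma blin_id (V : normedModType C) : blin (@id V).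
Proof. by apply: (@blinP _ _ _ 1) => // x; rewrite mul1r. Qed.

Lemma blin0 (V W : normedModType C) : blin (fun _ : V => 0 : W).
Proof.
apply: (@blinP _ _ _ 0) => [k x y|x]; first by rewrite scaler0 addr0.
by rewrite nr0 mul0r.
Qed.

Lemma blin_scaleD (V W : normedModType C) (L M : V -> W) (k : C) :
  blin L -> blin M -> blin (fun x => k *: L x + M x).
Proof.
move=> [lL [K K0 hK]] [lM [K' K0' hK']]; split.
  by move=> c x y; rewrite lL lM; lmod.
exists (nr k * K + K'); first by rewrite addr_ge0// mulr_ge0// nr_ge0.
move=> x; rewrite (le_trans (nrD _ _))// nrZ mulrDl lerD// -mulrA.
by rewrite ler_wpM2l// nr_ge0.
Qed.

Lemma blin_sum (V W : normedModType C) I (s : seq I) (L : I -> V -> W) :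
  (forall i, blin (L i)) -> blin (fun x => \sum_(i <- s) L i x).
Proof.
move=> h; elim: s => [|i s IH].
  rewrite (_ : (fun _ => _) = fun=> 0); first exact: blin0.
  by apply/funext => x; rewrite big_nil.
rewrite (_ : (fun _ => _) = fun x => 1 *: L i x + \sum_(i <- s) L i x).
  exact: blin_scaleD.
by apply/funext => x; rewrite big_cons scale1r.
Qed.

Lemma blin_le_total I (V W : normedModType C) (f : I -> V) (L : V -> W) (M : R) :
  total f -> 0 <= M -> blin L -> (forall s, nr (L (lci f s)) <= M * nr (lci f s)) ->
  forall x, nr (L x) <= M * nr x.
Proof.
move=> tf M0 [lL [K K0 hK]] h x; apply: (@le_eps _ _ _ (M + K)) => d d0.
have [s hs] := tf x d d0; have := nr_leD (L x) (L (lci f s)); rewrite -(linB lL).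
have n1 : nr (lci f s) <= nr x + d.
  by have := nr_leD (lci f s) x; rewrite nrBC; lra.
have n2 : K * nr (x - lci f s) <= K * d by rewrite ler_wpM2l// ltW.
have n3 : M * nr (lci f s) <= M * (nr x + d) by rewrite ler_wpM2l.
by have := h s; have := hK (x - lci f s); lra.
Qed.

Lemma hil_eq (H : hilbert R) I (f : I -> H) (x y : H) : total f ->
  (forall i, hdot H x (f i) = hdot H y (f i)) -> x = y.
Proof.
move=> tf h; apply/eqP; rewrite -subr_eq0; apply/eqP; set z := x - y.
apply: nr_eq0; apply/le_anti; rewrite nr_ge0 andbT.
apply: (@le_eps _ _ _ 1) => d d0; have [s hs] := tf z d d0; rewrite add0r mul1r.
have e : hdot H z z = hdot H z (z - lci f s).
  rewrite [RHS]ipBr /lci ip_sumr big1 ?subr0// => p _.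
  by rewrite ipZr /z ipBl h subrr mulr0.
have := ip_CS z (z - lci f s); rewrite -e ipxx nrR ger0_norm ?sqr_ge0// expr2.
have [->|z0] := eqVneq (nr z) 0; first by move=> _; exact: ltW.
rewrite ler_pM2l ?lt_def ?z0 ?nr_ge0// => /le_trans; apply; exact: ltW.
Qed.


Lemma blin_lm (A : cstarAlgType R) (m : multiplier A) r : bnd m r -> blin (lm m).
Proof. by move=> h; apply: blinP h => k x y; exact: lmP. Qed.
Lemma blin_amull (A : cstarAlgType R) (a : A) : blin (fun b => a ** b).
Proof. by apply: (@blinP _ _ _ (nr a)) => [k x y|b]; rewrite ?amulDr ?amulZr ?nr_amul. Qed.
Lemma blin_amulr (A : cstarAlgType R) (b : A) : blin (fun a => a ** b).
Proof.
by apply: (@blinP _ _ _ (nr b)) => [k x y|a]; rewrite ?amulDl ?amulZl// mulrC nr_amul.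
Qed.

End Blin.

(** * Contractivity of homomorphisms and representations *)

Section Contraction.
Context (R : realType).
Local Notation C := R[i].

(** 1 - a^* a = (1 - z)^2 written without the unit and with z in A, so that homomorphisms and
    representations of A can be applied to it. *)
Lemma sqrt_one_sub (A : cstarAlgType R) (a : A) : nr a <= 1 ->
  exists z, [/\ star z = z, star a ** a = z + z - z ** z &
    forall x, x ** (star a ** a) = star a ** a ** x -> x ** z = z ** x].
Proof.
move=> a1.
have h1 : nr (star a ** a) <= 1 by rewrite nr_star_amul expr_le1// nr_ge0.
have [||y [ys _ yy yc /(_ _ erefl)[z yz]]] := @msqrt R A (membed (star a ** a)).
- by rewrite -membed_star starM starK.
- exact: bnd_le h1 (bnd_membed _).
exists z; split.
- by apply: membed_inj; rewrite membed_star -yz.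
- apply: membed_inj; rewrite membedB membedD (membedM z z) -yz.
  apply: oppr_inj; apply: (@addrI _ (mone A)); rewrite -yy.
  by rewrite !amulE !mul1m mulm1; lmod.
- move=> x xc; apply: membed_inj; rewrite !membedM -yz; apply: yc.
  by rewrite -!membedM xc.
Qed.

(** For self-adjoint h of norm at most 1, f(h) + i(1 - f(z)) is unitary, with z from [sqrt_one_sub],
    so f(h) is a contraction; scaling and the C*-identity give the general case. *)
Lemma hom_mbnd (A B : cstarAlgType R) (f : A -> multiplier B) :
  starhom f -> forall a, bnd (f a) (nr a).
Proof.
move=> [fl fm fs].
have sa1 h : star h = h -> nr h <= 1 -> bnd (f h) 1.
  move=> hs h1; have [z [zs hz zc]] := sqrt_one_sub h1.
  have hc : h ** z = z ** h by apply: zc; rewrite hs amulA.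
  apply: (@unitary_bnd _ _ _ _ (mone B - f z)) => //.
  - by rewrite -fs hs.
  - by rewrite starB star1m -fs zs.
  - by rewrite amulBr amulBl mulm1 mul1m -!fm hc.
  - rewrite -fm -{1}hs hz (linB fl) (linD fl) fm expr1n sR1.
    by rewrite !amulE !mul1m mulm1; lmod.
have sa h : star h = h -> bnd (f h) (nr h).
  move=> hs; have [h0|h0] := eqVneq (nr h) 0.
    by rewrite h0 (nr_eq0 h0) (lin0 fl); exact: bnd0.
  have hp : 0 < nr h by rewrite lt_def h0 nr_ge0.
  have -> : h = (nr h)%:C%C *: ((nr h)^-1%:C%C *: h) by rewrite scalerA RCK// scale1r.
  rewrite (linZ fl) nrZ nrR ger0_norm ?nr_ge0//.
  have -> : nr h * nr ((nr h)^-1%:C%C *: h) = nr ((nr h)%:C%C : C) * 1.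
    by rewrite nrZ !nrR !ger0_norm ?invr_ge0 ?nr_ge0// mulVf.
  apply: bndZ; apply: sa1; first by rewrite starZR hs.
  by rewrite nrZ nrR ger0_norm ?invr_ge0 ?nr_ge0// mulVf.
move=> a; apply: bnd_sq; first exact: nr_ge0.
rewrite -fs -fm -nr_star_amul; apply: sa; by rewrite starM starK.
Qed.

Lemma hom_membed (A B : cstarAlgType R) (f : A -> B) :
  starhom f -> starhom (fun a => membed (f a)).
Proof.
move=> [fl fm fs]; split=> [k a b|a b|a].
- by rewrite fl membedD membedZ.
- by rewrite fm membedM.
- by rewrite fs membed_star.
Qed.

Lemma hom_contr (A B : cstarAlgType R) (f : A -> B) : starhom f ->
  forall a, nr (f a) <= nr a.
Proof.
move=> hf a; apply: bnd_membed_le; first exact: nr_ge0.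
exact: (hom_mbnd (hom_membed hf)).
Qed.

Lemma ip_lci (H : hilbert R) I J (f : I -> H) (g : J -> H) (s : seq (C * I)) (t : seq (C * J)) :
  hdot H (lci f s) (lci g t) =
  \sum_(p <- s) \sum_(q <- t) p.1 * Num.conj q.1 * hdot H (f p.2) (g q.2).
Proof.
rewrite /lci ip_suml; apply: eq_bigr => p _.
rewrite ip_sumr; apply: eq_bigr => q _; rewrite ipZl ipZr; ring.
Qed.


Lemma nr_lci_le (V W : normedModType C) I (f : I -> V) (g : I -> W) (M : R) s :
  0 <= M -> (forall d : R, 0 < d -> nr (lci f s) <= (M + d) * nr (lci g s)) ->
  nr (lci f s) <= M * nr (lci g s).
Proof.
move=> M0 h; apply: (@le_eps _ _ _ (nr (lci g s))) => d d0.
by rewrite (mulrC _ d) -mulrDl; exact: h.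
Qed.

Section KernelRep.
Variables (A : cstarAlgType R) (I : Type) (k : I -> I -> C) (act : A -> I -> I).
Hypothesis act_lin : forall (c : C) a b i j,
  k (act (c *: a + b) i) j = c * k (act a i) j + k (act b i) j.
Hypothesis act_mul : forall a b i j, k (act (a ** b) i) j = k (act a (act b i)) j.
Hypothesis act_star : forall a i j, k (act a i) j = k i (act (star a) j).

(* 1 - a* a is the square of a self-adjoint element, so a acts contractively
   whenever |a| <= 1, on any space with a positive semidefinite form. *)
Lemma kernel_rep_on (H : hilbert R) (i : I -> H) : total i ->
  (forall a b, hdot H (i a) (i b) = k a b) ->
  exists2 pi : A -> H -> H, representation pi & forall a j, pi a (i j) = i (act a j).
Proof.
move=> ti hi.
have il (c : C) a b j : i (act (c *: a + b) j) = c *: i (act a j) + i (act b j).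
  by apply: (hil_eq ti) => l; rewrite ipDl ipZl !hi act_lin.
have i0 j : i (act 0 j) = 0.
  by have := il (-1) 0 0 j; rewrite scaleN1r oppr0 addr0 scaleN1r addNr.
have iZ (c : C) a j : i (act (c *: a) j) = c *: i (act a j).
  by rewrite -[c *: a]addr0 il i0 addr0.
have iD a b j : i (act (a + b) j) = i (act a j) + i (act b j).
  by rewrite -[a]scale1r il !scale1r.
have iN a j : i (act (- a) j) = - i (act a j) by rewrite -scaleN1r iZ scaleN1r.
have im a b j : i (act (a ** b) j) = i (act a (act b j)).
  by apply: (hil_eq ti) => l; rewrite !hi act_mul.
have ist a j l : hdot H (i (act a j)) (i l) = hdot H (i j) (i (act (star a) l)).
  by rewrite !hi act_star.
have iB a s : nr a <= 1 -> nr (lci (i \o act a) s) <= nr (lci i s).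
  move=> a1; have [z [zs az _]] := sqrt_one_sub a1.
  pose X := lci i s; pose Y := lci (i \o act a) s; pose Z := lci (i \o act z) s.
  suff e : hdot H X X = hdot H Y Y + hdot H (X - Z) (X - Z).
    rewrite -ler_sqr ?nnegrE ?nr_ge0// -lecR -!ipxx -/X -/Y e lerDl ipxx ler0c.
    exact: sqr_ge0.
  rewrite ipBl !ipBr.
  suff -> : hdot H Y Y = hdot H Z X + hdot H X Z - hdot H Z Z by ring.
  rewrite !ip_lci -big_split -sumrB /=; apply: eq_bigr => p _.
  rewrite -big_split -sumrB /=; apply: eq_bigr => q _.
  rewrite -mulrDr -mulrBr; congr (_ * _).
  rewrite /= ist -im az !iD iN im !ipDr ipNr.
  by rewrite !(ist z p.2) zs.
have bd a s : nr (lci (i \o act a) s) <= nr a * nr (lci i s).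
  apply: nr_lci_le; first exact: nr_ge0.
  move=> d d0; have ad : 0 < nr a + d by rewrite ltr_wpDl// nr_ge0.
  have n1 : nr ((nr a + d)^-1%:C%C *: a) <= 1.
    rewrite nrZ nrR ger0_norm ?invr_ge0 ?(ltW ad)//.
    by rewrite mulrC ler_pdivrMr// mul1r lerDl ltW.
  have := iB _ s n1.
  have -> : lci (i \o act ((nr a + d)^-1%:C%C *: a)) s =
     (nr a + d)^-1%:C%C *: lci (i \o act a) s.
    rewrite -lci_scs /lci big_map; apply: eq_bigr => p _ /=.
    by rewrite mulrC -scalerA iZ.
  rewrite nrZ nrR ger0_norm ?invr_ge0 ?(ltW ad)//.
  by rewrite mulrC ler_pdivrMr// mulrC.
have /choice[pi hpi] : forall a, exists L : H -> H, [/\ linear L,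
    forall x, nr (L x) <= nr a * nr x & forall j, L (i j) = i (act a j)].
  by move=> a; apply: (ext_total ti) (bd a); exact: nr_ge0.
have pb a : blin (pi a) by have [h1 h2 _] := hpi a; exact: blinP h2.
have pE a j : pi a (i j) = i (act a j) by have [_ _ ->] := hpi a.
exists pi => //; split.
- by move=> a; have [] := hpi a.
- move=> x c a b; move: x.
  apply: (total_eq ti (pb _) (blin_scaleD c (pb a) (pb b))) => j.
  by rewrite !pE il.
- move=> a b; apply: (total_eq ti (pb _) (blin_comp (pb b) (pb a))).
  by move=> j /=; rewrite !pE im.
- move=> a x y; have h j l : hdot H (pi a (i j)) (i l) = hdot H (i j) (pi (star a) (i l)).
    by rewrite !pE.
  have ev (s t : seq (C * I)) : hdot H (pi a (lci i s)) (lci i t) =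
      hdot H (lci i s) (pi (star a) (lci i t)).
    rewrite !(lci_lin _ _ (pb _).1) !ip_lci; apply: eq_bigr => p _.
    by apply: eq_bigr => q _ /=; rewrite h.
  apply/eqP; rewrite -subr_eq0; apply/eqP/nr_small_eq0 => e e0.
  apply: (@le_eps _ _ _ (2 * nr a * (nr x + nr y + 1))).
  move=> d d0; wlog d1 : d d0 / d <= 1.
    move=> hw; have [|d1] := leP d 1; first exact: hw.
    apply: le_trans (hw 1 ltr01 (lexx _)) _; rewrite lerD2l ler_wpM2l ?(ltW d1)//.
    by rewrite !mulr_ge0 ?addr_ge0 ?nr_ge0.
  have [s hs] := ti x d d0; have [t ht] := ti y d d0.
  have -> : hdot H (pi a x) y - hdot H x (pi (star a) y) =
     hdot H (pi a (x - lci i s)) y + hdot H (pi a (lci i s)) (y - lci i t) -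
     (hdot H (x - lci i s) (pi (star a) y) +
      hdot H (lci i s) (pi (star a) (y - lci i t))).
    rewrite (linB (pb a).1) (linB (pb (star a)).1) !ipBl !ipBr ev; ring.
  have B u v : nr (hdot H (pi a u) v) <= nr a * nr u * nr v.
    apply: le_trans (ip_CS _ _) _; rewrite ler_wpM2r ?nr_ge0//.
    by have [_ -> _] := hpi a.
  have B' u v : nr (hdot H u (pi (star a) v)) <= nr a * nr u * nr v.
    apply: le_trans (ip_CS _ _) _; have -> : nr a * nr u * nr v = nr u * (nr a * nr v) by ring.
    rewrite ler_wpM2l ?nr_ge0//.
    by have [_ h2 _] := hpi (star a); rewrite -(nr_star a).
  apply: le_trans (nrB _ _) _.
  apply: le_trans (lerD (nrD _ _) (nrD _ _)) _.
  apply: le_trans (lerD (lerD (B _ _) (B _ _)) (lerD (B' _ _) (B' _ _))) _.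
  have sx : nr (lci i s) <= nr x + 1.
    by have := nr_leD (lci i s) x; rewrite nrBC; lra.
  have a0 := nr_ge0 a.
  have h1 : nr a * nr (x - lci i s) * nr y <= nr a * d * nr y.
    by rewrite ler_wpM2r ?nr_ge0// ler_wpM2l// ltW.
  have h2 : nr a * nr (lci i s) * nr (y - lci i t) <= nr a * (nr x + 1) * d.
    by apply: ler_pM; rewrite ?mulr_ge0 ?nr_ge0 ?(ltW ht)// ler_wpM2l.
  have -> : e + 2 * nr a * (nr x + nr y + 1) * d =
    e + (nr a * d * nr y + nr a * (nr x + 1) * d + (nr a * d * nr y + nr a * (nr x + 1) * d)).
    by ring.
  rewrite -[leLHS]add0r; apply: lerD; first exact: ltW.
  by apply: lerD; apply: lerD.
Qed.

Lemma kernel_rep : kernel k -> exists (H : hilbert R) (i : I -> H) (pi : A -> H -> H),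
  [/\ representation pi, total i, forall a b, hdot H (i a) (i b) = k a b &
    forall a j, pi a (i j) = i (act a j)].
Proof.
move=> hk; have [H [i [ti hi]]] := kernel_hilbert hk.
by have [pi h1 h2] := kernel_rep_on ti hi; exists H, i, pi.
Qed.

End KernelRep.

(** For |a| <= 1, with z from [sqrt_one_sub], |x|^2 = |pi(a)x|^2 + |x - pi(z)x|^2. *)
Lemma rep_bnd (A : cstarAlgType R) (H : hilbert R) (pi : A -> H -> H) :
  representation pi -> forall a x, nr (pi a x) <= nr a * nr x.
Proof.
move=> [pl pla pm ps] a x.
have B1 b y : nr b <= 1 -> nr (pi b y) <= nr y.
  move=> b1; have [z [zs bz _]] := sqrt_one_sub b1.
  suff e : hdot H y y = hdot H (pi b y) (pi b y) + hdot H (y - pi z y) (y - pi z y).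
    rewrite -ler_sqr ?nnegrE ?nr_ge0// -lecR -!ipxx e lerDl ipxx ler0c.
    exact: sqr_ge0.
  have pD c d : pi (c + d) y = pi c y + pi d y := linD (pla y) c d.
  rewrite ipBl !ipBr (ps b) -pm bz pD pD (linN (pla y)) pm !ipDr ipNr.
  by rewrite !(ps z) zs; ring.
apply: (@le_eps _ _ _ (nr x)) => d d0; rewrite (mulrC _ d) -mulrDl.
have ad : 0 < nr a + d by rewrite ltr_wpDl// nr_ge0.
have n1 : nr ((nr a + d)^-1%:C%C *: a) <= 1.
  rewrite nrZ nrR ger0_norm ?invr_ge0 ?(ltW ad)//.
  by rewrite mulrC ler_pdivrMr// mul1r lerDl ltW.
have := B1 _ x n1; rewrite (linZ (pla x)) nrZ nrR ger0_norm ?invr_ge0 ?(ltW ad)//.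
by rewrite mulrC ler_pdivrMr// mulrC.
Qed.

Lemma rep_blin (A : cstarAlgType R) (H : hilbert R) (pi : A -> H -> H) a :
  representation pi -> blin (pi a).
Proof.
move=> hp; apply: (@blinP _ _ _ _ (nr a)); first exact: (rep_linear hp).
exact: rep_bnd.
Qed.
Lemma rep_blinl (A : cstarAlgType R) (H : hilbert R) (pi : A -> H -> H) x :
  representation pi -> blin (pi^~ x).
Proof.
move=> hp; apply: (@blinP _ _ _ _ (nr x)); first exact: (rep_linearl hp).
by move=> a; rewrite mulrC rep_bnd.
Qed.

End Contraction.

(** * The Hahn-Banach theorem for sublinear functionals *)

Section HahnBanach.
Context (R : realType) (V : lmodType R[i]) (p : V -> R).
Local Notation C := R[i].
Implicit Types (x y : V) (r s t : R).
Hypothesis pD : forall x y, p (x + y) <= p x + p y.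
Hypothesis pZ : forall r x, 0 <= r -> p (r%:C%C *: x) = r * p x.

Let lin_graph (G : set (V * R)) := G (0, 0) /\ forall r x s y t, G (x, s) -> G (y, t) ->
  G (r%:C%C *: x + y, r * s + t).
Let dominated (G : set (V * R)) := forall x s, G (x, s) -> s <= p x.

Let extend (G : set (V * R)) x1 : lin_graph G -> dominated G ->
  exists c, let G' := [set z | exists x s t, G (x, s) /\ z = (x + t%:C%C *: x1, s + t * c)] in
    lin_graph G' /\ dominated G'.
Proof.
move=> [G0 GD] dG.
have GZ r x s : G (x, s) -> G (r%:C%C *: x, r * s).
  by move=> h; have := GD r _ _ _ _ h G0; rewrite !addr0.
have GA x s y t : G (x, s) -> G (y, t) -> G (x + y, s + t).
  by move=> h h'; have := GD 1 _ _ _ _ h h'; rewrite scale1r mul1r.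
(* The value c at x1 must lie above all s - p(x - x1) and below all p(y + x1) - t; [key] says that
   there is room, and the supremum of the lower bounds is taken. *)
pose S := [set z | exists x s, G (x, s) /\ z = s - p (x - x1)].
have key x s y t : G (x, s) -> G (y, t) -> s - p (x - x1) <= p (y + x1) - t.
  move=> hx hy; have := dG _ _ (GA _ _ _ _ hx hy).
  have -> : x + y = (x - x1) + (y + x1) by lmod.
  by move=> /le_trans /(_ (pD _ _)); lra.
have S0 : S !=set0 by exists (0 - p (0 - x1)), 0, 0.
have Sub y t : G (y, t) -> ubound S (p (y + x1) - t).
  by move=> hy _ [x [s [hx ->]]]; exact: key.
pose c := sup S.
have c1 x s : G (x, s) -> s - p (x - x1) <= c.
  by move=> hx; apply: ub_le_sup; [exists (p (0 + x1) - 0); exact: Sub|exists x, s].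
have c2 x s : G (x, s) -> c <= p (x + x1) - s.
  by move=> hx; apply: ge_sup => //; exact: Sub.
exists c; split; [split|].
- by exists 0, 0, 0; split => //; rewrite scale0r mul0r !addr0.
- move=> r x s y t [x' [s' [a [h1 [-> ->]]]]] [y' [t' [b [h2 [-> ->]]]]].
  exists (r%:C%C *: x' + y'), (r * s' + t'), (r * a + b); split; first exact: GD.
  by rewrite rmorphD rmorphM /=; congr (_, _); [lmod|ring].
- move=> x s [x' [s' [t [h [-> ->]]]]].
  have [t0|t0|->] := ltgtP t 0.
  + have tn : t != 0 by rewrite lt_eqF.
    have := c1 _ _ (GZ (- t)^-1 _ _ h).
    have nt : 0 < - t by rewrite oppr_gt0.
    rewrite -(ler_pM2l nt) mulrBr -pZ ?(ltW nt)// mulrA mulfV ?gt_eqF// mul1r.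
    rewrite scalerBr scalerA -rmorphM /= mulfV ?gt_eqF// scale1r rmorphN scaleNr opprK.
    by rewrite mulNr; lra.
  + have tn : t != 0 by rewrite gt_eqF.
    have := c2 _ _ (GZ t^-1 _ _ h).
    rewrite -(ler_pM2l t0) mulrBr -pZ ?(ltW t0)// mulrA mulfV// mul1r.
    rewrite scalerDr scalerA -rmorphM /= mulfV// scale1r.
    by lra.
  + by rewrite scale0r mul0r !addr0; exact: dG.
Qed.

(** Zorn's lemma on the graphs of real-linear functionals dominated by p, starting from t x0 -> t
    p(x0). Only real scalars occur, since p is homogeneous for nonnegative reals only. *)
Lemma hahn_banach x0 : exists f : V -> R,
  [/\ forall r x y, f (r%:C%C *: x + y) = r * f x + f y,
      forall x, f x <= p x & f x0 = p x0].
Proof.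
have p0 : p 0 = 0 by rewrite -(scale0r (0 : V)) -[0 in LHS]/((0 : R)%:C%C) pZ// mul0r.
pose G0 : set (V * R) := [set z | exists t, z = (t%:C%C *: x0, t * p x0)].
pose nice G := [/\ lin_graph G, dominated G & G (x0, p x0)].
have nG0 : nice G0.
  split; last by exists 1; rewrite scale1r mul1r.
    split; first by exists 0; rewrite scale0r mul0r.
    move=> r x s y t [a [-> ->]] [b [-> ->]]; exists (r * a + b).
    by rewrite rmorphD rmorphM /=; congr (_, _); [lmod|ring].
  move=> x s [t [-> ->]]; have [t0|t0] := leP 0 t; first by rewrite pZ.
  have nt : 0 <= - t by rewrite oppr_ge0 ltW.
  have := pD (t%:C%C *: x0) ((- t)%:C%C *: x0); rewrite (pZ _ nt).
  by rewrite -scalerDl -rmorphD /= subrr scale0r p0; lra.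
have [F tF|G [PG mG]] := @Zorn_bigcup (V * R)%type [set G | G = set0 \/ nice G].
  move=> tot; have [allE|] := pselect (forall G, F G -> G = set0).
    by left; rewrite -subset0 => z [G /allE ->].
  move=> /existsNP[G1 /not_implyP[FG1 G1n]]; right.
  have nF G : F G -> G = set0 \/ nice G by move=> /tF.
  have [e|[[l1 l2] d1 b1]] := nF _ FG1; first by [].
  split; [split|..].
  - by exists G1.
  - move=> r x s y t [A FA Ax] [B FB By].
    have [|] := tot _ _ FA FB => AB.
      have [e|[[_ h] _ _]] := nF _ FB; first by rewrite e in By.
      by exists B => //; apply: h => //; exact: AB.
    have [e|[[_ h] _ _]] := nF _ FA; first by rewrite e in Ax.
    by exists A => //; apply: h => //; exact: AB.
  - move=> x s [A FA Ax]; have [e|[_ h _]] := nF _ FA; first by rewrite e in Ax.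
    exact: h.
  - by exists G1.
case: PG => [GE|[lG dG bG]].
  exfalso; apply: (mG G0); last by right.
  rewrite GE; split; first by move=> z [].
  by move=> /(_ (x0, p x0)); apply; case: nG0.
have tot x : exists s, G (x, s).
  have [//|nx] := pselect (exists s, G (x, s)); exfalso.
  have [c [lG' dG']] := extend x lG dG.
  set G' := [set z | _] in lG' dG'.
  have sub : G `<=` G'.
    by move=> [y s] h; exists y, s, 0; rewrite scale0r mul0r !addr0.
  apply: (mG G'); last by right; split => //; exact: sub.
  split=> // sub'; apply: nx; exists c; apply: sub'.
  exists 0, 0, 1; split; first by case: lG.
  by rewrite scale1r mul1r !add0r.
have uniq x s t : G (x, s) -> G (x, t) -> s = t.
  have H u v : G (x, u) -> G (x, v) -> u <= v.
    move=> hu hv; have := dG _ _ (lG.2 (-1) _ _ _ _ hv hu).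
    by rewrite rmorphN rmorph1 scaleN1r addNr p0 mulN1r; lra.
  by move=> h h'; apply/le_anti; rewrite !H.
have [f hf] := choice tot.
exists f; split.
- by move=> r x y; apply: uniq (hf _) _; apply: lG.2.
- by move=> x; exact: dG.
- exact: uniq (hf _) bG.
Qed.

End HahnBanach.

(** * States and the Gelfand-Naimark theorem *)

Section GN.
Context (R : realType) (A : cstarAlgType R).
Local Notation C := R[i].
Implicit Types (a b x y h : A).

Let cone (s : seq A) : A := \sum_(x <- s) star x ** x.
Let re x : A := (2^-1 : R)%:C%C *: (x + star x).
Let S x : set R := [set r | exists s, r = nr (re x + cone s)].
(** The distance from - Re x to the cone of sums of y^* y. A real functional below p is contractive
    on self-adjoint elements, vanishes on skew-adjoint ones and is nonnegative on the cone, while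
    p(a^* a) = |a|^2; so one application of Hahn-Banach yields a norming state. *)
Let p x : R := inf (S x).

Let S0 x : S x !=set0.
Proof. by exists (nr (re x + cone [::])), [::]. Qed.
Let Slb x : has_lbound (S x).
Proof. by exists 0 => _ [s ->]; exact: nr_ge0. Qed.
Let p_le x s : p x <= nr (re x + cone s).
Proof. by apply: ge_inf; [exact: Slb|exists s]. Qed.
Let p_ge x r : (forall s, r <= nr (re x + cone s)) -> r <= p x.
Proof. by move=> h; apply: lb_le_inf => // _ [s ->]. Qed.
Let p_adh x (e : R) : 0 < e -> exists s, nr (re x + cone s) < p x + e.
Proof.
move=> e0; have [_ [s ->] h] := inf_adherent e0 (conj (S0 x) (Slb x)).
by exists s.
Qed.
Let reD x y : re (x + y) = re x + re y.
Proof. by rewrite /re starD; lmod. Qed.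
Let reZ (r : R) x : re (r%:C%C *: x) = r%:C%C *: re x.
Proof. by rewrite /re starZR; lmod. Qed.
Let coneD s t : cone (s ++ t) = cone s + cone t.
Proof. by rewrite /cone big_cat. Qed.
Let coneZ (r : R) s : 0 <= r -> r%:C%C *: cone s = cone [seq (Num.sqrt r)%:C%C *: x | x <- s].
Proof.
move=> r0; rewrite /cone big_map scaler_sumr; apply: eq_bigr => x _.
by rewrite starZR amulZl amulZr scalerA -rmorphM /= -expr2 sqr_sqrtr.
Qed.
Let pD x y : p (x + y) <= p x + p y.
Proof.
apply: (@le_eps _ _ _ 2) => e e0.
have [s hs] := p_adh x e0; have [t ht] := p_adh y e0.
apply: le_trans (p_le _ (s ++ t)) _; rewrite reD coneD addrACA.
by have := nrD (re x + cone s) (re y + cone t); lra.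
Qed.
Let pZ (r : R) x : 0 <= r -> p (r%:C%C *: x) = r * p x.
Proof.
have H (q : R) z : 0 < q -> p (q%:C%C *: z) <= q * p z.
  move=> q0; apply: (@le_eps _ _ _ q) => e e0; have [s hs] := p_adh z e0.
  apply: le_trans (p_le _ [seq (Num.sqrt q)%:C%C *: x | x <- s]) _.
  rewrite reZ -coneZ ?(ltW q0)// -scalerDr nrZ nrR gtr0_norm//.
  by rewrite -mulrDr ler_pM2l// ltW.
rewrite le_eqVlt => /orP[/eqP <-|r0].
  rewrite mul0r; apply/le_anti/andP; split; last by apply: p_ge => s; exact: nr_ge0.
  by apply: le_trans (p_le _ [::]) _; rewrite reZ scale0r /cone big_nil addr0 nr0.
apply/le_anti; rewrite H//=.
have ri : 0 < r^-1 by rewrite invr_gt0.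
have := H _ (r%:C%C *: x) ri; rewrite scalerA -rmorphM /= mulVf ?gt_eqF// scale1r.
by rewrite -(ler_pM2l r0) mulrA mulfV ?gt_eqF// mul1r.
Qed.

Lemma state_exists a : exists f : A -> C, [/\ scalar f,
  forall x, f (star x) = Num.conj (f x), forall x, 0 <= f (star x ** x),
  forall h, star h = h -> nr (f h) <= nr h &
  f (star a ** a) = (nr a ^+ 2)%:C%C].
Proof.
have [g [gl gp ga]] := hahn_banach pD pZ (star a ** a).
have g0 : g 0 = 0 by have := gl (-1) 0 0; rewrite scaler0 addr0; lra.
have gD x y : g (x + y) = g x + g y by have := gl 1 x y; rewrite scale1r mul1r.
have gZ (r : R) x : g (r%:C%C *: x) = r * g x by have := gl r x 0; rewrite g0 !addr0.
have gN x : g (- x) = - g x.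
  by have := gl (-1) x 0; rewrite rmorphN rmorph1 scaleN1r mulN1r g0 !addr0.
have re_sa h : star h = h -> re h = h.
  by move=> hs; rewrite /re hs scalerDr -scalerDl half2 scale1r.
have psa h : star h = h -> p h <= nr h.
  move=> hs; apply: le_trans (p_le _ [::]) _.
  by rewrite re_sa// /cone big_nil addr0.
have gsa h : star h = h -> `|g h| <= nr h.
  move=> hs; rewrite ler_norml; apply/andP; split; last exact: le_trans (gp _) (psa _ hs).
  by rewrite lerNl -gN -nrN (le_trans (gp _))// psa// starN hs.
pose i : C := 'i%C.
have ii : i * i = -1 := mul_ii R.
have ian h : star h = - h -> g h = 0.
  move=> hs; have r0 : re h = 0 by rewrite /re hs subrr scaler0.
  have pz k : re k = 0 -> p k <= 0.
    by move=> k0; apply: le_trans (p_le _ [::]) _; rewrite k0 /cone big_nil addr0 nr0.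
  apply/le_anti; rewrite (le_trans (gp _) (pz _ r0))//=.
  by rewrite -oppr_le0 -gN (le_trans (gp _))// pz// /re starN hs subrr scaler0.
have gpos x : 0 <= g (star x ** x).
  rewrite -oppr_le0 -gN (le_trans (gp _))//; apply: le_trans (p_le _ [:: x]) _.
  rewrite re_sa ?starN ?starM ?starK// /cone big_seq1 addrC subrr nr0.
  exact: lexx.
(* The complex functional whose real part is g. *)
pose f x : C := (g x)%:C%C - i * (g (i *: x))%:C%C.
have fsa h : star h = h -> f h = (g h)%:C%C.
  move=> hs; have h0 : g (i *: h) = 0 by apply: ian; rewrite starZ hs conj_i scaleNr.
  by rewrite /f h0 rmorph0 mulr0 subr0.
exists f; split.
- move=> c x y; rewrite /f.
  have -> : c = (complex.Re c)%:C%C + i * (complex.Im c)%:C%C by exact: complexE.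
  set u := complex.Re c; set v := complex.Im c.
  have e1 : g ((u%:C%C + i * v%:C%C) *: x + y) = u * g x + v * g (i *: x) + g y.
    by rewrite gD scalerDl gD gZ [i * _]mulrC -scalerA gZ.
  have e2 : g (i *: ((u%:C%C + i * v%:C%C) *: x + y)) = u * g (i *: x) - v * g x + g (i *: y).
    rewrite scalerDr gD scalerA mulrDr mulrA ii mulN1r scalerDl gD.
    by rewrite [i * _]mulrC -scalerA gZ scaleNr gN gZ.
  rewrite e1 e2 !rmorphD !rmorphN !rmorphM /=.
  move: (g x)%:C%C (g (i *: x))%:C%C (g y)%:C%C (g (i *: y))%:C%C u%:C%C v%:C%C.
  move=> X X' Y Y' U W.
  have -> : (U + i * W) * (X - i * X') = U * X + i * (W * X) - i * (U * X') - (i * i) * (W * X').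
    by ring.
  by rewrite ii; ring.
- move=> x; have e1 : g (star x) = g x.
    apply/eqP; rewrite -subr_eq0 -gN -gD; apply/eqP/ian.
    by rewrite starD starN starK; lmod.
  have e2 : g (i *: star x) = - g (i *: x).
    apply/eqP; rewrite -subr_eq0 opprK -gD; apply/eqP/ian.
    by rewrite starD !starZ starK conj_i; lmod.
  have cf (u v : R) : Num.conj (u%:C%C - i * v%:C%C) = u%:C%C + i * v%:C%C.
    by rewrite rmorphB rmorphM /= conj_i !conjR mulNr opprK.
  by rewrite cf /f e1 e2 rmorphN; ring.
- by move=> x; rewrite fsa ?ler0c ?gpos// starM starK.
- by move=> h hs; rewrite fsa// nrR gsa.
- rewrite fsa ?starM ?starK//; congr (_%:C%C); rewrite ga -nr_star_amul.
  have sa : star (star a ** a) = star a ** a by rewrite starM starK.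
  apply/le_anti/andP; split; first exact: psa.
  by apply: p_ge => s; rewrite re_sa//; exact: nr_star_mul_cone.
Qed.

Lemma ideal_setT : ideal (setT : set A).
Proof. by split => //; exact: closedT. Qed.

(** The GNS representation of a state f with f(a^* a) = |a|^2. In place of a cyclic vector it uses
    the class of an approximate unit u for a^*: the squared norm of its image under a is f(u a^* a
    u), which is close to |a|^2, while its own squared norm f(u u) is at most 1. *)
Lemma gelfand_naimark a (r : R) : 0 <= r ->
  (forall (H : hilbert R) (pi : A -> H -> H), representation pi ->
     forall x : H, nr (pi a x) <= r * nr x) -> nr a <= r.
Proof.
move=> r0 h; have [f [fl fs fp fb fa]] := state_exists a.
pose k x y : C := f (star y ** x).
have fD x y : f (x + y) = f x + f y by rewrite -[x]scale1r fl mul1r scale1r.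
have f0 : f 0 = 0 by have := fl (-1) 0 0; rewrite scaler0 addr0 mulN1r addNr.
have fZ (c : C) x : f (c *: x) = c * f x by rewrite -[c *: x]addr0 fl f0 addr0.
have fN x : f (- x) = - f x by rewrite -scaleN1r fZ mulN1r.
have f_sum I (s : seq I) (g : I -> A) : f (\sum_(i <- s) g i) = \sum_(i <- s) f (g i).
  by elim/big_rec2: _ => [|j u v _ <-].
have hk : kernel k.
  split=> [x y|s]; first by rewrite /k -fs starM starK.
  have -> : kform k s s = f (star (lci id s) ** lci id s).
    rewrite /kform exchange_big /lci star_sum amul_suml f_sum; apply: eq_bigr => q _.
    rewrite amul_sumr f_sum; apply: eq_bigr => c _ /=.
    by rewrite starZ amulZl amulZr !fZ mulrA [c.1 * _]mulrC.
  exact: fp.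
have [|||//|H [i [pi [rp ti hi he]]]] := @kernel_rep R A A k (fun x y => x ** y).
- by move=> c x y z w; rewrite /k amulDl amulDr amulZl amulZr fl.
- by move=> x y z w; rewrite /k !amulA.
- by move=> x y z; rewrite /k starM starK !amulA.
rewrite -ler_sqr ?nnegrE ?nr_ge0//; apply: (@le_eps _ _ _ (2 * nr a)) => e e0.
have [|u [_ us _ u1 hu]] := @approx_unit R A setT [:: star a] e ideal_setT e0.
  by [].
have := hu (star a); rewrite mem_head => /(_ isT).
rewrite -nr_star starB starM starK us => au.
have := h H pi rp (i u).
rewrite -ler_sqr ?nnegrE ?mulr_ge0 ?nr_ge0// exprMn -lecR [leRHS]rmorphM /=.
rewrite -!ipxx he !hi /k starM us.
set X := f _; set Y := f _ => hXY.
have fX : X = (nr X)%:C%C by apply: ge0_nrE; rewrite /X -us -starM us; exact: fp.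
have fY : Y = (nr Y)%:C%C by apply: ge0_nrE; rewrite /Y -{1}us; exact: fp.
have Y1 : nr Y <= 1.
  apply: le_trans (fb _ _) _; first by rewrite starM us.
  by apply: le_trans (nr_amul _ _) _; rewrite mulr_ile1 ?nr_ge0.
have XY : nr X <= r ^+ 2.
  move: hXY; rewrite {1}fX {1}fY -rmorphM lecR => /le_trans; apply.
  by rewrite -[leRHS]mulr1 ler_wpM2l// sqr_ge0.
have d1 : nr (f (star a ** a) - X) <= 2 * nr a * e.
  have -> : f (star a ** a) - X = f (star a ** a - u ** star a ** (a ** u)).
    by rewrite fD fN.
  apply: le_trans (fb _ _) _; first by rewrite starB !starM starK us !amulA.
  have -> : star a ** a - u ** star a ** (a ** u) =
     star a ** (a - a ** u) + (star a - u ** star a) ** (a ** u).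
    by rewrite !amulE; lmod.
  have n1 : nr (star a ** (a - a ** u)) <= nr a * e.
    apply: le_trans (nr_amul _ _) _; rewrite nr_star ler_wpM2l ?nr_ge0//.
    exact: ltW.
  have n2 : nr ((star a - u ** star a) ** (a ** u)) <= e * nr a.
    apply: le_trans (nr_amul _ _) _; apply: ler_pM; rewrite ?nr_ge0//.
      by rewrite -nr_star starB starM starK us ltW.
    by apply: le_trans (nr_amul _ _) _; rewrite ler_piMr ?nr_ge0.
  by have := nrD (star a ** (a - a ** u)) ((star a - u ** star a) ** (a ** u)); lra.
have : nr (f (star a ** a)) <= nr X + nr (f (star a ** a) - X) by exact: nr_leD.
by rewrite [in leLHS]fa nrR ger0_norm ?sqr_ge0// => /le_trans; apply; exact: lerD XY d1.
Qed.

End GN.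

(** * Tensor products of Hilbert spaces and of representations *)

Section Cspan.
Context (R : realType).
Local Notation C := R[i].

Lemma cspanP (V : normedModType C) (S : set V) x : cspan S x <->
  forall e : R, 0 < e -> exists s : seq (C * V), (forall p, p \in s -> S p.2) /\
    nr (x - lci id s) < e.
Proof.
rewrite /cspan closureP; split=> h e e0.
  by have [y [s [hs ->]] hy] := h e e0; exists s.
by have [s [hs hx]] := h e e0; exists (lci id s) => //; exists s.
Qed.

Lemma lci_map (V : lmodType C) I J (f : J -> V) (g : I -> J) (s : seq (C * I)) :
  lci f [seq (p.1, g p.2) | p <- s] = lci (f \o g) s.
Proof. by rewrite /lci big_map. Qed.

Lemma cspan_total (V : normedModType C) I (f : I -> V) (S : set V) :
  cspan S = setT -> (forall x, S x -> exists i, x = f i) -> total f.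
Proof.
move=> hS hf x e e0.
have : cspan S x by rewrite hS.
move=> /cspanP /(_ e e0)[s [sS hx]].
suff [t ht] : exists t, lci f t = lci id s by exists t; rewrite ht.
elim: s sS {hx} => [|p s IH] sS; first by exists [::]; rewrite /lci !big_nil.
have [t ht] : exists t, lci f t = lci id s.
  by apply: IH => q qs; apply: sS; rewrite in_cons qs orbT.
have [i hi] := hf p.2 (sS p (mem_head _ _)).
by exists ((p.1, i) :: t); rewrite /lci !big_cons -!/(lci _ _) ht /= hi.
Qed.

Lemma mem_lci_map (V : normedModType C) I (f : I -> V) (S : set V) (s : seq (C * I)) :
  (forall i, S (f i)) -> forall p, p \in [seq (p.1, f p.2) | p <- s] -> S p.2.
Proof.
move=> hf; elim: s => //= q s IH p; rewrite in_cons => /orP[/eqP ->|]; [exact: hf|exact: IH].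
Qed.

Lemma total_cspan (V : normedModType C) I (f : I -> V) (S : set V) :
  total f -> (forall i, S (f i)) -> cspan S = setT.
Proof.
move=> tf hf; rewrite -subTset => x _; apply/cspanP => e e0.
have [s hs] := tf x e e0; exists [seq (p.1, f p.2) | p <- s].
by rewrite lci_map; split => //; exact: mem_lci_map.
Qed.


(** [tdot], [tact] and [spatial_bound] take lists of pairs without coefficients, so the scalars are
    absorbed into the first leg. *)
Definition absl (V W : lmodType C) (s : seq (C * (V * W))) : seq (V * W) :=
  [seq (p.1 *: p.2.1, p.2.2) | p <- s].

Lemma lci_absl (U V W : lmodType C) (f : V -> W -> U) s :
  (forall w, linear (f^~ w)) ->
  lci (fun p => f p.1 p.2) s = \sum_(p <- absl s) f p.1 p.2.
Proof.
move=> lf; rewrite /lci big_map; apply: eq_bigr => p _ /=.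
by rewrite (linZ (lf _)).
Qed.


Lemma blin_continuous (V W : normedModType C) (L : V -> W) : blin L -> continuous L.
Proof.
move=> [lL [K K0 hK]]; apply/continuous_nrP => x e e0.
exists (e / (K + 1)); first by rewrite divr_gt0// ltr_wpDl.
move=> y; rewrite ltr_pdivlMr ?ltr_wpDl// -(linB lL) => hy.
apply: le_lt_trans (hK _) _; apply: le_lt_trans hy.
by rewrite mulrDr mulr1 mulrC lerDl nr_ge0.
Qed.

Lemma continuous_blin (V W : normedModType C) (L : V -> W) :
  linear L -> continuous L -> blin L.
Proof.
move=> lL /continuous_nrP /(_ 0 1 ltr01)[d d0 hd].
apply: (@blinP _ _ _ _ (d / 2)^-1) => // x.
have d2 : 0 < d / 2 by rewrite divr_gt0.
rewrite mulrC ler_pdivlMr//; apply: (@le_eps _ _ _ 1) => e e0; rewrite mul1r.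
have x0 : 0 < nr x + e by rewrite ltr_wpDl// nr_ge0.
have k0 : 0 < d / 2 / (nr x + e) by rewrite divr_gt0.
have := hd ((d / 2 / (nr x + e))%:C%C *: x); rewrite !(subr0, sub0r, nrN) (lin0 lL).
rewrite ?subr0 ?sub0r ?nrN (linZ lL) !nrZ !nrR !gtr0_norm//.
move=> h; have {h} : d / 2 / (nr x + e) * nr (L x) < 1.
  apply: h; rewrite mulrAC ltr_pdivrMr// mulrDr.
  have : d / 2 * nr x <= d * nr x by rewrite ler_wpM2r ?nr_ge0//; lra.
  have : 0 < d * e by rewrite mulr_gt0.
  by lra.
by rewrite mulrAC ltr_pdivrMr// mul1r mulrC => /ltW.
Qed.

End Cspan.

(** * The complex numbers as a C*-algebra *)

Section Cx.
Context (R : realType).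
Local Notation C := R[i].
(** Target of the trivial representation of G, and of functionals when these are treated as bounded
    linear maps. *)
Definition cplx : Type := (C : numFieldType)^o.
HB.instance Definition _ := NormedModule.on cplx.
Fact cplx_complete : forall u : nat -> cplx, cau u -> exists l, cvs u l.
Proof. exact: (@complete_cvsC R). Qed.
HB.instance Definition _ := Uniform_isComplete.Build cplx (seq_complete cplx_complete).
Implicit Types x y : C.
Fact cxA : associative (fun x y : cplx => (x * y : C) : cplx). Proof. exact: mulrA. Qed.
Fact cxDl : left_distributive (fun x y : cplx => (x * y : C) : cplx) +%R. Proof. exact: mulrDl. Qed.
Fact cxDr : right_distributive (fun x y : cplx => (x * y : C) : cplx) +%R. Proof. exact: mulrDr. Qed.
Fact cxZl (k : C) (a b : cplx) :
  ((k *: a : cplx) : C) * (b : C) = k *: ((a : C) * (b : C) : cplx) :> cplx.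
Proof. exact: esym (mulrA _ _ _). Qed.
Fact cxZr (k : C) (a b : cplx) :
  (a : C) * ((k *: b : cplx) : C) = k *: ((a : C) * (b : C) : cplx) :> cplx.
Proof. exact: mulrCA. Qed.
Fact cxK : involutive (fun x : cplx => Num.conj (x : C) : cplx). Proof. exact: conjCK. Qed.
Fact cxsD (x y : cplx) :
  Num.conj (x + y : C) = (Num.conj (x : C) : cplx) + (Num.conj (y : C) : cplx) :> cplx.
Proof. exact: rmorphD. Qed.
Fact cxsZ (k : C) (x : cplx) :
  Num.conj ((k *: x : cplx) : C) = Num.conj k *: (Num.conj (x : C) : cplx) :> cplx.
Proof. exact: rmorphM. Qed.
Fact cxsM (x y : cplx) :
  Num.conj ((x : C) * (y : C)) = (Num.conj (y : C)) * (Num.conj (x : C)) :> C.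
Proof. by rewrite rmorphM mulrC. Qed.
HB.instance Definition _ := Lmodule_isStarAlgebra.Build R cplx cxA cxDl cxDr cxZl cxZr cxK cxsD cxsZ cxsM.
Fact cxn (a b : cplx) : `|a ** b| <= `|a| * `|b|. Proof. by rewrite -(normrM (a : C) b). Qed.
Fact cxs (a : cplx) : `|star a ** a| = `|a| ^+ 2.
Proof. by rewrite (normrM (star a : C) (a : C)) (norm_conjC (a : C)) expr2. Qed.
HB.instance Definition _ := StarAlgebra_isCstarAlgebra.Build R cplx cxn cxs.
End Cx.

(** * Amplifications and tensor products of representations *)

Section TensorBasic.
Context (R : realType) (T : min_tensors R).
Local Notation C := R[i].

Section AC.
Variables (A D : cstarAlgType R).
Local Notation tn := (tens (T A D)).

Lemma tens_total : total (fun p : A * D => tn p.1 p.2).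
Proof.
apply: cspan_total (tens_dense (T A D)) _ => x [a [c ->]].
by exists (a, c).
Qed.

Lemma lci_tens (s : seq (C * (A * D))) :
  lci (fun p => tn p.1 p.2) s = \sum_(p <- absl s) tn p.1 p.2.
Proof. by apply: lci_absl => c; exact: tens_linearl. Qed.

Lemma tens_normP (t : seq (A * D)) (r : R) : 0 <= r ->
  nr (\sum_(p <- t) tn p.1 p.2) <= r <-> spatial_bound t r%:C%C.
Proof. by move=> r0; rewrite -(tens_norm (T A D)) ?ler0c// nrE lecR. Qed.

Lemma zero_rep (B : cstarAlgType R) (H : hilbert R) :
  representation (fun (_ : B) (_ : H) => 0 : H).
Proof. split=> [? k ? ?|? k ? ?|? ? ?|? ? ?] //; by rewrite ?scaler0 ?addr0 ?ip0l ?ip0r. Qed.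

(* The Schur product theorem for Gram matrices, read off the spatial norm of 0. *)
Lemma tdot_ge0 (H K : hilbert R) (xi : seq (H * K)) : 0 <= tdot xi xi.
Proof.
have /tens_normP : nr (\sum_(p <- [::] : seq (A * D)) tn p.1 p.2) <= 1.
  by rewrite big_nil nr0.
move=> /(_ ler01 H K _ _ (zero_rep A H) (zero_rep D K) xi).
by rewrite /tact /= /tdot big_nil expr1n mul1r.
Qed.

Lemma tens_Z_r k a c : tn a (k *: c) = k *: tn a c.
Proof. exact: (linZ (tens_linearr (T A D) a)). Qed.
Lemma tens_B_l a a' c : tn (a - a') c = tn a c - tn a' c.
Proof. exact: (linB (tens_linearl (T A D) c)). Qed.
Lemma tens_B_r a c c' : tn a (c - c') = tn a c - tn a c'.
Proof. exact: (linB (tens_linearr (T A D) a)). Qed.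
Lemma tens_0_l c : tn 0 c = 0. Proof. exact: (lin0 (tens_linearl (T A D) c)). Qed.

End AC.


Section HK.
Variables (H K : hilbert R).

Definition hk_kernel (p q : H * K) : C := hdot H p.1 q.1 * hdot K p.2 q.2.

Lemma hk_kernelP : kernel hk_kernel.
Proof.
split=> [p q|s]; first by rewrite /hk_kernel rmorphM /= -!ipJ.
suff -> : kform hk_kernel s s = tdot (absl s) (absl s) by exact: (tdot_ge0 (cplx R) (cplx R)).
rewrite /kform /tdot big_map; apply: eq_bigr => p _.
rewrite big_map; apply: eq_bigr => q _ /=.
by rewrite /hk_kernel ipZl ipZr; ring.
Qed.

Lemma hten_ex : exists Hi : {HK : hilbert R & H * K -> HK},
  total (projT2 Hi) /\ forall p q, hdot _ (projT2 Hi p) (projT2 Hi q) = hk_kernel p q.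
Proof. by have [HK [i h]] := kernel_hilbert hk_kernelP; exists (existT _ HK i). Qed.

(** It depends on [T] because the positivity of its kernel is read off the spatial norm. *)
Definition hten : hilbert R := projT1 (proj1_sig (cid hten_ex)).
Definition ht (x : H) (y : K) : hten := projT2 (proj1_sig (cid hten_ex)) (x, y).

Lemma ht_total : total (fun p : H * K => ht p.1 p.2).
Proof.
have := proj1 (proj2_sig (cid hten_ex)).
by congr total; apply/funext => -[].
Qed.

Lemma ht_dot x y x' y' : hdot hten (ht x y) (ht x' y') = hdot H x x' * hdot K y y'.
Proof. exact: (proj2 (proj2_sig (cid hten_ex))). Qed.

Lemma ht_linl y : linear (ht^~ y).
Proof.
by move=> k x x'; apply: (hil_eq ht_total) => -[u v]; rewrite ipDl ipZl !ht_dot ipDl ipZl; ring.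
Qed.

Lemma nr_ht x y : nr (ht x y) = nr x * nr y.
Proof.
apply/eqP; rewrite -(eqrXn2 (n := 2))// ?mulr_ge0 ?nr_ge0//; apply/eqP.
have := ht_dot x y x y; by rewrite !ipxx -rmorphM /= -exprMn => -[].
Qed.

Definition hsum (xi : seq (H * K)) : hten := \sum_(p <- xi) ht p.1 p.2.

Lemma hsum_dot xi eta : hdot hten (hsum xi) (hsum eta) = tdot xi eta.
Proof.
rewrite /hsum ip_suml; apply: eq_bigr => p _.
by rewrite ip_sumr; apply: eq_bigr => q _; rewrite ht_dot.
Qed.

Lemma hsum_nr xi : tdot xi xi = (nr (hsum xi) ^+ 2)%:C%C.
Proof. by rewrite -hsum_dot ipxx. Qed.

Lemma lci_ht s : lci (fun p => ht p.1 p.2) s = hsum (absl s).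
Proof. by apply: lci_absl => y; exact: ht_linl. Qed.

End HK.

Section TensNorm.
Variables (A D : cstarAlgType R).
Local Notation tn := (tens (T A D)).

Lemma spatial_boundP (t : seq (A * D)) (r : R) : 0 <= r ->
  spatial_bound t r%:C%C <->
  forall (H K : hilbert R) (pi : A -> H -> H) (rho : D -> K -> K),
    representation pi -> representation rho ->
    forall xi, nr (hsum (tact pi rho t xi)) <= r * nr (hsum xi).
Proof.
move=> r0; split=> h H K pi rho hp hr xi; have := h H K pi rho hp hr xi.
  by rewrite !hsum_nr -rmorphXn -rmorphM lecR -exprMn ler_sqr ?nnegrE ?mulr_ge0 ?nr_ge0.
by rewrite !hsum_nr -rmorphXn -rmorphM lecR -exprMn ler_sqr ?nnegrE ?mulr_ge0 ?nr_ge0.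
Qed.


Lemma hsum_tact (H K : hilbert R) (pi : A -> H -> H) (rho : D -> K -> K) t xi :
  hsum (tact pi rho t xi) =
  \sum_(p <- t) \sum_(q <- xi) ht (pi p.1 q.1) (rho p.2 q.2).
Proof. by rewrite /hsum /tact big_allpairs_dep. Qed.

(** The amplification pi (x) 1; its boundedness comes from [kernel_rep_on], with the elementary
    tensors as generators. *)
Lemma ht_repl (H K : hilbert R) (B : cstarAlgType R) (pi : B -> H -> H) :
  representation pi -> exists2 sg : B -> hten H K -> hten H K, representation sg &
    forall b x y, sg b (ht x y) = ht (pi b x) y.
Proof.
move=> [pl pla pm ps].
have [||||sg rs hs] := @kernel_rep_on R B (H * K)%type (@hk_kernel H K)
  (fun b p => (pi b p.1, p.2)) _ _ _ (hten H K) (fun p => ht p.1 p.2) (@ht_total H K).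
- by move=> c a b p q; rewrite /hk_kernel /= pla ipDl ipZl; ring.
- by move=> a b p q; rewrite /hk_kernel /= pm.
- by move=> a p q; rewrite /hk_kernel /= ps.
- by move=> p q; rewrite ht_dot.
by exists sg => // b x y; rewrite (hs b (x, y)).
Qed.

Lemma ht_repr (H K : hilbert R) (B : cstarAlgType R) (rho : B -> K -> K) :
  representation rho -> exists2 sg : B -> hten H K -> hten H K, representation sg &
    forall b x y, sg b (ht x y) = ht x (rho b y).
Proof.
move=> [pl pla pm ps].
have [||||sg rs hs] := @kernel_rep_on R B (H * K)%type (@hk_kernel H K)
  (fun b p => (p.1, rho b p.2)) _ _ _ (hten H K) (fun p => ht p.1 p.2) (@ht_total H K).
- by move=> c a b p q; rewrite /hk_kernel /= pla ipDl ipZl; ring.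
- by move=> a b p q; rewrite /hk_kernel /= pm.
- by move=> a p q; rewrite /hk_kernel /= ps.
- by move=> p q; rewrite ht_dot.
by exists sg => // b x y; rewrite (hs b (x, y)).
Qed.

Lemma tens_ind (P : T A D -> Prop) :
  (forall x, (forall e : R, 0 < e -> exists2 y, P y & nr (x - y) < e) -> P x) ->
  P 0 -> (forall k x y, P x -> P y -> P (k *: x + y)) ->
  (forall a d, P (tn a d)) -> forall x, P x.
Proof. by move=> h1 h2 h3 h4; apply: (total_ind (@tens_total A D)). Qed.

Lemma tens_eq (W : normedModType C) (L L' : T A D -> W) : blin L -> blin L' ->
  (forall a d, L (tn a d) = L' (tn a d)) -> L =1 L'.
Proof. by move=> h1 h2 h3; apply: (total_eq (@tens_total A D)) => // -[]. Qed.

Lemma ht_eq (H K : hilbert R) (W : normedModType C) (L L' : hten H K -> W) :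
  blin L -> blin L' -> (forall x y, L (ht x y) = L' (ht x y)) -> L =1 L'.
Proof. by move=> h1 h2 h3; apply: (total_eq (@ht_total H K)) => // -[]. Qed.

Lemma blin_ipl (H : hilbert R) (z : H) : blin (fun x : H => hdot H x z : cplx R).
Proof.
apply: (@blinP _ _ _ _ (nr z)); first by move=> k x y; rewrite ipDl ipZl.
by move=> x; rewrite mulrC; exact: ip_CS.
Qed.

(** For a fixed vector h the spatial norm bounds t -> (pi (x) rho)(t) h on algebraic tensors, so
    this extends to [T A D]; the laws of a representation are then checked on generators, where the
    two amplifications commute. *)
Lemma tens_rep (H K : hilbert R) (pi : A -> H -> H) (rho : D -> K -> K) :
  representation pi -> representation rho ->
  exists2 sg : T A D -> hten H K -> hten H K, representation sg &
    forall a d x y, sg (tn a d) (ht x y) = ht (pi a x) (rho d y).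
Proof.
move=> rp rr; have [s1 r1 h1] := ht_repl K rp; have [s2 r2 h2] := ht_repr H rr.
pose g h p := s1 p.1 (s2 p.2 h).
have gb p : blin (g^~ p) by exact: blin_comp (rep_blin p.2 r2) (rep_blin p.1 r1).
have cm a d : forall h, s1 a (s2 d h) = s2 d (s1 a h).
  apply: ht_eq => [||u v]; last by rewrite h2 !h1 h2.
    exact: blin_comp (rep_blin _ r2) (rep_blin _ r1).
  exact: blin_comp (rep_blin _ r1) (rep_blin _ r2).
have bg h s : nr (lci (g h) s) <= nr h * nr (lci (fun p => tn p.1 p.2) s).
  rewrite mulrC; pose M := nr (lci (fun p => tn p.1 p.2) s).
  have M0 : 0 <= M by exact: nr_ge0.
  have bL : blin (fun h => lci (g h) s).
    by apply: blin_sum => p; have [lg [N N0 hN]] := gb p.2; apply: (@blinP _ _ _ _ (nr p.1 * N)) => [k x y|x];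
      [rewrite lg; lmod|rewrite nrZ -mulrA ler_wpM2l ?nr_ge0].
  apply: (blin_le_total (@ht_total H K) M0 bL) => xi.
  have : nr (\sum_(p <- absl s) tn p.1 p.2) <= M by rewrite -lci_tens.
  move=> /(tens_normP _ M0) /(spatial_boundP _ M0) /(_ H K pi rho rp rr (absl xi)).
  rewrite -lci_ht hsum_tact => hM; apply: le_trans hM.
  rewrite (_ : lci (g _) s = \sum_(p <- absl s) \sum_(q <- absl xi) ht (pi p.1 q.1) (rho p.2 q.2))//.
  rewrite /lci big_map; apply: eq_bigr => p _ /=.
  rewrite -/(lci _ _) (lin_sum (gb p.2).1) scaler_sumr big_map; apply: eq_bigr => q _ /=.
  rewrite /g (linZ (rep_linear r2 _)) h2 (linZ (rep_linear r1 _)) h1.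
  by rewrite (linZ (rep_linearl rp _)) (linZ (rep_linear rp _)) !(linZ (ht_linl _)); lmod.
have /choice[sg' hsg] : forall h, exists L : T A D -> hten H K, [/\ linear L,
    forall t, nr (L t) <= nr h * nr t & forall p, L (tn p.1 p.2) = g h p].
  by move=> h; apply: (ext_total (@tens_total A D)) (bg h); exact: nr_ge0.
have bl h : blin (sg' h) by have [u v _] := hsg h; exact: blinP v.
have E h a d : sg' h (tn a d) = s1 a (s2 d h) by have [_ _ /(_ (a, d))] := hsg h.
have ll t : linear (fun h => sg' h t).
  move=> k h h'; move: t; apply: tens_eq => //; first exact: blin_scaleD.
  move=> a d; rewrite !E (linD (rep_linear r2 _)) (linZ (rep_linear r2 _)).
  by rewrite (linD (rep_linear r1 _)) (linZ (rep_linear r1 _)).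
have blh t : blin (fun h => sg' h t).
  apply: (@blinP _ _ _ _ (nr t)) => // h; rewrite mulrC.
  by have [_ u _] := hsg h; exact: u.
exists (fun t h => sg' h t).
  split.
  - exact: ll.
  - by move=> h; exact: (bl h).1.
  - move=> t t' h; move: t; apply: tens_eq; [exact: blin_comp (blin_amulr _) (bl h)|exact: bl|].
    move=> a d; move: t'; apply: tens_eq; [exact: blin_comp (blin_amull _) (bl h)| |].
      exact: blin_comp (bl h) (blh _).
    move=> a' d'; rewrite tens_mul !E; rewrite (rep_mul r1) (rep_mul r2); congr (s1 _ _).
    by rewrite -cm.
  - move=> t x y; move: t.
    have b1 : blin (fun t => hdot (hten H K) (sg' x t) y : cplx R).
      exact: blin_comp (bl x) (blin_ipl y).
    apply: tens_eq (b1) _ _ => [|a d].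
      apply: (@blinP _ _ _ _ (nr x * nr y)) => [k t t'|t].
        by rewrite starD starZ (bl y).1 ipDr ipZr conjCK.
      apply: le_trans (ip_CS _ _) _; rewrite -mulrA ler_wpM2l ?nr_ge0// -(nr_star t).
      by have [_ u _] := hsg y; exact: u.
    by rewrite tens_star !E (rep_star r1) (rep_star r2) cm.
by move=> a d x y; rewrite E h2 h1.
Qed.

End TensNorm.
End TensorBasic.

(** * Slices and norming families for the minimal tensor product *)

Section TensorNorm.
Context (R : realType) (T : min_tensors R).
Local Notation C := R[i].
Variables (A D : cstarAlgType R).
Local Notation tn := (tens (T A D)).
Local Notation ht := (ht T).
Local Notation hten := (hten T).

Definition is_tens_rep (H K : hilbert R) (pi : A -> H -> H) (rho : D -> K -> K)
    (sg : T A D -> hten H K -> hten H K) :=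
  representation sg /\
  forall a d x y, sg (tn a d) (ht x y) = ht (pi a x) (rho d y).

Lemma tens_repP (H K : hilbert R) (pi : A -> H -> H) (rho : D -> K -> K) :
  representation pi -> representation rho ->
  exists sg : T A D -> hten H K -> hten H K, is_tens_rep pi rho sg.
Proof. by move=> h1 h2; have [sg] := @tens_rep R T A D H K pi rho h1 h2; exists sg. Qed.

(** The spatial norm is prescribed on algebraic tensors; one within d of t carries the criterion
    over to the completion. *)
Lemma tens_rep_norm (t : T A D) (r : R) : 0 <= r ->
  (forall (H K : hilbert R) (pi : A -> H -> H) (rho : D -> K -> K) sg,
     representation pi -> representation rho -> is_tens_rep pi rho sg ->
     forall h, nr (sg t h) <= r * nr h) -> nr t <= r.
Proof.
move=> r0 h; apply: (@le_eps _ _ _ 2) => d d0.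
have [s hs] := @tens_total R T A D t d d0; set t' := lci _ s in hs.
suff n1 : nr t' <= r + d by have := nr_leD t t'; lra.
have rd : 0 <= r + d by rewrite addr_ge0// ltW.
rewrite /t' lci_tens; apply/(tens_normP T (absl s) rd)/(spatial_boundP T _ rd).
move=> H K pi rho hp hr xi; have [sg [rs hsg]] := tens_repP hp hr.
have -> : hsum T (tact pi rho (absl s) xi) = sg t' (hsum T xi).
  rewrite hsum_tact /t' lci_tens (lin_sum (rep_linearl rs _)); apply: eq_bigr => p _.
  by rewrite /hsum (lin_sum (rep_linear rs _)); apply: eq_bigr => q _; rewrite hsg.
have := nr_leD (sg t' (hsum T xi)) (sg t (hsum T xi)).
rewrite -(linB (rep_linearl rs _)) => /le_trans; apply; rewrite mulrDl lerD//.
  exact: (h _ _ _ _ _ hp hr (conj rs hsg)).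
apply: le_trans (rep_bnd rs _ _) _; rewrite ler_wpM2r ?nr_ge0// nrBC.
exact: ltW.
Qed.

Lemma nr_tens_le a c : nr (tn a c) <= nr a * nr c.
Proof.
apply: tens_rep_norm => [|H K pi rho sg hp hr [rs hsg] h]; first by rewrite mulr_ge0 ?nr_ge0.
have [s1 r1 h1] := ht_repl T K hp; have [s2 r2 h2] := ht_repr T H hr.
have -> : sg (tn a c) h = s1 a (s2 c h).
  move: h; apply: ht_eq => [||u v]; first exact: rep_blin.
    exact: blin_comp (rep_blin _ r2) (rep_blin _ r1).
  by rewrite hsg h2 h1.
apply: le_trans (rep_bnd r1 _ _) _; rewrite -mulrA ler_wpM2l ?nr_ge0//.
exact: rep_bnd.
Qed.

Lemma blin_tensl c : blin (tn^~ c).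
Proof.
apply: (@blinP _ _ _ _ (nr c)); first exact: (tens_linearl (T A D)).
by move=> a; rewrite mulrC nr_tens_le.
Qed.
Lemma blin_tensr a : blin (tn a).
Proof.
apply: (@blinP _ _ _ _ (nr a)); first exact: (tens_linearr (T A D)).
by move=> c; rewrite nr_tens_le.
Qed.

Lemma dual_blin (B : cstarAlgType R) (g : B -> C) : dual g <-> blin (g : B -> cplx R).
Proof.
split=> [[gl [K hK]]|[gl [K K0 hK]]].
  apply: (@blinP _ _ _ _ (nr K)) => // x.
  have h0 := le_trans (normr_ge0 _) (hK x).
  by have := hK x; rewrite -(ger0_norm h0) normrM normr_id !nrE -rmorphM lecR.
split=> //; exists K%:C%C => x; rewrite !nrE -rmorphM lecR; exact: hK.
Qed.

(** Boundedness by testing twice: a matrix coefficient of pi at the slice is g(w), where w in D is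
    the slice of t by a vector functional of pi, and the matrix coefficients of rho at w are
    coefficients of pi (x) rho at t. *)
Lemma slice_ex (g : D -> C) : dual g -> exists2 S : T A D -> A, blin S &
  forall b c, S (tn b c) = g c *: b.
Proof.
move=> /dual_blin[gl [K K0 hK]].
suff [S [h1 h2 h3]] : exists S : T A D -> A, [/\ linear S, forall t, nr (S t) <= K * nr t &
   forall p, S (tn p.1 p.2) = g p.2 *: p.1].
  by exists S; [exact: blinP h2|move=> b c; exact: (h3 (b, c))].
apply: (ext_total (@tens_total R T A D)) => // s; pose t := lci (fun p : A * D => tn p.1 p.2) s; rewrite -/t.
apply: gelfand_naimark => [|H pi hp x]; first by rewrite mulr_ge0 ?nr_ge0.
apply: nr_le_ip => [|x']; first by rewrite !mulr_ge0 ?nr_ge0.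
pose w := lci (fun p : A * D => hdot H (pi p.1 x) x' *: p.2) s.
have -> : hdot H (pi (lci (fun p => g p.2 *: p.1) s) x) x' = g w.
  rewrite (lci_lin _ _ (rep_linearl hp x)) /w (lci_lin _ _ gl) /lci ip_suml.
  apply: eq_bigr => p _ /=; rewrite (linZ (rep_linearl hp x)) (linZ gl) !ipZl.
  by congr (_ * _); exact: mulrC.
apply: le_trans (hK w) _; rewrite -!mulrA ler_wpM2l//.
apply: gelfand_naimark => [|L rho hr y]; first by rewrite !mulr_ge0 ?nr_ge0.
apply: nr_le_ip => [|y']; first by rewrite !mulr_ge0 ?nr_ge0.
have [sg [rs hsg]] := tens_repP hp hr.
have -> : hdot L (rho w y) y' = hdot _ (sg t (ht x y)) (ht x' y').
  rewrite (lci_lin _ _ (rep_linearl hr y)) (lci_lin _ _ (rep_linearl rs _)) /lci !ip_suml.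
  apply: eq_bigr => p _ /=; rewrite (linZ (rep_linearl hr y)) hsg !ipZl ht_dot; ring.
apply: le_trans (ip_CS _ _) _.
have := rep_bnd rs t (ht x y); rewrite !nr_ht => h.
have -> : nr t * (nr x * nr x') * nr y * nr y' = nr t * (nr x * nr y) * (nr x' * nr y') by ring.
by rewrite ler_wpM2r// mulr_ge0 ?nr_ge0.
Qed.

Lemma sliceE (g : D -> C) (S : T A D -> A) t : blin S ->
  (forall b c, S (tn b c) = g c *: b) -> slice T g t = S t.
Proof.
move=> bS hS; apply: xget_unique => [|_ [S' [lS' cS' hS' ->]]].
  by exists S; split=> //; [exact: bS.1|exact: blin_continuous].
move: t; apply: tens_eq => //; first exact: continuous_blin.
by move=> a d; rewrite hS hS'.
Qed.


(** A substitute for 2^m-th roots: if b_0 = (1 + d) q_0 N with d > 0, then repeated squaring makes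
    b_m/(q_m N) grow without bound, against b_m <= q_m K. The linear minorant 1 + (m+1) d of the
    growth is enough. *)
Lemma pow_bound (b q : nat -> R) (K N : R) : 0 < N -> 0 < q 0 ->
  (forall m, q m.+1 = q m ^+ 2) -> (forall m, 0 <= b m) ->
  (forall m, b m ^+ 2 <= b m.+1 * N) -> (forall m, b m <= q m * K) -> b 0 <= q 0 * N.
Proof.
move=> N0 q0 hq b0 hb hK; have qp m : 0 < q m.
  by elim: m => // m IH; rewrite hq exprn_gt0.
rewrite leNgt; apply/negP => hlt.
pose d := b 0 / (q 0 * N) - 1.
have qN m : 0 < q m * N by rewrite mulr_gt0.
have d0 : 0 < d by rewrite subr_gt0 ltr_pdivlMr// mul1r.
have B m : (1 + m.+1%:R * d) * (q m * N) <= b m.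
  elim: m => [|m IH]; first by rewrite mul1r /d addrC subrK divfK ?gt_eqF.
  rewrite -(ler_pM2r N0); apply: le_trans (hb m).
  have k0 : 0 <= 1 + m.+1%:R * d by rewrite addr_ge0// mulr_ge0// ltW.
  have h2 : ((1 + m.+1%:R * d) * (q m * N)) ^+ 2 <= b m ^+ 2.
    by rewrite ler_sqr// nnegrE// mulr_ge0// ltW.
  apply: le_trans h2; rewrite hq.
  have -> : ((1 + m.+1%:R * d) * (q m * N)) ^+ 2 = (1 + m.+1%:R * d) ^+ 2 * (q m ^+ 2 * N * N) by ring.
  rewrite -[leLHS]mulrA ler_wpM2r ?mulr_ge0 ?(ltW (qp m)) ?(ltW N0)//.
  have : 0 <= (m.+1%:R * d) ^+ 2 by exact: sqr_ge0.
  have : 0 <= m%:R * d by rewrite mulr_ge0// ltW.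
  have -> : (m.+2%:R : R) = m%:R + 2 by rewrite -addn2 natrD.
  have -> : (m.+1%:R : R) = m%:R + 1 by rewrite -addn1 natrD.
  have -> : (1 + (m%:R + 1) * d) ^+ 2 = 1 + 2 * (m%:R * d) + 2 * d + ((m%:R + 1) * d) ^+ 2 by ring.
  by move: (_ ^+ 2) => z; rewrite mulrDl; lra.
have KB m : (1 + m.+1%:R * d) * N <= K.
  have := le_trans (B m) (hK m); rewrite mulrCA ler_pM2l//.
have K1 : 0 < `|K| + 1 by rewrite ltr_wpDl.
have [n hn] := iv_small (divr_gt0 (mulr_gt0 d0 N0) K1).
have := KB n; apply/negP; rewrite -ltNge.
move: hn; rewrite /iv ltr_pdivlMr// mulrC ltr_pdivrMr// => hn.
apply: le_lt_trans (ler_norm _) _; rewrite mulrDl mul1r mulrAC -mulrA.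
by move: hn; rewrite [_ * N * _]mulrC; lra.
Qed.

(** * Norming families of representations *)

Section NormingFamily.
Variable Fam : forall H : hilbert R, (A -> H -> H) -> Prop.
Hypothesis Fam_rep : forall (H : hilbert R) (pi : A -> H -> H), Fam pi -> representation pi.
Hypothesis Fam_norming : forall a (r : R), 0 <= r ->
  (forall (H : hilbert R) (pi : A -> H -> H), Fam pi -> forall x : H, nr (pi a x) <= r * nr x) -> nr a <= r.

Lemma fam_tens_norm (t : T A D) (r : R) : 0 <= r ->
  (forall (H K : hilbert R) (pi : A -> H -> H) (rho : D -> K -> K) sg,
     Fam pi -> representation rho -> is_tens_rep pi rho sg ->
     forall h, nr (sg t h) <= r * nr h) -> nr t <= r.
Proof.
move=> r0 ht0; apply: (@le_eps _ _ _ 1) => e e0; rewrite mul1r.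
have re : 0 < r + e by rewrite ltr_wpDl.
have {}ht0 (H K : hilbert R) (pi : A -> H -> H) (rho : D -> K -> K) sg :
     Fam pi -> representation rho -> is_tens_rep pi rho sg ->
     forall h, nr (sg t h) <= (r + e) * nr h.
  move=> h1 h2 h3 h; apply: le_trans (ht0 _ _ _ _ _ h1 h2 h3 h) _.
  by rewrite ler_wpM2r ?nr_ge0// lerDl ltW.
move: (r + e) re ht0 => {e0 e r0}r r0 hF.
apply: tens_rep_norm => [|H K pi rho sg hp hr hsg]; first exact: ltW.
have [rs hs] := hsg.
apply: (blin_le_total (@ht_total R T H K) (ltW r0) (rep_blin t rs)) => s.
set h := lci _ s.
pose adm v (q : R) := forall (H' : hilbert R) (pi' : A -> H' -> H') (sg' : T A D -> hten H' K -> hten H' K),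
  Fam pi' -> is_tens_rep pi' rho sg' -> forall k, nr (sg' v k) <= q * nr k.
(* The slice of v by a vector functional of rho lies in A, where the family is norming; so the bound
   q, known for members of [Fam], passes to the arbitrary representation pi. *)
have slc v q x y x' y' : 0 <= q -> adm v q ->
    nr (hdot _ (sg v (ht x y)) (ht x' y')) <= q * (nr x * nr y * nr x' * nr y').
  move=> q0 hv.
  have [] := @slice_ex (fun d => hdot K (rho d y) y').
    apply/dual_blin; exact: blin_comp (rep_blinl y hr) (blin_ipl y').
  move=> S bS hS.
  have E (H' : hilbert R) (pi' : A -> H' -> H') (sg' : T A D -> hten H' K -> hten H' K) :
      representation pi' -> is_tens_rep pi' rho sg' -> forall z z' u,
      hdot _ (sg' u (ht z y)) (ht z' y') = hdot _ (pi' (S u) z) z'.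
    move=> rp' [rs' hs'] z z'.
    apply: (@tens_eq _ _ _ _ (cplx R)).
    - exact: blin_comp (rep_blinl _ rs') (blin_ipl _).
    - exact: blin_comp bS (blin_comp (rep_blinl _ rp') (blin_ipl _)).
    - by move=> a d /=; rewrite hs' ht_dot hS (linZ (rep_linearl rp' z)) ipZl mulrC.
  rewrite (E _ _ _ hp hsg).
  have nS : nr (S v) <= q * (nr y * nr y').
    apply: Fam_norming => [|H' pi' F' z]; first by rewrite !mulr_ge0 ?nr_ge0.
    apply: nr_le_ip => [|z']; first by rewrite !mulr_ge0 ?nr_ge0.
    have [sg' hsg'] := tens_repP (Fam_rep F') hr.
    rewrite -(E _ _ _ (Fam_rep F') hsg'); apply: le_trans (ip_CS _ _) _.
    have := hv _ _ _ F' hsg' (ht z y); rewrite !nr_ht => h1.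
    have -> : q * (nr y * nr y') * nr z * nr z' = q * (nr z * nr y) * (nr z' * nr y') by ring.
    by rewrite ler_wpM2r// mulr_ge0 ?nr_ge0.
  apply: le_trans (ip_CS _ _) _.
  have -> : q * (nr x * nr y * nr x' * nr y') = q * (nr y * nr y') * nr x * nr x' by ring.
  rewrite ler_wpM2r ?nr_ge0//; apply: le_trans (rep_bnd hp _ _) _.
  by rewrite ler_wpM2r ?nr_ge0.
(* The constant depends on the fixed combination h but not on v or q, so it disappears under
   repeated squaring. *)
have [Kh K0 hK] : exists2 Kh : R, 0 <= Kh & forall v q, 0 <= q -> adm v q ->
    nr (hdot _ (sg v h) h) <= q * Kh.
  exists (\sum_(p <- s) \sum_(p' <- s) nr (p.1 * Num.conj p'.1) *
     (nr p.2.1 * nr p.2.2 * nr p'.2.1 * nr p'.2.2)).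
    by apply: sumr_ge0 => p _; apply: sumr_ge0 => p' _; rewrite !mulr_ge0 ?nr_ge0.
  move=> v q q0 hv; rewrite /h (lci_lin _ _ (rep_linear rs v)) ip_lci.
  rewrite mulr_sumr; apply: le_trans (nr_sum _ _) _; apply: ler_sum => p _.
  rewrite mulr_sumr; apply: le_trans (nr_sum _ _) _; apply: ler_sum => p' _.
  by rewrite [leLHS]nrM [leRHS]mulrCA ler_wpM2l ?nr_ge0//; exact: slc.
pose u := fix u m := if m is m'.+1 then u m' ** u m' else star t ** t.
have us m : star (u m) = u m.
  by elim: m => [|m IH] /=; rewrite starM ?starK ?IH.
pose q := fix q m : R := if m is m'.+1 then q m' ^+ 2 else r ^+ 2.
have qp m : 0 <= q m by case: m => [|m] /=; rewrite sqr_ge0.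
have ua m : adm (u m) (q m).
  elim: m => [|m IH] H' pi' sg' F' hsg' k /=; have [rs' _] := hsg'.
    rewrite (rep_mul rs') expr2.
    have B := hF _ _ _ _ _ F' hr hsg'.
    apply: nr_le_ip => [|k']; first by rewrite !mulr_ge0 ?nr_ge0 ?(ltW r0).
    rewrite (rep_star rs') starK; apply: le_trans (ip_CS _ _) _.
    have -> : r * r * nr k * nr k' = (r * nr k) * (r * nr k') by ring.
    by apply: ler_pM (B _) (B _); exact: nr_ge0.
  rewrite (rep_mul rs') expr2 -mulrA; apply: le_trans (IH _ _ _ F' hsg' _) _.
  by rewrite ler_wpM2l// (IH _ _ _ F' hsg').
have [h0|h0] := eqVneq (nr h) 0.
  by rewrite (nr_eq0 h0) (lin0 (rep_linear rs t)) nr0 mulr0.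
have hp0 : 0 < nr h by rewrite lt_def h0 nr_ge0.
pose b m := nr (hdot _ (sg (u m) h) h).
have : b 0%N <= q 0%N * nr h ^+ 2.
  apply: (@pow_bound b q Kh) => //.
  - by rewrite exprn_gt0.
  - by rewrite exprn_gt0.
  - by move=> m; exact: nr_ge0.
  - move=> m; rewrite /b /= (rep_mul rs) [in leRHS](rep_star rs) us ipxx nrR ger0_norm ?sqr_ge0//.
    by rewrite -exprMn ler_sqr ?nnegrE ?mulr_ge0 ?nr_ge0// ip_CS.
  - by move=> m; exact: hK.
rewrite /b /= (rep_mul rs) (rep_star rs) starK ipxx nrR ger0_norm ?sqr_ge0//.
by rewrite -exprMn ler_sqr ?nnegrE ?mulr_ge0 ?nr_ge0// ltW.
Qed.

End NormingFamily.

End TensorNorm.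

(** * Tensor products of multipliers and of homomorphisms *)

Section MultTotal.
Context (R : realType).
Local Notation C := R[i].

(** Tested against x on the left, y -> x (m y) = (x m) y is continuous, whatever the multiplier. *)
Lemma mult_eq_total I (A : cstarAlgType R) (f : I -> A) (m n : multiplier A) :
  total f -> (forall i, lm m (f i) = lm n (f i)) -> m = n.
Proof.
move=> tf h; apply: multiplierP => y; apply: amull_inj => x; move: y.
apply: (total_eq tf) => [||i]; last by rewrite h.
  by under eq_fun do rewrite centralizer; exact: blin_amull.
by under eq_fun do rewrite centralizer; exact: blin_amull.
Qed.

(** The action and its adjoint are both prescribed on generators; their compatibility extends by
    density in each variable and becomes the double centralizer law. *)
Lemma mult_ex I (A : cstarAlgType R) (f g g' : I -> A) (r : R) : total f -> 0 <= r ->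
  (forall s, nr (lci g s) <= r * nr (lci f s)) ->
  (forall s, nr (lci g' s) <= r * nr (lci f s)) ->
  (forall i j, star (f i) ** g j = star (g' i) ** f j) ->
  exists k : multiplier A, [/\ bnd k r, forall i, lm k (f i) = g i &
    forall i, lm (star k) (f i) = g' i].
Proof.
move=> tf r0 hg hg' e.
have [L [lL bL EL]] := ext_total tf r0 hg.
have [L' [lL' bL' EL']] := ext_total tf r0 hg'.
have BL : blin L by exact: blinP bL.
have BL' : blin L' by exact: blinP bL'.
have cent0 : forall x y, star x ** L y = star (L' x) ** y.
  move=> x y; move: y x.
  apply: (total_ind tf) => [y hy x|x|k y y' h h' x|j].
  - have b1 : blin (fun y => star x ** L y) by exact: blin_comp BL (blin_amull _).
    apply: (closed_eq b1 (blin_amull (star (L' x)))) => d d0.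
    by have [y' h1 h2] := hy d d0; exists y'.
  - by rewrite (lin0 lL) !amul0r.
  - by rewrite lL !amulDr !amulZr h h'.
  - apply: (total_ind tf) => [x hx||k x x' h h'|i].
    + apply: (can_inj (@starK R A)); rewrite !starM !starK.
      have b1 : blin (fun x => star (f j) ** L' x) by exact: blin_comp BL' (blin_amull _).
      apply: (closed_eq (blin_amull (star (L (f j)))) b1) => d d0.
      have [x' h1 h2] := hx d d0; exists x' => //.
      by apply: (can_inj (@starK R A)); rewrite !starM !starK.
    + by rewrite (lin0 lL') star0 !amul0l.
    + by rewrite lL' !starD !starZ !amulDl !amulZl h h'.
    + by rewrite EL EL' e.
have cent x y : x ** L y = star (L' (star x)) ** y by rewrite -cent0 starK.
exists (Multiplier cent); split=> // i /=.
by rewrite !starK EL'.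
Qed.

Lemma approx_fin (A : cstarAlgType R) (s : seq A) (e : R) : 0 < e ->
  exists u : A, nr u <= 1 /\ forall c, c \in s -> nr (c - u ** c) < e.
Proof.
move=> e0; have [|u [_ _ _ u1 hu]] := @approx_unit R A setT s e (@ideal_setT R A) e0.
  by [].
by exists u.
Qed.

End MultTotal.

Section Mtens.
Context (R : realType) (T : min_tensors R).
Local Notation C := R[i].
Variables (A D : cstarAlgType R).
Local Notation tn := (tens (T A D)).
Local Notation tp := (fun p : A * D => tn p.1 p.2).

Let tens_approx a c : forall e : R, 0 < e -> exists d : R, 0 < d /\
  forall a' c', nr (a - a') < d -> nr (c - c') < d -> nr (tn a c - tn a' c') < e.
Proof.
move=> e e0; pose K := nr a + nr c + 1.
have K0 : 0 < K by rewrite ltr_wpDl// addr_ge0 ?nr_ge0.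
pose d := Num.min 1 (e / K).
have d0 : 0 < d by rewrite lt_min ltr01 divr_gt0.
exists d; split=> // a' c' ha hc.
have -> : tn a c - tn a' c' = tn (a - a') c + tn a' (c - c').
  by rewrite tens_B_l tens_B_r; lmod.
apply: le_lt_trans (nrD _ _) _.
have n1 : nr (tn (a - a') c) <= d * nr c.
  by apply: le_trans (nr_tens_le _ _ _) _; rewrite ler_wpM2r ?nr_ge0// ltW.
have na : nr a' <= nr a + 1.
  have := nr_leD a' a; rewrite nrBC; have : d <= 1 by rewrite ge_min lexx.
  by lra.
have n2 : nr (tn a' (c - c')) < d * (nr a + 1).
  apply: le_lt_trans (nr_tens_le _ _ _) _.
  apply: (@le_lt_trans _ _ ((nr a + 1) * nr (c - c'))); first by rewrite ler_wpM2r ?nr_ge0.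
  by rewrite mulrC ltr_pM2r// ltr_wpDl// nr_ge0.
have : d * K <= e.
  have : d <= e / K by rewrite ge_min lexx orbT.
  by rewrite ler_pdivlMr.
by rewrite /K; lra.
Qed.

(** On the finitely many entries of t, m and n act almost like left multiplication by a0 = m u and
    c0 = n v, with u and v approximate units; for those the sum is the product of a0 (x) c0 with the
    tensor. *)
Let mtens_bound (m : multiplier A) (n : multiplier D) r s : 0 <= r -> 0 <= s ->
  bnd m r -> bnd n s -> forall t,
  nr (lci (fun p => tn (lm m p.1) (lm n p.2)) t) <= r * s * nr (lci tp t).
Proof.
move=> r0 s0 hm hn t; apply: (@le_eps _ _ _ 1) => e e0; rewrite mul1r.
suff [a0 [c0 [h1 h2]]] : exists a0 c0, nr a0 * nr c0 <= r * s /\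
    nr (lci (fun p => tn (lm m p.1) (lm n p.2)) t -
        lci (fun p => tn (a0 ** p.1) (c0 ** p.2)) t) < e.
  apply: le_trans (nr_leD _ (lci (fun p => tn (a0 ** p.1) (c0 ** p.2)) t)) _.
  apply: lerD; last exact: ltW.
  have -> : lci (fun p => tn (a0 ** p.1) (c0 ** p.2)) t = tn a0 c0 ** lci tp t.
    rewrite /lci amul_sumr; apply: eq_bigr => p _.
    by rewrite amulZr tens_mul.
  apply: le_trans (nr_amul _ _) _; rewrite ler_wpM2r ?nr_ge0//.
  exact: le_trans (nr_tens_le _ _ _) _.
have [d [d0 hd]] : exists d : R, 0 < d /\ forall a0 c0,
   (forall p, p \in t -> nr (lm m p.2.1 - a0 ** p.2.1) < d /\
      nr (lm n p.2.2 - c0 ** p.2.2) < d) ->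
   nr (lci (fun p => tn (lm m p.1) (lm n p.2)) t -
        lci (fun p => tn (a0 ** p.1) (c0 ** p.2)) t) < e.
  elim: t e e0 => [|p t IH] e e0.
    by exists 1; split=> // a0 c0 _; rewrite /lci !big_nil subrr nr0.
  have [d1 [d10 h1]] := IH (e / 2) (divr_gt0 e0 (ltr0n _ 2)).
  have e1 : 0 < e / 2 / (nr p.1 + 1) by rewrite !divr_gt0// ltr_wpDl ?nr_ge0.
  have [d2 [d20 h2]] := tens_approx (lm m p.2.1) (lm n p.2.2) e1.
  exists (Num.min d1 d2); split; first by rewrite lt_min d10.
  move=> a0 c0 h; rewrite /lci !big_cons opprD addrACA -!/(lci _ t) -scalerBr.
  apply: le_lt_trans (nrD _ _) _; rewrite nrZ.
  have [ha hc] := h p (mem_head _ _); move: ha hc; rewrite !lt_min => /andP[_ ha] /andP[_ hc].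
  have l1 := h2 _ _ ha hc.
  have l2 : nr (lci (fun p => tn (lm m p.1) (lm n p.2)) t -
        lci (fun p => tn (a0 ** p.1) (c0 ** p.2)) t) < e / 2.
    apply: h1 => q qt; have := h q; rewrite in_cons qt orbT => /(_ isT).
    by rewrite !lt_min => -[/andP[-> _] /andP[-> _]].
  have l3 : nr p.1 * nr (tn (lm m p.2.1) (lm n p.2.2) - tn (a0 ** p.2.1) (c0 ** p.2.2)) < e / 2.
    apply: le_lt_trans (ler_wpM2l (nr_ge0 _) (ltW l1)) _.
    rewrite mulrC; apply: divS_lt; last exact: nr_ge0.
    by rewrite divr_gt0.
  by rewrite [e]splitr addrC ltrD// addrC.
have dr : 0 < d / (r + 1) by rewrite divr_gt0// ltr_wpDl.
have ds : 0 < d / (s + 1) by rewrite divr_gt0// ltr_wpDl.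
have [u [u1 hu]] := approx_fin [seq p.2.1 | p <- t] dr.
have [v [v1 hv]] := approx_fin [seq p.2.2 | p <- t] ds.
exists (lm m u), (lm n v); split.
  apply: ler_pM; rewrite ?nr_ge0//.
    by apply: le_trans (hm _) _; rewrite ler_piMr.
  by apply: le_trans (hn _) _; rewrite ler_piMr.
apply: hd => p pt; rewrite -!lmA -!lm_B; split.
  apply: le_lt_trans (hm _) _; rewrite mulrC.
  apply: (@le_lt_trans _ _ (nr (p.2.1 - u ** p.2.1) * (r + 1))).
    by rewrite ler_wpM2l ?nr_ge0// lerDl.
  by rewrite -ltr_pdivlMr ?ltr_wpDl// hu// (map_f (fun p => p.2.1)).
apply: le_lt_trans (hn _) _; rewrite mulrC.
apply: (@le_lt_trans _ _ (nr (p.2.2 - v ** p.2.2) * (s + 1))).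
  by rewrite ler_wpM2l ?nr_ge0// lerDl.
by rewrite -ltr_pdivlMr ?ltr_wpDl// hv// (map_f (fun p => p.2.2)).
Qed.

Lemma mtens_ex (m : multiplier A) (n : multiplier D) r s : 0 <= r -> 0 <= s ->
  bnd m r -> bnd n s -> exists2 k : multiplier (T A D), bnd k (r * s) &
    forall a c, lm k (tn a c) = tn (lm m a) (lm n c).
Proof.
move=> r0 s0 hm hn.
have [|||k [h1 h2 _]] := @mult_ex R (A * D)%type (T A D) tp
  (fun p => tn (lm m p.1) (lm n p.2)) (fun p => tn (lm (star m) p.1) (lm (star n) p.2))
  (r * s) (@tens_total R T A D) (mulr_ge0 r0 s0).
- exact: mtens_bound.
- by apply: mtens_bound => //; exact: bnd_star.
- by move=> p q; rewrite !tens_star !tens_mul -!lm_star.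
by exists k => // a c; rewrite (h2 (a, c)).
Qed.

Lemma lm_mtens (m : multiplier A) (n : multiplier D) : bd m -> bd n ->
  forall a c, lm (mtens T m n) (tn a c) = tn (lm m a) (lm n c).
Proof.
move=> [r r0 hm] [s s0 hn]; have [k _ hk] := mtens_ex r0 s0 hm hn.
by apply: (@xgetPex _ 0 [set k | forall a c, lm k (tn a c) = tn (lm m a) (lm n c)]); exists k.
Qed.

Lemma mtensP (m : multiplier A) (n : multiplier D) k : bd m -> bd n ->
  (forall a c, lm k (tn a c) = tn (lm m a) (lm n c)) -> mtens T m n = k.
Proof.
move=> hm hn h; apply: (mult_eq_total (@tens_total R T A D)) => -[a c] /=.
by rewrite lm_mtens// h.
Qed.

Lemma bnd_mtens (m : multiplier A) (n : multiplier D) r s : 0 <= r -> 0 <= s ->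
  bnd m r -> bnd n s -> bnd (mtens T m n) (r * s).
Proof.
move=> r0 s0 hm hn; have [k bk hk] := mtens_ex r0 s0 hm hn.
by rewrite (mtensP _ _ hk)//; [exists r|exists s].
Qed.

Lemma bd_mtens (m : multiplier A) (n : multiplier D) : bd m -> bd n -> bd (mtens T m n).
Proof.
move=> [r r0 hm] [s s0 hn]; exists (r * s); [exact: mulr_ge0|exact: bnd_mtens].
Qed.

Lemma mtens_mul (m m' : multiplier A) (n n' : multiplier D) :
  bd m -> bd n -> bd m' -> bd n' ->
  mtens T m n ** mtens T m' n' = mtens T (m ** m') (n ** n').
Proof.
move=> hm hn hm' hn'; apply/esym/mtensP; [exact: bdM|exact: bdM|] => a c.
by rewrite !lmM !lm_mtens.
Qed.

Lemma mtens_star (m : multiplier A) (n : multiplier D) : bd m -> bd n ->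
  star (mtens T m n) = mtens T (star m) (star n).
Proof.
move=> hm hn; apply/esym/mtensP; [exact: bd_star|exact: bd_star|] => a c.
apply: amull_inj => x; rewrite -[x]starK; move: (star x) => {}x.
rewrite lm_star starK; move: x.
have b1 : blin (fun x : T A D => star (tn a c) ** lm (mtens T m n) x).
  have [k k0 hk] := bd_mtens hm hn.
  exact: blin_comp (blin_lm hk) (blin_amull _).
have H : forall x, star (tn a c) ** lm (mtens T m n) x = star (tn (lm (star m) a) (lm (star n) c)) ** x.
  apply: (tens_eq b1 (blin_amull _)) => a' c'.
  by rewrite lm_mtens// !tens_star !tens_mul !lm_star.
by move=> x; apply: (can_inj (@starK R _)); rewrite !starM !starK H.
Qed.

Lemma mtens_membed a c : mtens T (membed a) (membed c) = membed (tn a c).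
Proof.
by apply: mtensP => [||a' c'] /=; [exact: bd_membed|exact: bd_membed|rewrite tens_mul].
Qed.

End Mtens.

Section TensHom.
Context (R : realType) (T : min_tensors R).
Local Notation C := R[i].

(** [f] is merely a family of generators, so compatibility with products and involution is expressed
    by an index k that serves [f] and [g] simultaneously. *)
Lemma total_hom I (V W : cstarAlgType R) (f : I -> V) (g : I -> W) (K : R) :
  total f -> 0 <= K -> (forall s, nr (lci g s) <= K * nr (lci f s)) ->
  (forall i j, exists2 k, f i ** f j = f k & g i ** g j = g k) ->
  (forall i, exists2 k, star (f i) = f k & star (g i) = g k) ->
  exists2 F : V -> W, starhom F & forall i, F (f i) = g i.
Proof.
move=> tf K0 hK gm gs; have [F [Fl Fb FE]] := ext_total tf K0 hK.
have bF : blin F by exact: blinP Fb.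
exists F => //; split=> //.
- move=> t t'; move: t; apply: (total_eq tf); [exact: blin_comp (blin_amulr _) bF|exact: blin_comp bF (blin_amulr _)|].
  move=> i; move: t'; apply: (total_eq tf); [exact: blin_comp (blin_amull _) bF|exact: blin_comp bF (blin_amull _)|].
  by move=> j; have [k e1 e2] := gm i j; rewrite !FE e2 -FE e1.
- apply: (total_ind tf).
  + move=> t h; apply/eqP; rewrite -subr_eq0; apply/eqP/nr_small_eq0 => e e0.
    apply: (@le_eps _ _ _ (2 * K)) => d d0; have [t' h1 h2] := h d d0.
    have -> : F (star t) - star (F t) = F (star (t - t')) - star (F (t - t')).
      by rewrite starB !(linB Fl) starB h1; lmod.
    apply: le_trans (nrB _ _) _; rewrite nr_star.
    have := Fb (star (t - t')); have := Fb (t - t'); rewrite nr_star.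
    have : K * nr (t - t') <= K * d by rewrite ler_wpM2l// ltW.
    by have := ltW e0; lra.
  + by rewrite star0 (lin0 Fl) star0.
  + by move=> k x y hx hy; rewrite starD starZ !Fl hx hy starD starZ.
  + by move=> i; have [k e1 e2] := gs i; rewrite e1 !FE e2.
Qed.

Section Ext.
Variables (A D W : cstarAlgType R).
Local Notation tn := (tens (T A D)).
Local Notation tp := (fun p : A * D => tn p.1 p.2).

Lemma tens_hom (g : A -> D -> W) (K : R) : 0 <= K ->
  (forall s, nr (lci (fun p => g p.1 p.2) s) <= K * nr (lci tp s)) ->
  (forall a d a' d', g a d ** g a' d' = g (a ** a') (d ** d')) ->
  (forall a d, star (g a d) = g (star a) (star d)) ->
  exists2 F : T A D -> W, starhom F & forall a d, F (tn a d) = g a d.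
Proof.
move=> K0 hK gm gs.
have [[a d] [a' d']|[a d]|F hF FE] := total_hom (@tens_total R T A D) K0 hK.
- by exists (a ** a', d ** d'); rewrite ?tens_mul ?gm.
- by exists (star a, star d); rewrite ?tens_star ?gs.
- by exists F => // a d; rewrite (FE (a, d)).
Qed.

Lemma hom_blin (A' B' : cstarAlgType R) (f : A' -> B') : starhom f -> blin f.
Proof.
by move=> hf; apply: (@blinP _ _ _ _ 1) => [|x]; [case: hf|rewrite mul1r hom_contr].
Qed.

Lemma homm_blin (A' B' : cstarAlgType R) (f : A' -> multiplier B') b : starhom f ->
  blin (fun a => lm (f a) b).
Proof.
move=> hf; apply: (@blinP _ _ _ _ (nr b)) => [k x y|x].
  by case: hf => fl _ _; rewrite fl.
by rewrite mulrC; exact: hom_mbnd.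
Qed.

Lemma bd_hom (A' B' : cstarAlgType R) (f : A' -> multiplier B') a : starhom f -> bd (f a).
Proof. by move=> hf; exists (nr a); [exact: nr_ge0|exact: hom_mbnd]. Qed.

Lemma tens_homm_eq (F F' : T A D -> multiplier W) : starhom F -> starhom F' ->
  (forall a d, F (tn a d) = F' (tn a d)) -> F =1 F'.
Proof.
move=> hF hF' h t; apply: multiplierP => b; move: t.
by apply: tens_eq; [exact: homm_blin|exact: homm_blin|move=> a d; rewrite h].
Qed.

End Ext.

Lemma tens_rep_lci (A D B E : cstarAlgType R) (phi : A -> B) (psi : D -> E) s
  (H K : hilbert R) (pi : B -> H -> H) (rho : E -> K -> K) sg sg' :
  is_tens_rep pi rho sg -> is_tens_rep (pi \o phi) (rho \o psi) sg' ->
  forall h, sg (lci (fun p => tens (T B E) (phi p.1) (psi p.2)) s) h =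
            sg' (lci (fun p => tens (T A D) p.1 p.2) s) h.
Proof.
move=> [rs hs] [rs' hs'].
have L1 h : sg (lci (fun p => tens (T B E) (phi p.1) (psi p.2)) s) h =
   lci (fun p => sg (tens (T B E) (phi p.1) (psi p.2)) h) s.
  by rewrite (lci_lin _ _ (rep_linearl rs h)).
apply: ht_eq => [||x y]; try exact: rep_blin.
rewrite L1 (lci_lin _ _ (rep_linearl rs' _)); apply: eq_bigr => p _ /=.
by rewrite hs hs'.
Qed.

Lemma comp_rep (A B : cstarAlgType R) (phi : A -> B) (H : hilbert R) (pi : B -> H -> H) :
  starhom phi -> representation pi -> representation (pi \o phi).
Proof.
move=> [pl pm ps] [h1 h2 h3 h4]; split=> /=.
- by move=> a; exact: h1.
- by move=> x k a b; rewrite pl h2.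
- by move=> a b x; rewrite pm h3.
- by move=> a x y; rewrite ps h4.
Qed.

Lemma tmap_ex (A D B E : cstarAlgType R) (phi : A -> B) (psi : D -> E) :
  starhom phi -> starhom psi ->
  exists2 F : T A D -> T B E, starhom F &
    forall a d, F (tens (T A D) a d) = tens (T B E) (phi a) (psi d).
Proof.
move=> hp hq; apply: (tens_hom ler01) => [s|a d a' d'|a d].
- rewrite mul1r; apply: tens_rep_norm => [|H K pi rho sg rp rr hsg h]; first exact: nr_ge0.
  have [sg' hsg'] := tens_repP T (comp_rep hp rp) (comp_rep hq rr).
  by rewrite (tens_rep_lci s hsg hsg'); case: hsg' => rs _; exact: rep_bnd.
- by rewrite tens_mul (starhom_mul hp) (starhom_mul hq).
- by rewrite tens_star (starhom_star hp) (starhom_star hq).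
Qed.

(** As phi is isometric, the representations pi o phi, with pi a representation of B, are norming
    for A. By [fam_tens_norm] they compute the norm of t, and their tensor products with rho factor
    through F. *)
Lemma tmap_isom (A D B : cstarAlgType R) (phi : A -> B) (F : T A D -> T B D) :
  starhom phi -> (forall a, nr (phi a) = nr a) -> starhom F ->
  (forall a d, F (tens (T A D) a d) = tens (T B D) (phi a) d) ->
  forall t, nr (F t) = nr t.
Proof.
move=> hp ip hF FE t; apply/le_anti; rewrite (hom_contr hF)/=.
apply: (@fam_tens_norm R T A D (fun H pi => exists2 pi' : B -> H -> H, representation pi' & pi = pi' \o phi)).
- by move=> H pi [pi' rp ->]; exact: comp_rep.
- move=> a r r0 h; rewrite -ip; apply: gelfand_naimark => // H pi rp x.
  by apply: (h H (pi \o phi)); exists pi.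
- exact: nr_ge0.
- move=> H K _ rho sg [pi rp ->] rr [rs hs] h.
  have [sg' [rs' hs']] := tens_repP T rp rr.
  suff -> : sg t h = sg' (F t) h by exact: rep_bnd.
  move: t; apply: tens_eq; [exact: rep_blinl|exact: blin_comp (hom_blin hF) (rep_blinl _ rs')|].
  move=> a d; move: h; apply: ht_eq => [||x y]; try exact: rep_blin.
  by rewrite FE hs hs'.
Qed.

Lemma cspan_lim (V : normedModType C) (S : set V) x :
  (forall e : R, 0 < e -> exists2 y, cspan S y & nr (x - y) < e) -> cspan S x.
Proof.
move=> h; apply/cspanP => e e0; have e2 : 0 < e / 2 by rewrite divr_gt0.
have [y /cspanP /(_ _ e2)[s [h1 h2]] h3] := h _ e2; exists s; split=> //.
by have := nr_tri y x (lci id s); lra.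
Qed.

Lemma cspan0 (V : normedModType C) (S : set V) : cspan S 0.
Proof. by apply/cspanP => e e0; exists [::]; rewrite /lci big_nil subrr nr0. Qed.

Lemma cspan_in (V : normedModType C) (S : set V) x : S x -> cspan S x.
Proof.
move=> h; apply/cspanP => e e0; exists [:: (1, x)]; split.
  by move=> p; rewrite inE => /eqP ->.
by rewrite lci1 subrr nr0.
Qed.

Lemma cspan_lin (V : normedModType C) (S : set V) (k : C) x y :
  cspan S x -> cspan S y -> cspan S (k *: x + y).
Proof.
move=> /cspanP hx /cspanP hy; apply/cspanP => e e0.
have e1 : 0 < e / 2 / (nr k + 1) by rewrite !divr_gt0// ltr_wpDl ?nr_ge0.
have [s [hs h1]] := hx _ e1; have [t [ht h2]] := hy _ (divr_gt0 e0 (ltr0n _ 2)).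
exists (scs k s ++ t); split.
  move=> p; rewrite mem_cat => /orP[/mapP[q qs ->]|]; [exact: hs qs|exact: ht].
rewrite lci_cat lci_scs opprD addrACA -scalerBr; apply: le_lt_trans (nrD _ _) _.
have h3 : nr k * nr (x - lci id s) < e / 2.
  apply: le_lt_trans (ler_wpM2l (nr_ge0 _) (ltW h1)) _.
  by rewrite mulrC; apply: divS_lt; rewrite ?nr_ge0// divr_gt0.
by rewrite nrZ; lra.
Qed.

Lemma cspan_ind (V : normedModType C) (S : set V) (P : V -> Prop) :
  (forall x, (forall e : R, 0 < e -> exists2 y, P y & nr (x - y) < e) -> P x) ->
  P 0 -> (forall k x y, P x -> P y -> P (k *: x + y)) ->
  (forall x, S x -> P x) -> forall x, cspan S x -> P x.
Proof.
move=> cP P0 PD PS x /cspanP hx; apply: cP => e e0; have [s [hs h]] := hx e e0.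
exists (lci id s) => //; elim: s hs {h} => [|p s IH] hs; first by rewrite /lci big_nil.
rewrite /lci big_cons; apply: PD; first by apply/PS/hs/mem_head.
by apply: IH => q qs; apply: hs; rewrite in_cons qs orbT.
Qed.

Lemma cspan_map (V W : normedModType C) (L : V -> W) (S : set V) (S' : set W) :
  blin L -> (forall x, S x -> cspan S' (L x)) -> forall x, cspan S x -> cspan S' (L x).
Proof.
move=> [lL [K K0 hK]] h; apply: cspan_ind => //.
- move=> x hx; apply: cspan_lim => e e0.
  have e1 : 0 < e / (K + 1) by rewrite divr_gt0// ltr_wpDl.
  have [y h1 h2] := hx _ e1; exists (L y) => //; rewrite -(linB lL).
  apply: le_lt_trans (hK _) _; apply: le_lt_trans (ler_wpM2l K0 (ltW h2)) _.
  by rewrite mulrC; exact: divS_lt.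
- by rewrite (lin0 lL); exact: cspan0.
- by move=> k x y hx hy; rewrite lL; exact: cspan_lin.
Qed.

Lemma total_cspanT (V : normedModType C) I (f : I -> V) : total f -> cspan (range f) = setT.
Proof. by move=> tf; apply: (total_cspan tf) => i; exists i. Qed.

Lemma total_nestl I J (V W : normedModType C) (f : I -> V) (g : V -> J -> W) :
  total f -> total (fun p : V * J => g p.1 p.2) -> (forall j, blin (g^~ j)) ->
  total (fun p : I * J => g (f p.1) p.2).
Proof.
move=> tf tg bg; apply: (@cspan_total _ _ _ _ (range (fun p : I * J => g (f p.1) p.2)));
  last by move=> _ [p _ <-]; exists p.
rewrite -subTset => x _.
apply: (total_ind tg) => [{}x hx||k {}x y hx hy|[v j]].
- exact: cspan_lim.
- exact: cspan0.
- exact: cspan_lin.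
- apply: (@cspan_map _ _ _ (range f) _ (bg j)); last by rewrite total_cspanT.
  by move=> _ [i _ <-]; apply: cspan_in; exists (i, j).
Qed.

Lemma total_nestr I J (V W : normedModType C) (f : I -> V) (g : J -> V -> W) :
  total f -> total (fun p : J * V => g p.1 p.2) -> (forall j, blin (g j)) ->
  total (fun p : J * I => g p.1 (f p.2)).
Proof.
move=> tf tg bg; apply: (@cspan_total _ _ _ _ (range (fun p : J * I => g p.1 (f p.2))));
  last by move=> _ [p _ <-]; exists p.
rewrite -subTset => x _.
apply: (total_ind tg) => [{}x hx||k {}x y hx hy|[j v]].
- exact: cspan_lim.
- exact: cspan0.
- exact: cspan_lin.
- apply: (@cspan_map _ _ _ (range f) _ (bg j)); last by rewrite total_cspanT.
  by move=> _ [i _ <-]; apply: cspan_in; exists (j, i).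
Qed.

Lemma nr_lci_gram (H K : hilbert R) I (f : I -> H) (g : I -> K) s :
  (forall i j, hdot H (f i) (f j) = hdot K (g i) (g j)) -> nr (lci f s) = nr (lci g s).
Proof.
move=> h; apply/eqP; rewrite -(eqrXn2 (n := 2)) ?nr_ge0//; apply/eqP.
suff : (nr (lci f s) ^+ 2)%:C%C = (nr (lci g s) ^+ 2)%:C%C :> C by case.
rewrite -!ipxx !ip_lci; apply: eq_bigr => p _; apply: eq_bigr => q _.
by rewrite h.
Qed.

(** * Associativity of the minimal tensor product *)

Section Assoc.
Variables (A B D : cstarAlgType R).
Local Notation ht := (ht T).
Local Notation hten := (hten T).

(** Inductive, so that case analysis identifies the underlying space with some [hten H K]. *)
Inductive prod_rep : forall H : hilbert R, (T A B -> H -> H) -> Prop :=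
  ProdRep (H K : hilbert R) (pi : A -> H -> H) (rho : B -> K -> K) sg :
    representation pi -> representation rho -> is_tens_rep pi rho sg ->
    @prod_rep (hten H K) sg.

Lemma blin_htl (H K : hilbert R) (y : K) : blin (fun x : H => ht x y).
Proof.
apply: (@blinP _ _ _ _ (nr y)); first exact: ht_linl.
by move=> x; rewrite nr_ht mulrC.
Qed.

(* The representations pi (x) rho form a norming family of A (x) B, so by
   [fam_tens_norm] they compute the norm of (A (x) B) (x) D; the vectors
   (x (x) y) (x) z and x (x) (y (x) z) have the same Gram matrix. *)
Lemma tens_assoc_bound s :
  nr (lci (fun p : A * (B * D) => tens (T (T A B) D) (tens (T A B) p.1 p.2.1) p.2.2) s) <=
  nr (lci (fun p => tens (T A (T B D)) p.1 (tens (T B D) p.2.1 p.2.2)) s).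
Proof.
set t' := lci _ s; set t := lci _ s.
apply: (@fam_tens_norm R T (T A B) D prod_rep).
- by move=> H _ [{}H K pi rho sg _ _ []].
- move=> a r r0 h; apply: tens_rep_norm => // H K pi rho sg rp rr hsg x.
  exact: h (ProdRep rp rr hsg) x.
- exact: nr_ge0.
move=> HK L sg0 sigma tau fam; move: tau.
case: fam => {HK sg0} H K pi rho sg rp rr [rs hs] tau rsi [rt htau].
have [sg2 [rs2 hs2]] := tens_repP T rr rsi.
have [tau2 [rt2 htau2]] := tens_repP T rp rs2.
pose f (p : H * K * L) := ht (ht p.1.1 p.1.2) p.2.
pose g (p : H * K * L) := ht p.1.1 (ht p.1.2 p.2).
have tf : total f.
  have := @total_nestl _ _ (hten H K) (hten (hten H K) L) _ (fun u z => ht u z)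
    (@ht_total R T H K) (@ht_total R T _ L).
  by apply=> z; exact: blin_htl.
have fg p q : hdot _ (f p) (f q) = hdot _ (g p) (g q).
  by rewrite !ht_dot mulrA.
apply: (blin_le_total tf (nr_ge0 _) (rep_blin t' rt)) => xi.
pose s2 := [seq (p.1 * q.1, (pi p.2.1 q.2.1.1, rho p.2.2.1 q.2.1.2, sigma p.2.2.2 q.2.2)) | p <- s, q <- xi].
have -> : tau t' (lci f xi) = lci f s2.
  rewrite /t' (lci_lin _ _ (rep_linearl rt _)) /s2 /lci big_allpairs_dep.
  apply: eq_bigr => p _ /=; rewrite (lin_sum (rep_linear rt _)) scaler_sumr.
  by apply: eq_bigr => q _; rewrite (linZ (rep_linear rt _)) htau hs scalerA.
have e2 : tau2 t (lci g xi) = lci g s2.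
  rewrite /t (lci_lin _ _ (rep_linearl rt2 _)) /s2 /lci big_allpairs_dep.
  apply: eq_bigr => p _ /=; rewrite (lin_sum (rep_linear rt2 _)) scaler_sumr.
  by apply: eq_bigr => q _; rewrite (linZ (rep_linear rt2 _)) htau2 hs2 scalerA.
rewrite (nr_lci_gram s2 fg) -e2 (nr_lci_gram xi fg).
exact: rep_bnd.
Qed.

Lemma assoc_total : total (fun p : A * (B * D) => tens (T A (T B D)) p.1 (tens (T B D) p.2.1 p.2.2)).
Proof.
have := @total_nestr _ _ (T B D) (T A (T B D)) _ (fun a w => tens (T A (T B D)) a w)
    (@tens_total R T B D) (@tens_total R T A _).
by apply=> a; exact: blin_tensr.
Qed.

Lemma assoc_total' : total (fun p : A * B * D => tens (T (T A B) D) (tens (T A B) p.1.1 p.1.2) p.2).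
Proof.
have := @total_nestl _ _ (T A B) (T (T A B) D) _ (fun a w => tens (T (T A B) D) a w)
    (@tens_total R T A B) (@tens_total R T _ D).
by apply=> a; exact: blin_tensl.
Qed.

Lemma tens_assocP : starhom (@tens_assoc R T A B D) /\ forall a b d,
  tens_assoc T (tens (T A (T B D)) a (tens (T B D) b d)) = tens (T (T A B) D) (tens (T A B) a b) d.
Proof.
apply: (@xgetPex _ (fun=> 0) [set f | starhom f /\ forall a b d,
  f (tens (T A (T B D)) a (tens (T B D) b d)) = tens (T (T A B) D) (tens (T A B) a b) d]).
have [|[a [b d]] [a' [b' d']]|[a [b d]]|F hF FE] := @total_hom _ _ _ _
  (fun p : A * (B * D) => tens (T (T A B) D) (tens (T A B) p.1 p.2.1) p.2.2) 1 assoc_total ler01.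
- by move=> s; rewrite mul1r; exact: tens_assoc_bound.
- by exists (a ** a', (b ** b', d ** d')); rewrite /= !tens_mul.
- by exists (star a, (star b, star d)); rewrite /= !tens_star.
by exists F; split=> // a b d; rewrite (FE (a, (b, d))).
Qed.

End Assoc.

(** * Tensor products of homomorphisms into multipliers *)

Section HomTens.
Variables (A B D E : cstarAlgType R) (phi : A -> multiplier B) (psi : D -> multiplier E).
Hypotheses (hphi : starhom phi) (hpsi : starhom psi).

(* the representation of A' on the closure of pi(B') H *)
Let pull_rep (A' B' : cstarAlgType R) (f : A' -> multiplier B') (H : hilbert R) (pi : B' -> H -> H) :
  starhom f -> representation pi ->
  exists (H' : hilbert R) (i : B' * H -> H') (pi' : A' -> H' -> H'),
  [/\ representation pi', forall p q, hdot H' (i p) (i q) = hdot H (pi p.1 p.2) (pi q.1 q.2) &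
   forall a p, pi' a (i p) = i (lm (f a) p.1, p.2)].
Proof.
move=> [fl fm fs] rp.
pose k (p q : B' * H) : C := hdot H (pi p.1 p.2) (pi q.1 q.2).
have hk : kernel k.
  split=> [p q|s]; first exact: ipJ.
  suff -> : kform k s s = hdot H (lci (fun p => pi p.1 p.2) s) (lci (fun p => pi p.1 p.2) s).
    by rewrite ipxx ler0c sqr_ge0.
  by rewrite ip_lci.
have [|||H' [i [pi' [h1 h2 h3 h4]]]] := @kernel_rep R A' (B' * H)%type k
  (fun a p => (lm (f a) p.1, p.2)) _ _ _ hk.
- by move=> c a b p q; rewrite /k /= fl lmD lmZ (rep_linearl rp) ipDl ipZl.
- by move=> a b p q; rewrite /k /= fm.
- by move=> a p q; rewrite /k /= !(rep_star rp) -!(rep_mul rp) fs lm_star starK.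
by exists H', i, pi'.
Qed.

(** The vectors pi(b)x (x) rho(e)y and their copies built from the spaces of [pull_rep] have the
    same Gram matrix. On the copies phi and psi act through representations of A and D, whose tensor
    product is bounded by |t|. *)
Lemma homtens_bound s (w : T B E) :
  nr (lci (fun p => lm (mtens T (phi p.1) (psi p.2)) w) s) <=
  nr w * nr (lci (fun p => tens (T A D) p.1 p.2) s).
Proof.
pose t := lci (fun p => tens (T A D) p.1 p.2) s; rewrite -/t; have bl a d : bd (mtens T (phi a) (psi d)).
  by apply: bd_mtens; exact: bd_hom.
rewrite mulrC.
have bX : blin (fun w => lci (fun p => lm (mtens T (phi p.1) (psi p.2)) w) s).
  apply: blin_sum => p; have [r r0 hr] := bl p.2.1 p.2.2.
  have := blin_scaleD p.1 (blin_lm hr) (blin0 (T B E) (T B E)).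
  by under eq_fun do rewrite addr0.
move: w; apply: (blin_le_total (@tens_total R T B E) (nr_ge0 t) bX) => w0.
set w := lci _ w0.
apply: tens_rep_norm => [|H K pi rho sg rp rr [rs hs]]; first by rewrite mulr_ge0 ?nr_ge0.
apply: (blin_le_total (@ht_total R T H K)); [by rewrite mulr_ge0 ?nr_ge0|exact: rep_blin|].
move=> xi.
have [H' [i [pi' [rp' hi hpi']]]] := pull_rep hphi rp.
have [K' [i' [rho' [rr' hi' hrho']]]] := pull_rep hpsi rr.
have [sg' [rs' hs']] := tens_repP T rp' rr'.
pose G (v : B * H * (E * K)) := ht T (pi v.1.1 v.1.2) (rho v.2.1 v.2.2).
pose F (v : B * H * (E * K)) := ht T (i v.1) (i' v.2).
have FG u v : hdot _ (F u) (F v) = hdot _ (G u) (G v) by rewrite !ht_dot hi hi'.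
(* [S2] lists the vector w xi and [S3] its image under t; both are evaluated by [G] in the given
   space and by [F] in the copy. *)
pose S2 := [seq (q.1 * x.1, ((q.2.1, x.2.1), (q.2.2, x.2.2))) | q <- w0, x <- xi].
pose S3 := [seq (p.1 * v.1, ((lm (phi p.2.1) v.2.1.1, v.2.1.2), (lm (psi p.2.2) v.2.2.1, v.2.2.2)))
  | p <- s, v <- S2].
have e2 : sg w (lci (fun p => ht T p.1 p.2) xi) = lci G S2.
  rewrite /w (lci_lin _ _ (rep_linearl rs _)) /S2 /lci big_allpairs_dep.
  apply: eq_bigr => q _ /=; rewrite (lin_sum (rep_linear rs _)) scaler_sumr.
  by apply: eq_bigr => x _; rewrite (linZ (rep_linear rs _)) hs scalerA.
have e3 : sg (lci (fun p => lm (mtens T (phi p.1) (psi p.2)) w) s)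
    (lci (fun p => ht T p.1 p.2) xi) = lci G S3.
  rewrite (lci_lin _ _ (rep_linearl rs _)) /S3 /lci big_allpairs_dep.
  apply: eq_bigr => p _ /=; rewrite /S2 big_allpairs_dep.
  have [r r0 hr] := bl p.2.1 p.2.2.
  rewrite /w (lci_lin _ _ (blin_lm hr).1) (lci_lin _ _ (rep_linearl rs _)) scaler_sumr.
  apply: eq_bigr => q _ /=; rewrite lm_mtens; try exact: bd_hom.
  rewrite (lin_sum (rep_linear rs _)) !scaler_sumr.
  by apply: eq_bigr => x _; rewrite (linZ (rep_linear rs _)) hs !scalerA !mulrA.
have e4 : sg' t (lci F S2) = lci F S3.
  rewrite /t (lci_lin _ _ (rep_linearl rs' _)) [RHS]/lci /S3 [RHS]big_allpairs_dep.
  rewrite [LHS]/lci.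
  apply: eq_bigr => p _ /=; rewrite (lin_sum (rep_linear rs' _)) scaler_sumr.
  by apply: eq_bigr => v _; rewrite (linZ (rep_linear rs' _)) hs' hpi' hrho' scalerA.
rewrite e3 -(nr_lci_gram S3 FG) -e4; apply: le_trans (rep_bnd rs' _ _) _.
rewrite (nr_lci_gram S2 FG) -e2 -mulrA ler_wpM2l ?nr_ge0//; exact: rep_bnd.
Qed.

(** [L w] is t -> Phi(t) w. The double centralizer law, with adjoint L x (star t), extends from
    elementary tensors by density. *)
Lemma homtensP : starhom (homtens T phi psi) /\
  forall a d, homtens T phi psi (tens (T A D) a d) = mtens T (phi a) (psi d).
Proof.
have bl a d : bd (mtens T (phi a) (psi d)) by apply: bd_mtens; exact: bd_hom.
apply: (@xgetPex _ (fun=> 0) [set Phi | starhom Phi /\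
  forall a d, Phi (tens (T A D) a d) = mtens T (phi a) (psi d)]).
have /choice[L hL] : forall w, exists L : T A D -> T B E, [/\ linear L,
    forall t, nr (L t) <= nr w * nr t &
    forall p : A * D, L (tens (T A D) p.1 p.2) = lm (mtens T (phi p.1) (psi p.2)) w].
  by move=> w; apply: (ext_total (@tens_total R T A D)) (nr_ge0 w) _ => s; exact: homtens_bound.
have bL w : blin (L w) by have [h1 h2 _] := hL w; exact: blinP h2.
have EL w a d : L w (tens (T A D) a d) = lm (mtens T (phi a) (psi d)) w.
  by have [_ _ /(_ (a, d))] := hL w.
have cent0 t x y : star x ** L y t = star (L x (star t)) ** y.
  move: t; apply: tens_ind => [t h||k t t' h h'|a d].
  - have b1 : blin (fun t => star x ** L y t) by exact: blin_comp (bL y) (blin_amull _).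
    apply: (closed_eq b1) h; apply: (@blinP _ _ _ _ (nr x * nr y)) => [k u v|u].
      by rewrite starD starZ (bL x).1 starD starZ conjCK amulDl amulZl.
    apply: le_trans (nr_amul _ _) _; rewrite nr_star [leRHS]mulrAC ler_wpM2r ?nr_ge0//.
    by rewrite -(nr_star u); have [_ u1 _] := hL x; exact: u1.
  - by rewrite star0 !(lin0 (bL _).1) star0 amul0l amul0r.
  - by rewrite starD starZ !(bL _).1 starD starZ conjCK amulDl amulZl amulDr amulZr h h'.
  - rewrite tens_star !EL (starhom_star hphi) (starhom_star hpsi) -mtens_star ?lm_star//; exact: bd_hom.
have cent t x y : x ** L y t = star (L (star x) (star t)) ** y by rewrite -cent0 starK.
pose Phi t := Multiplier (cent t).
have PE a d : Phi (tens (T A D) a d) = mtens T (phi a) (psi d).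
  by apply: multiplierP => y; rewrite /= EL.
have bP t : blin (lm (Phi t)).
  apply: (@blinP _ _ _ _ (nr t)) => [k x y|x]; first exact: lmP.
  by rewrite mulrC; have [_ h _] := hL x; exact: h.
exists Phi; split=> //; split.
- by move=> k t t'; apply: multiplierP => y /=; rewrite (bL y).1.
- move=> t t'; apply: multiplierP => y /=; move: t; apply: tens_eq.
  + exact: blin_comp (blin_amulr _) (bL y).
  + exact: bL.
  move=> a d; rewrite EL; move: t'; apply: tens_eq.
  + exact: blin_comp (blin_amull _) (bL y).
  + have [r r0 hr] := bl a d; exact: blin_comp (bL y) (blin_lm hr).
  move=> a' d'; rewrite tens_mul !EL (starhom_mul hphi) (starhom_mul hpsi).
  by rewrite -mtens_mul//; exact: bd_hom.
- by move=> t; apply: multiplierP => y /=; rewrite !starK.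
Qed.

End HomTens.

(** * Extension of nondegenerate homomorphisms to multipliers *)

Section Mext.
Variables (A B : cstarAlgType R) (phi : A -> multiplier B).
Hypotheses (hphi : starhom phi) (nphi : Defs.nondegenerate phi).

Lemma nondeg_total : total (fun p : A * B => lm (phi p.1) p.2).
Proof. by apply: cspan_total nphi _ => x [a [b ->]]; exists (a, b). Qed.

(** On the finitely many elements of A in the list, m acts almost like multiplication by the element
    m u, whose image under phi is bounded by r. *)
Let mext_bound m r s : 0 <= r -> bnd m r ->
  nr (lci (fun p => lm (phi (lm m p.1)) p.2) s) <= r * nr (lci (fun p => lm (phi p.1) p.2) s).
Proof.
move=> r0 hm; apply: (@le_eps _ _ _ (r * \sum_(p <- s) nr p.1 * nr p.2.2)) => d d0.
have [u [u1 hu]] := approx_fin [seq p.2.1 | p <- s] d0.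
set v := lci _ s; set w := lci _ s.
have e : lm (phi (lm m u)) w = lci (fun p => lm (phi (lm m (u ** p.1))) p.2) s.
  rewrite /w (@lci_lin R _ _ _ (lm (phi (lm m u))) _ s (lmP _)); apply: eq_bigr => p _.
  by rewrite /= lmA (starhom_mul hphi).
apply: le_trans (nr_leD _ (lm (phi (lm m u)) w)) _; apply: lerD.
  apply: le_trans (hom_mbnd hphi _ _) _; rewrite ler_wpM2r ?nr_ge0//.
  by apply: le_trans (hm _) _; rewrite ler_piMr.
have -> : v - lm (phi (lm m u)) w = lci (fun p => lm (phi (lm m (p.1 - u ** p.1))) p.2) s.
  rewrite e /v /lci -sumrB; apply: eq_bigr => p _.
  by rewrite -scalerBr lm_B (linB (starhom_linear hphi)) lmB.
apply: le_trans (nr_sum _ _) _; rewrite -mulrA mulr_suml mulr_sumr.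
rewrite big_seq [leRHS]big_seq; apply: ler_sum => p ps; rewrite nrZ.
have h1 : nr (lm (phi (lm m (p.2.1 - u ** p.2.1))) p.2.2) <= r * d * nr p.2.2.
  apply: le_trans (hom_mbnd hphi _ _) _; rewrite ler_wpM2r ?nr_ge0//.
  apply: le_trans (hm _) _; rewrite ler_wpM2l// ltW// hu// (map_f (fun p => p.2.1))//.
have -> : r * (nr p.1 * nr p.2.2 * d) = nr p.1 * (r * d * nr p.2.2) by ring.
by rewrite ler_wpM2l ?nr_ge0.
Qed.

Lemma mext_ex m r : 0 <= r -> bnd m r -> exists2 n, bnd n r &
  forall a b, lm n (lm (phi a) b) = lm (phi (lm m a)) b.
Proof.
move=> r0 hm.
have [|||n [h1 h2 _]] := @mult_ex R (A * B)%type B (fun p => lm (phi p.1) p.2)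
  (fun p => lm (phi (lm m p.1)) p.2) (fun p => lm (phi (lm (star m) p.1)) p.2) r nondeg_total r0.
- by move=> s; exact: mext_bound.
- by move=> s; apply: mext_bound => //; exact: bnd_star.
- move=> p q; rewrite (lm_star (phi (lm m q.1))) (lm_star (phi q.1)).
  rewrite -!(starhom_star hphi) -!lmM -!(starhom_mul hphi).
  by rewrite (lm_star (star m)) starK.
by exists n => // a b; rewrite (h2 (a, b)).
Qed.

Lemma lm_mext m : bd m ->
  forall a b, lm (mext phi m) (lm (phi a) b) = lm (phi (lm m a)) b.
Proof.
move=> [r r0 hm]; have [n _ hn] := mext_ex r0 hm.
by apply: (@xgetPex _ 0 [set n | forall a b, lm n (lm (phi a) b) = lm (phi (lm m a)) b]); exists n.
Qed.

Lemma mextP m n : bd m -> (forall a b, lm n (lm (phi a) b) = lm (phi (lm m a)) b) ->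
  mext phi m = n.
Proof.
by move=> hm h; apply: (mult_eq_total nondeg_total) => -[a b] /=; rewrite lm_mext// h.
Qed.

Lemma bnd_mext m r : 0 <= r -> bnd m r -> bnd (mext phi m) r.
Proof.
move=> r0 hm; have [n bn hn] := mext_ex r0 hm.
by rewrite (mextP _ hn)//; exists r.
Qed.

Lemma bd_mext m : bd m -> bd (mext phi m).
Proof. by move=> [r r0 hm]; exists r => //; exact: bnd_mext. Qed.

Lemma mext_mul m n : bd m -> bd n -> mext phi m ** mext phi n = mext phi (m ** n).
Proof.
move=> hm hn; apply/esym/mextP => [|a b]; first exact: bdM.
by rewrite !lmM !lm_mext.
Qed.

Lemma mext_star m : bd m -> star (mext phi m) = mext phi (star m).
Proof.
move=> hm; apply/esym/mextP => [|a b]; first exact: bd_star.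
apply: amull_inj => x; rewrite -[x]starK lm_star starK; move: (star x) => {}x.
apply: (can_inj (@starK R _)); rewrite !starM !starK; move: x.
have [k k0 hk] := bd_mext hm; apply: (total_eq nondeg_total); [|exact: blin_amull|].
  exact: blin_comp (blin_lm hk) (blin_amull _).
move=> [c d] /=; rewrite lm_mext//.
rewrite (lm_star (phi (lm m c))) (lm_star (phi c)).
rewrite -!(starhom_star hphi) -!lmM -!(starhom_mul hphi).
by rewrite (lm_star (star m)) starK.
Qed.



End Mext.

End TensHom.

(** * Naturality of f . a, and exactness from the inclusion *)

Section Slices.
Context (R : realType) (T : min_tensors R).
Local Notation C := R[i].

Lemma blin_rm (A : cstarAlgType R) (m : multiplier A) : bd m -> blin (rm m).
Proof.
move=> /bd_star[r r0 h]; apply: (@blinP _ _ _ _ r) => [k x y|x]; first exact: rmP.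
by rewrite rmE nr_star -[nr x]nr_star; exact: h.
Qed.

Section AD.
Variables (A D : cstarAlgType R).
Local Notation tn := (tens (T A D)).

Lemma rm_mtens (m : multiplier A) (n : multiplier D) a c : bd m -> bd n ->
  rm (mtens T m n) (tn a c) = tn (rm m a) (rm n c).
Proof.
move=> hm hn; rewrite rmE mtens_star// tens_star lm_mtens; try exact: bd_star.
by rewrite tens_star -!rmE.
Qed.

Lemma bd_mtens1 (c : D) : bd (mtens1 T A c).
Proof. by apply: bd_mtens; [exact: bd1|exact: bd_membed]. Qed.

Lemma lm_mtens1 (c : D) a d : lm (mtens1 T A c) (tn a d) = tn a (c ** d).
Proof. by rewrite lm_mtens//; [exact: bd1|exact: bd_membed]. Qed.

Lemma rm_mtens1 (c : D) a d : rm (mtens1 T A c) (tn a d) = tn a (d ** c).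
Proof. by rewrite rm_mtens//; [exact: bd1|exact: bd_membed]. Qed.

Lemma slice_blin (g : D -> C) : dual g -> blin (slice T g : T A D -> A).
Proof.
move=> dg; have [S bS hS] := slice_ex T A dg.
have -> : slice T g = S by apply/funext => t; exact: sliceE.
exact: bS.
Qed.

Lemma slice_tens (g : D -> C) a d : dual g -> slice T g (tn a d) = g d *: a.
Proof. by move=> dg; have [S bS hS] := slice_ex T A dg; rewrite (sliceE _ bS hS). Qed.

Lemma dual_amulr (g : D -> C) c : dual g -> dual (fun x => g (x ** c)).
Proof. by move=> /dual_blin dg; apply/dual_blin; exact: blin_comp (blin_amulr c) dg. Qed.

Lemma slice_rm (g : D -> C) c t : dual g ->
  slice T g (rm (mtens1 T A c) t) = slice T (fun x => g (x ** c)) t.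
Proof.
move=> dg; move: t; apply: tens_eq.
- exact: blin_comp (blin_rm (bd_mtens1 c)) (slice_blin dg).
- exact/slice_blin/dual_amulr.
by move=> a d; rewrite rm_mtens1 !slice_tens//; exact: dual_amulr.
Qed.

(* Independence of the factorization f = g(. c): multiply on the left by an
   approximate unit e, so that e m (1 (x) c) is the product of e m, which lies in
   A (x) D, with 1 (x) c. *)
Lemma msliceE (f : D -> C) (m : multiplier (T A D)) g c t : dual g ->
  (forall x, f x = g (x ** c)) -> m ** mtens1 T A c = membed t ->
  mslice T f m = slice T g t.
Proof.
move=> dg fg mt; apply: xget_unique => [|_ [g' [c' [t' [dg' fg' mt' ->]]]]].
  by exists g, c, t.
have H (h : D -> C) d s e : dual h -> (forall x, f x = h (x ** d)) -> m ** mtens1 T A d = membed s ->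
    slice T h (e ** s) = slice T f (rm m e).
  move=> dh fh ms; have -> : e ** s = rm (mtens1 T A d) (rm m e).
    by apply: membed_inj; rewrite membedM -ms -!membed_rm amulA.
  by rewrite slice_rm//; congr slice; apply/funext => x; rewrite fh.
apply/eqP; rewrite -subr_eq0; apply/eqP/nr_small_eq0 => e e0.
have [bl [K K0 hK]] := slice_blin dg; have [bl' [K' K0' hK']] := slice_blin dg'.
apply: (@le_eps _ _ _ (K + K')) => d d0.
have [u [_ hu]] := approx_fin [:: t; t'] d0.
have h1 : nr (t - u ** t) < d by rewrite hu// !inE eqxx.
have h2 : nr (t' - u ** t') < d by rewrite hu// !inE eqxx orbT.
have -> : slice T g' t' - slice T g t = slice T g' (t' - u ** t') - slice T g (t - u ** t).
  by rewrite (linB bl') (linB bl) (H g c t)// (H g' c' t')//; lmod.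
apply: le_trans (nrB _ _) _; have := hK (t - u ** t); have := hK' (t' - u ** t').
have : K * nr (t - u ** t) <= K * d by rewrite ler_wpM2l// ltW.
have : K' * nr (t' - u ** t') <= K' * d by rewrite ler_wpM2l// ltW.
by have := ltW e0; lra.
Qed.

(** For an f without factorization the description is empty and the default 0 is returned; both
    sides of naturality then vanish. *)
Lemma mslice_nfact (f : D -> C) (m : multiplier (T A D)) :
  ~ (exists g c t, [/\ dual g, forall x, f x = g (x ** c) & m ** mtens1 T A c = membed t]) ->
  mslice T f m = 0.
Proof.
move=> h; rewrite /mslice xgetPN// => y [g [c [t [h1 h2 h3 _]]]].
by apply: h; exists g, c, t.
Qed.

End AD.

Lemma slice_tmap (A B D : cstarAlgType R) (phi : A -> B) (F : T A D -> T B D) (g : D -> C) t :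
  starhom phi -> starhom F -> (forall a d, F (tens (T A D) a d) = tens (T B D) (phi a) d) ->
  dual g -> slice T g (F t) = phi (slice T g t).
Proof.
move=> hp hF FE dg; move: t; apply: tens_eq.
- exact: blin_comp (hom_blin hF) (slice_blin _ dg).
- exact: blin_comp (slice_blin _ dg) (hom_blin hp).
by move=> a d; rewrite FE !slice_tens// (linZ (starhom_linear hp)).
Qed.

Lemma starhom_id (A : cstarAlgType R) : starhom (@id A).
Proof. by []. Qed.

Lemma tmapl_ex (A B D : cstarAlgType R) (phi : A -> B) : starhom phi ->
  exists2 F : T A D -> T B D, starhom F &
    forall a d, F (tens (T A D) a d) = tens (T B D) (phi a) d.
Proof. by move=> hp; exact: (tmap_ex T hp (starhom_id D)). Qed.

Lemma homtens_membed (A B D E : cstarAlgType R) (phi : A -> B) (psi : D -> E) (F : T A D -> T B E) :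
  starhom phi -> starhom psi -> starhom F ->
  (forall a d, F (tens (T A D) a d) = tens (T B E) (phi a) (psi d)) ->
  forall t, homtens T (fun a => membed (phi a)) (fun d => membed (psi d)) t = membed (F t).
Proof.
move=> hp hq hF FE; have [h1 h2] := homtensP T (hom_membed hp) (hom_membed hq).
apply: tens_homm_eq => //; first exact: hom_membed.
by move=> a d; rewrite h2 FE mtens_membed.
Qed.

End Slices.

Section CoactHom.
Context (R : realType) (G : topGroupType) (CG : group_cstar R G) (T : min_tensors R).
Local Notation C := R[i].
Local Notation coact := (coaction CG T).

Lemma delta_tilde (X : coact) (a : X) c : exists t, membed t = cdelta a ** mtens1 T X c.
Proof. by have [[t _ ht] _] := cdelta_tilde a c; exists t. Qed.

Lemma lin_delta (X : coact) : linear (@cdelta _ _ _ _ X).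
Proof. exact: starhom_linear (@cdelta_hom _ _ _ _ X). Qed.

Lemma cdotE (X : coact) (f : CG -> C) (a : X) g c t : dual g -> (forall x, f x = g (x ** c)) ->
  membed t = cdelta a ** mtens1 T X c -> cdot f a = slice T g t.
Proof. by move=> dg fg h; rewrite /cdot (msliceE dg fg (esym h)). Qed.

Lemma cdot_nfact (X : coact) (f : CG -> C) (a : X) :
  ~ (exists g c, dual g /\ forall x, f x = g (x ** c)) -> cdot f a = 0.
Proof.
move=> h; apply: mslice_nfact => -[g [c [t [h1 h2 _]]]].
by apply: h; exists g, c.
Qed.

Lemma cdot0 (X : coact) (f : CG -> C) : cdot f (0 : X) = 0.
Proof.
have [[g [c [dg fg]]]|] := pselect (exists g c, dual (A := CG) g /\ forall x, f x = g (x ** c)); last exact: cdot_nfact.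
have h : membed 0 = cdelta (0 : X) ** mtens1 T X c.
  by rewrite (lin0 (@lin_delta X)) amul0l membed0.
by rewrite (cdotE dg fg h) (lin0 (slice_blin T X dg).1).
Qed.

Lemma chom_lin (X Y : coact) (phi : coact_hom X Y) : linear phi.
Proof. exact: starhom_linear (chom_hom phi). Qed.

(* [Mtilde_ext phi] is a definite description; where it fails to describe
   anything its value is 0, so that phi a = 0 by injectivity of the coaction. *)
Lemma chom_delta (X Y : coact) (phi : coact_hom X Y) (F : T X CG -> T Y CG) : starhom F ->
  (forall a d, F (tens (T X CG) a d) = tens (T Y CG) (phi a) d) ->
  forall a, phi a = 0 \/
    forall c t, membed t = cdelta a ** mtens1 T X c -> membed (F t) = cdelta (phi a) ** mtens1 T Y c.
Proof.
move=> hF FE a; have e := chom_equiv phi a.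
pose S := [set n | Mtilde T Y CG n /\ forall c t, cdelta a ** mtens1 T X c = membed t ->
    n ** mtens1 T Y c = homtens T (fun a => membed (phi a)) (@membed R CG) t].
have [h|h] := pselect (exists n, S n).
  right=> c t ht; have : S (cdelta (phi a)) by rewrite e; exact: (xgetPex 0 h).
  move=> [_ /(_ c t (esym ht)) ->]; apply/esym.
  exact: (homtens_membed (chom_hom phi) (starhom_id CG) hF FE).
left; apply: (@cdelta_inj _ _ _ _ Y); rewrite e (lin0 (@lin_delta Y)).
by apply: xgetPN => n Sn; apply: h; exists n.
Qed.

(** The hypothesis handles the branch phi a = 0 of [chom_delta], in which equivariance gives no
    information; injectivity or exactness will supply it. *)
Lemma cdot_hom (X Y : coact) (phi : coact_hom X Y) f a :
  (phi a = 0 -> phi (cdot f a) = 0) -> cdot f (phi a) = phi (cdot f a).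
Proof.
move=> h0; have [F hF FE] := tmapl_ex T CG (chom_hom phi).
have [[g [c [dg fg]]]|nf] := pselect (exists g c, dual (A := CG) g /\ forall x, f x = g (x ** c)); last first.
  by rewrite !cdot_nfact// (lin0 (chom_lin phi)).
have [p0|h] := chom_delta hF FE a; first by rewrite p0 cdot0 h0.
have [t ht] := delta_tilde a c.
rewrite (cdotE dg fg ht) (cdotE dg fg (h _ _ ht)).
exact: (slice_tmap t (chom_hom phi) hF FE dg).
Qed.

Lemma chom_delta_inj (X Y : coact) (phi : coact_hom X Y) (F : T X CG -> T Y CG) : starhom F ->
  (forall a d, F (tens (T X CG) a d) = tens (T Y CG) (phi a) d) -> injective phi ->
  forall a c t, membed t = cdelta a ** mtens1 T X c -> membed (F t) = cdelta (phi a) ** mtens1 T Y c.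
Proof.
move=> hF FE ip a c t ht; have [p0|] := chom_delta hF FE a; last exact.
have a0 : a = 0 by apply: ip; rewrite p0 (lin0 (chom_lin phi)).
have t0 : t = 0.
  by apply: membed_inj; rewrite ht a0 (lin0 (@lin_delta X)) amul0l membed0.
by rewrite p0 t0 (lin0 (starhom_linear hF)) membed0 (lin0 (@lin_delta Y)) amul0l.
Qed.

(** * Short exact sequences of coactions *)

Section Exact.
Variables (X Y Z : coact) (phi : coact_hom X Y) (psi : coact_hom Y Z).
Hypothesis ex : short_exact phi psi.

Lemma exact_cdot_phi f a : cdot f (phi a) = phi (cdot f a).
Proof.
have [ip _ _] := ex; apply: cdot_hom => p0.
have -> : a = 0 by apply: ip; rewrite p0 (lin0 (chom_lin phi)).
by rewrite cdot0 (lin0 (chom_lin phi)).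
Qed.

(** If psi b = 0, then b comes from X and so does f . b, by naturality for phi; this settles the
    exceptional case of [cdot_hom]. *)
Lemma exact_cdot_psi f b : cdot f (psi b) = psi (cdot f b).
Proof.
have [_ rk _] := ex; apply: cdot_hom => p0.
have [a _ <-] : range phi b by rewrite rk.
rewrite exact_cdot_phi.
have : range phi (phi (cdot f a)) by exists (cdot f a).
by rewrite rk.
Qed.

Lemma exact_ideal : ideal (range phi).
Proof.
have [_ -> _] := ex; have [pl pm _] := chom_hom psi; split => //=.
- exact: lin0 pl.
- by move=> k x y hx hy; rewrite pl hx hy scaler0 addr0.
- by move=> a x hx; rewrite pm hx amul0r.
- by move=> a x hx; rewrite pm hx amul0l.
- apply/closedP => x hx; apply: (closed_eq (hom_blin (chom_hom psi)) (blin0 _ _)) => e e0.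
  by have [y h1 h2] := hx e e0; exists y.
Qed.

(** Both sides are the closure of the image of X (x) C*(G) under phi (x) id, which is generated by
    images of elementary tensors and also, by the density condition for X, by those of the elements
    delta(b)(1 (x) c). *)
Lemma exact_strongly_invariant : strongly_invariant (range phi).
Proof.
have [ip _ _] := ex; have [F hF FE] := tmapl_ex T CG (chom_hom phi).
have D := chom_delta_inj hF FE ip; have bF := hom_blin hF.
have H S : (forall b c, cspan S (tens (T X CG) b c)) -> forall t, cspan S t.
  move=> h t; have : cspan [set x | exists a c, x = tens (T X CG) a c] t by rewrite tens_dense.
  by apply: (cspan_map (blin_id _)) => _ [b [c ->]].
rewrite /strongly_invariant; apply/seteqP; split.
  apply: (cspan_map (blin_id _)) => t [_ [c [[b _ <-] ht]]].
  have [t' ht'] := delta_tilde b c.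
  have -> : t = F t' by apply: membed_inj; rewrite ht (D _ _ _ ht').
  have : cspan [set x | exists a c, x = tens (T X CG) a c] t' by rewrite tens_dense.
  apply: (cspan_map bF) => _ [b' [c' ->]]; apply: cspan_in.
  by exists (phi b'), c'; split; [exists b'|rewrite FE].
apply: (cspan_map (blin_id _)) => _ [_ [c [[b _ <-] ->]]]; rewrite -FE.
have : cspan [set t : T X CG | exists a c, membed t = cdelta a ** mtens1 T X c] (tens (T X CG) b c).
  by rewrite cdelta_dense.
apply: (cspan_map bF) => t [b' [c' ht]]; apply: cspan_in.
by exists (phi b'), c'; split; [exists b'|exact: D].
Qed.

End Exact.

Lemma exact_of_inclusion (E : set (CG -> C)) (tauE : tau_functor T E) :
  (forall (X : coact) (I : set X), ideal I -> strongly_invariant I ->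
     [set a : X | forall f, E f -> I (cdot f a)] `<=`
     [set x + y | x in I & y in annihilated E (X := X)]) -> exact_functor tauE.
Proof.
move=> H X Y Z phi psi ex; have [ip rk sp] := ex.
have tl (W : coact) : linear (tauQ tauE W) by exact: chom_lin.
have ker (W : coact) (a : W) : tauQ tauE W a = 0 <-> annihilated E a.
  by rewrite -(tauQ_ker tauE W).
have surj (W : coact) (b : tau tauE W) : exists a, tauQ tauE W a = b.
  have [a _ <-] : range (tauQ tauE W) b by rewrite tauQ_surj.
  by exists a.
split.
- have inj0 x : fmor tauE phi x = 0 -> x = 0.
    have [a <-] := surj _ x; rewrite tauQ_natural => /ker h; apply/ker => f Ef.
    by apply: ip; rewrite -(exact_cdot_phi ex) h// (lin0 (chom_lin phi)).
  move=> x y e; apply/eqP; rewrite -subr_eq0; apply/eqP/inj0.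
  by rewrite (linB (chom_lin _)) e subrr.
- apply/seteqP; split=> [_ [x _ <-]|y /=].
    have [a <-] := surj _ x; rewrite /= !tauQ_natural.
    have : range phi (phi a) by exists a.
    by rewrite rk /= => ->; rewrite (lin0 (chom_lin _)).
  have [b <-] := surj _ y; rewrite tauQ_natural => /ker h.
  have /(H _ _ (exact_ideal ex) (exact_strongly_invariant ex)) : 
      [set a | forall f, E f -> range phi (cdot f a)] b.
    by move=> f Ef; rewrite rk /= -(exact_cdot_psi ex) h.
  move=> [_ [a _ <-] [b' /ker hb' <-]]; exists (tauQ tauE X a) => //.
  by rewrite tauQ_natural (linD (tl Y)) hb' addr0.
- rewrite -subTset => z _; have [c <-] := surj _ z.
  have : range psi c by rewrite sp.
  move=> [b _ <-]; exists (tauQ tauE Y b) => //.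
  by rewrite tauQ_natural.
Qed.

End CoactHom.

(** * The counit of a coaction *)

Section Intertwine.
Context (R : realType) (T : min_tensors R).
Local Notation C := R[i].

(** [L] is just a bounded linear map, such as a slice or a map induced on tensor products;
    equalities of multipliers are obtained by pushing their actions on vectors through such maps. *)
Lemma mext_intertwine (A1 A2 B1 B2 : cstarAlgType R) (phi1 : A1 -> multiplier B1)
    (phi2 : A2 -> multiplier B2) (K : A1 -> A2) (L : B1 -> B2) m1 m2 :
  starhom phi1 -> Defs.nondegenerate phi1 -> starhom phi2 -> Defs.nondegenerate phi2 ->
  blin L -> (forall a b, L (lm (phi1 a) b) = lm (phi2 (K a)) (L b)) ->
  bd m1 -> bd m2 -> (forall a, K (lm m1 a) = lm m2 (K a)) ->
  forall b, L (lm (mext phi1 m1) b) = lm (mext phi2 m2) (L b).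
Proof.
move=> h1 n1 h2 n2 bL i1 b1 b2 i2.
have [r1 _ c1] := bd_mext h1 n1 b1; have [r2 _ c2] := bd_mext h2 n2 b2.
apply: (total_eq (nondeg_total n1)).
- exact: blin_comp (blin_lm c1) bL.
- exact: blin_comp bL (blin_lm c2).
by move=> [a b] /=; rewrite lm_mext// !i1 i2 lm_mext.
Qed.

Lemma homtens_intertwine (A1 A2 D1 D2 B1 B2 E1 E2 : cstarAlgType R)
    (phi1 : A1 -> multiplier B1) (psi1 : D1 -> multiplier E1)
    (phi2 : A2 -> multiplier B2) (psi2 : D2 -> multiplier E2)
    (k0 : A1 -> A2) (k1 : D1 -> D2) (l0 : B1 -> B2) (l1 : E1 -> E2)
    (K : T A1 D1 -> T A2 D2) (L : T B1 E1 -> T B2 E2) :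
  starhom phi1 -> starhom psi1 -> starhom phi2 -> starhom psi2 ->
  blin K -> blin L ->
  (forall a d, K (tens (T A1 D1) a d) = tens (T A2 D2) (k0 a) (k1 d)) ->
  (forall b e, L (tens (T B1 E1) b e) = tens (T B2 E2) (l0 b) (l1 e)) ->
  (forall a b, l0 (lm (phi1 a) b) = lm (phi2 (k0 a)) (l0 b)) ->
  (forall d e, l1 (lm (psi1 d) e) = lm (psi2 (k1 d)) (l1 e)) ->
  forall t w, L (lm (homtens T phi1 psi1 t) w) = lm (homtens T phi2 psi2 (K t)) (L w).
Proof.
move=> h1 g1 h2 g2 bK bL KE LE i0 i1 t w.
have [H1 E1'] := homtensP T h1 g1; have [H2 E2'] := homtensP T h2 g2.
move: t; apply: tens_eq.
- exact: blin_comp (homm_blin _ H1) bL.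
- exact: blin_comp bK (homm_blin _ H2).
move=> a d; rewrite KE E1' E2'.
have [r1 _ c1] := bd_mtens T (bd_hom a h1) (bd_hom d g1).
have [r2 _ c2] := bd_mtens T (bd_hom (k0 a) h2) (bd_hom (k1 d) g2).
move: w; apply: tens_eq.
- exact: blin_comp (blin_lm c1) bL.
- exact: blin_comp bL (blin_lm c2).
move=> b e; rewrite LE !lm_mtens; try exact: bd_hom.
by rewrite LE i0 i1.
Qed.

Lemma total_nondeg (A B : cstarAlgType R) (phi : A -> multiplier B) I (f : I -> B) :
  total f -> (forall i, exists a b, f i = lm (phi a) b) -> Defs.nondegenerate phi.
Proof. by move=> tf h; apply: (total_cspan tf). Qed.

Lemma homtens_nondeg (A B D E : cstarAlgType R) (phi : A -> multiplier B) (psi : D -> multiplier E) :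
  starhom phi -> Defs.nondegenerate phi -> starhom psi -> Defs.nondegenerate psi ->
  Defs.nondegenerate (homtens T phi psi).
Proof.
move=> h n g m; have [H HE] := homtensP T h g.
have t1 := total_nestr (nondeg_total m) (@tens_total R T B E) (@blin_tensr R T B E).
have t2 := @total_nestl R (A * B) (D * E) B (T B E) (fun p => lm (phi p.1) p.2)
  (fun b p => tens (T B E) b (lm (psi p.1) p.2)) (nondeg_total n) t1
  (fun p => @blin_tensl R T B E _).
apply: (total_nondeg t2) => -[[a b] [d e]] /=.
exists (tens (T A D) a d), (tens (T B E) b e).
by rewrite HE lm_mtens//; exact: bd_hom.
Qed.

Lemma approx_mul (A : cstarAlgType R) (a : A) (e : R) : 0 < e -> exists u : A, nr (a - u ** a) < e.
Proof.
by move=> e0; have [u [_ hu]] := approx_fin [:: a] e0; exists u; apply: hu; rewrite mem_head.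
Qed.

Lemma membed_nondeg (A B : cstarAlgType R) (f : A -> B) :
  cspan (range f) = setT -> Defs.nondegenerate (fun a => membed (f a)).
Proof.
move=> hf; rewrite /Defs.nondegenerate -subTset => x _; apply: cspan_lim => e e0.
have [u hu] := approx_mul x e0; exists (u ** x) => //.
have : cspan (range f) u by rewrite hf.
apply: (cspan_map (blin_amulr x)) => _ [a _ <-]; apply: cspan_in.
by exists a, x.
Qed.

Lemma membed_id_nondeg (A : cstarAlgType R) : Defs.nondegenerate (@membed R A).
Proof.
apply: (@membed_nondeg A A id); rewrite -subTset => x _; apply: cspan_in.
by exists x.
Qed.

Lemma mext_membed_id (A : cstarAlgType R) (m : multiplier A) : bd m -> mext (@membed R A) m = m.
Proof.
move=> bm; apply: (mextP (@membed_hom R A) (@membed_id_nondeg A) bm) => a b /=.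
by rewrite lmA.
Qed.

End Intertwine.

(** * Unitary homomorphisms of G and the universal property of C*(G) *)

Section Group.
Context (R : realType) (G : topGroupType) (CG : group_cstar R G) (T : min_tensors R).
Local Notation C := R[i].
Local Notation u := (gunit CG).

Lemma cont_nr (S : topologicalType) (V : normedModType C) (f : S -> V) :
  continuous f <-> forall x (e : R), 0 < e -> \forall y \near x, nr (f x - f y) < e.
Proof.
split=> [cf x e e0|h x].
  have e1 : (0 : C) < e%:C%C by rewrite (ltcR 0 e).
  have /cvgrPdist_lt /(_ _ e1) := cf x.
  by apply: filterS => y; rewrite nrE ltcR.
apply/cvgrPdist_lt => e /posC[d d0 ->]; have := h x d d0.
by apply: filterS => y hy; rewrite nrE ltcR.
Qed.

Lemma unitary_bnd1 (B : cstarAlgType R) (v : G -> multiplier B) s : unitary_hom v -> bnd (v s) 1.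
Proof.
move=> [v1 vm vV _]; apply: bnd_sq => //.
by rewrite -vV -vm mulVg v1 expr1n; exact: bnd1.
Qed.

Lemma unitary_bd (B : cstarAlgType R) (v : G -> multiplier B) s : unitary_hom v -> bd (v s).
Proof. by exists 1 => //; exact: unitary_bnd1. Qed.

Lemma bd_u s : bd (u s).
Proof. exact/unitary_bd/gunit_unitary. Qed.

(** The unitaries are uniformly bounded, so strict continuity can be checked on elementary
    tensors. *)
Lemma unitary_mtens (A B : cstarAlgType R) (v : G -> multiplier A) (w : G -> multiplier B) :
  unitary_hom v -> unitary_hom w -> unitary_hom (fun s => mtens T (v s) (w s)).
Proof.
move=> hv hw; have [v1 vm vV vc] := hv; have [w1 wm wV wc] := hw.
have bv s := unitary_bd s hv; have bw s := unitary_bd s hw.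
have b1 s : bnd (mtens T (v s) (w s)) 1.
  by rewrite -[1 in X in bnd _ X]mulr1; apply: bnd_mtens => //; exact: unitary_bnd1.
split.
- by rewrite v1 w1; apply: mtensP => //; exact: bd1.
- by move=> s t; rewrite vm wm mtens_mul.
- by move=> s; rewrite vV wV mtens_star.
move=> b; apply/cont_nr; move: b; apply: tens_ind.
- move=> b hb x e e0; have e3 : 0 < e / 3 by rewrite divr_gt0.
  have [b' h1 h2] := hb _ e3; have := h1 x _ e3; apply: filterS => y hy.
  have D s : nr (lm (mtens T (v s) (w s)) b - lm (mtens T (v s) (w s)) b') < e / 3.
    by rewrite -lm_B; apply: le_lt_trans (b1 s _) _; rewrite mul1r.
  have := nr_tri (lm (mtens T (v x) (w x)) b') (lm (mtens T (v x) (w x)) b) (lm (mtens T (v y) (w y)) b).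
  have := nr_tri (lm (mtens T (v y) (w y)) b') (lm (mtens T (v x) (w x)) b') (lm (mtens T (v y) (w y)) b).
  by have := D x; have := D y; rewrite (nrBC (lm (mtens T (v y) (w y)) b)); lra.
- by move=> x e e0; apply: filterE => y; rewrite !lm0 subrr nr0.
- move=> k b b' hb hb' x e e0; have e2 : 0 < e / 2 by rewrite divr_gt0.
  have ek : 0 < e / 2 / (nr k + 1) by rewrite divr_gt0// ltr_wpDl ?nr_ge0.
  have h1 := hb x _ ek; have h2 := hb' x _ e2.
  near=> y; rewrite !lm_D !lm_Z.
  have n1 : nr (lm (mtens T (v x) (w x)) b - lm (mtens T (v y) (w y)) b) < e / 2 / (nr k + 1) by near: y.
  have n2 : nr (lm (mtens T (v x) (w x)) b' - lm (mtens T (v y) (w y)) b') < e / 2 by near: y.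
  move: n1 n2; move: (lm (mtens T (v x) (w x)) b) (lm (mtens T (v x) (w x)) b')
    (lm (mtens T (v y) (w y)) b) (lm (mtens T (v y) (w y)) b') => p p' q q' n1 n2.
  have -> : k *: p + p' - (k *: q + q') = k *: (p - q) + (p' - q') by lmod.
  have := nrD (k *: (p - q)) (p' - q'); rewrite nrZ.
  have : nr k * nr (p - q) < e / 2.
    apply: le_lt_trans (ler_wpM2l (nr_ge0 _) (ltW n1)) _.
    by rewrite mulrC; apply: divS_lt; rewrite ?nr_ge0.
  by lra.
- move=> a c x e e0; pose K := nr a + nr c + 1.
  have K0 : 0 < K by rewrite ltr_wpDl// addr_ge0 ?nr_ge0.
  have eK : 0 < e / K by rewrite divr_gt0.
  have /cont_nr /(_ x _ eK) h1 := vc a; have /cont_nr /(_ x _ eK) h2 := wc c.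
  near=> y; rewrite !lm_mtens//.
  have n1 : nr (lm (v x) a - lm (v y) a) < e / K by near: y.
  have n2 : nr (lm (w x) c - lm (w y) c) < e / K by near: y.
  have -> : tens (T A B) (lm (v x) a) (lm (w x) c) - tens (T A B) (lm (v y) a) (lm (w y) c) =
     tens (T A B) (lm (v x) a - lm (v y) a) (lm (w x) c) +
     tens (T A B) (lm (v y) a) (lm (w x) c - lm (w y) c).
    by rewrite tens_B_l tens_B_r; lmod.
  have m1 : nr (lm (w x) c) <= nr c by rewrite -[leRHS]mul1r; exact: unitary_bnd1.
  have m2 : nr (lm (v y) a) <= nr a by rewrite -[leRHS]mul1r; exact: unitary_bnd1.
  apply: le_lt_trans (nrD _ _) _.
  have l1 : nr (tens (T A B) (lm (v x) a - lm (v y) a) (lm (w x) c)) <= e / K * nr c.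
    apply: le_trans (nr_tens_le _ _ _) _.
    by apply: ler_pM; rewrite ?nr_ge0// ltW.
  have l2 : nr (tens (T A B) (lm (v y) a) (lm (w x) c - lm (w y) c)) <= nr a * (e / K).
    apply: le_trans (nr_tens_le _ _ _) _.
    by apply: ler_pM; rewrite ?nr_ge0// ltW.
  have : e / K * K = e by rewrite divfK// gt_eqF.
  by rewrite /K; move: l1 l2 eK; rewrite /K; move: (e / _) => z; lra.
Unshelve. all: by end_near.
Qed.

Lemma group_hom_ex (B : cstarAlgType R) (v : G -> multiplier B) : unitary_hom v ->
  exists phi : CG -> multiplier B,
    [/\ starhom phi, Defs.nondegenerate phi & forall s, mext phi (u s) = v s].
Proof. by move=> hv; have [phi [h _]] := gunit_universal CG hv; exists phi. Qed.

Lemma group_hom_uniq (B : cstarAlgType R) (phi psi : CG -> multiplier B) :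
  starhom phi -> Defs.nondegenerate phi -> starhom psi -> Defs.nondegenerate psi ->
  forall v, unitary_hom v -> (forall s, mext phi (u s) = v s) -> (forall s, mext psi (u s) = v s) ->
  phi = psi.
Proof.
move=> h1 n1 h2 n2 v hv e1 e2; have [chi [_ hu]] := gunit_universal CG hv.
by rewrite -(hu phi)// -(hu psi).
Qed.

Local Notation dG := (comult T (CG := CG)).

Lemma comultP : [/\ starhom dG, Defs.nondegenerate dG &
  forall s, mext dG (u s) = mtens T (u s) (u s)].
Proof.
have uu := gunit_unitary CG.
have [d hd] := group_hom_ex (unitary_mtens uu uu).
exact: (@xgetPex _ (fun=> 0) [set d | [/\ starhom d, Defs.nondegenerate d &
    forall s, mext d (u s) = mtens T (u s) (u s)]] (ex_intro _ d hd)).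
Qed.

Lemma mext_hom_lm (A B : cstarAlgType R) (phi : A -> multiplier B) m a : starhom phi ->
  Defs.nondegenerate phi -> bd m -> mext phi m ** phi a = phi (lm m a).
Proof. by move=> h n bm; apply: multiplierP => b; exact: lm_mext. Qed.

Lemma trivial_unitary : unitary_hom (fun _ : G => mone (cplx R)).
Proof.
split=> // [s t|s|b].
- by rewrite mul1m.
- by rewrite star1m.
- exact: cst_continuous.
Qed.

(* [eps] is the trivial representation of G. *)
Lemma counit_ex : exists eps : CG -> cplx R, [/\ starhom eps,
  forall s a, eps (lm (u s) a) = eps a & exists c, eps c = 1].
Proof.
have [e1 [h1 n1 v1]] := group_hom_ex trivial_unitary.
pose one : cplx R := (1 : C).
(* A multiplier of the complex numbers is multiplication by its value at 1. *)
have E a : e1 a = membed (lm (e1 a) one).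
  apply: multiplierP => x /=; rewrite -lmA; congr (lm _ _).
  exact/esym/mul1r.
pose eps a := lm (e1 a) one.
have hs : starhom eps.
  have [l m s] := h1; split.
  - by move=> k a b; rewrite /eps l.
  - by move=> a b; apply: membed_inj; rewrite membedM -!E m.
  - by move=> a; apply: membed_inj; rewrite membed_star -!E s.
exists eps; split=> //.
  move=> s a; apply: membed_inj; rewrite -!E -mext_hom_lm//; last exact: bd_u.
  by rewrite v1 mul1m.
(* A nondegenerate homomorphism into the multipliers of a nonzero algebra does not vanish, so some
   value can be scaled to 1. *)
have [[c hc]|h] := pselect (exists c, eps c != 0).
  exists ((eps c : C)^-1 *: c); rewrite (linZ (starhom_linear hs)).
  exact: (mulVf (hc : (eps c : C) != 0)).
exfalso; have e0 a : e1 a = 0.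
  have [e|ne] := eqVneq (eps a) 0; first by rewrite E -/(eps a) e membed0.
  by exfalso; apply: h; exists a.
have : cspan [set x | exists a b, x = lm (e1 a) b] one by rewrite n1.
suff : forall x : cplx R, cspan [set x | exists a b, x = lm (e1 a) b] x -> x = 0.
  by move=> H /H /eqP; rewrite (oner_eq0 C).
apply: cspan_ind => //.
- move=> x hx; apply: nr_small_eq0 => e e0'; have [y -> h2] := hx e e0'.
  by rewrite subr0 in h2; exact: ltW.
- by move=> k x y -> ->; rewrite scaler0 addr0.
- by move=> x [a [b ->]]; rewrite e0.
Qed.

End Group.

(** * Slicing by the trivial representation *)

Section Counit.
Context (R : realType) (G : topGroupType) (CG : group_cstar R G) (T : min_tensors R).
Local Notation C := R[i].
Local Notation u := (gunit CG).
Local Notation dG := (comult T (CG := CG)).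

(** Slices by characters are multiplicative, so id (x) eps can be extended to multipliers. *)
Lemma slice_hom (A D : cstarAlgType R) (eps : D -> cplx R) : starhom eps ->
  starhom (slice T eps : T A D -> A).
Proof.
move=> he; have de : dual (A := D) eps by apply/dual_blin; exact: hom_blin.
have [Sl [K K0 hK]] := slice_blin T A de.
have [s|a d a' d'|a d|F hF FE] := @tens_hom R T A D A (fun a d => (eps d : C) *: a) K K0.
- have := hK (lci (fun p => tens (T A D) p.1 p.2) s).
  rewrite (lci_lin _ _ Sl) /lci; congr (nr _ <= _); apply: eq_bigr => p _ /=.
  by rewrite slice_tens.
- rewrite amulZl amulZr scalerA (starhom_mul he); congr (_ *: _).
- by rewrite starZ (starhom_star he).
have -> : slice T eps = F by apply/funext => t; apply: sliceE => //; exact: hom_blin.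
exact: hF.
Qed.

Variable eps : CG -> cplx R.
Hypotheses (heps : starhom eps) (epsu : forall s a, eps (lm (u s) a) = eps a).
Variable c1 : CG.
Hypothesis epsc1 : eps c1 = 1.

Local Notation Se := (slice T eps).

Let deps : dual (A := CG) eps.
Proof. by apply/dual_blin; exact: hom_blin. Qed.

Lemma Se_tens (A : cstarAlgType R) a c : Se (tens (T A CG) a c) = (eps c : C) *: a.
Proof. exact: slice_tens. Qed.

Lemma Se_onto (A : cstarAlgType R) a : Se (tens (T A CG) a c1) = a.
Proof. by rewrite Se_tens epsc1 scale1r. Qed.

Lemma Se_nondeg (A : cstarAlgType R) : Defs.nondegenerate (fun t : T A CG => membed (Se t)).
Proof.
apply: membed_nondeg; rewrite -subTset => a _; apply: cspan_in.
by exists (tens (T A CG) a c1) => //; exact: Se_onto.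
Qed.

Let hSe (A : cstarAlgType R) : starhom (fun t : T A CG => membed (Se t)).
Proof. exact/hom_membed/slice_hom. Qed.

(* (id (x) eps) o delta_G is the identity, by the uniqueness part of the
   universal property of C*(G). *)
Lemma comult_counit c (t : T CG CG) : Se (lm (dG c) t) = c ** Se t.
Proof.
have [hd nd ud] := comultP CG T.
pose th c := mext (fun t : T CG CG => membed (Se t)) (dG c).
have bd_d a : bd (dG a) by exact: bd_hom.
have hS := hSe CG; have nS := @Se_nondeg CG.
have thE a t' b : lm (th a) (Se t' ** b) = Se (lm (dG a) t') ** b by exact: (lm_mext hS nS).
have hth : starhom th.
  split=> [k a b|a b|a].
  - apply: (mextP hS nS) => [|t' b']; first exact: bd_d.
    rewrite lmD lmZ !thE (starhom_linear hd) lmD lmZ.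
    by rewrite /= (slice_blin T CG deps).1 amulDl amulZl.
  - by rewrite /th (starhom_mul hd) mext_mul.
  - by rewrite /th (starhom_star hd) mext_star.
(* As eps(u_s c) = eps(c), slicing u_s (x) u_s leaves u_s. *)
have uuE s : mext (fun t : T CG CG => membed (Se t)) (mtens T (u s) (u s)) = u s.
  apply: (mextP hS nS) => [|t' b]; first by apply: bd_mtens; exact: bd_u.
  rewrite /= lmA; congr (_ ** _); move: t'.
  have [r _ hr] := bd_mtens T (bd_u CG s) (bd_u CG s).
  have [r' _ hr'] := bd_u CG s.
  apply: tens_eq.
  - exact: blin_comp (slice_blin T CG deps) (blin_lm hr').
  - exact: blin_comp (blin_lm hr) (slice_blin T CG deps).
  by move=> a d; rewrite lm_mtens ?Se_tens ?epsu ?lm_Z//; exact: bd_u.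
have uth s a : u s ** th a = th (lm (u s) a).
  rewrite -{1}(uuE s) /th mext_mul//; last by apply: bd_mtens; exact: bd_u.
  by rewrite -ud mext_hom_lm//; exact: bd_u.
have nth : Defs.nondegenerate th.
  have t1 := nondeg_total nS; have t2 := nondeg_total nd.
  have := @total_nestl R (CG * T CG CG)%type CG (T CG CG) CG (fun p => lm (dG p.1) p.2)
    (fun t b => Se t ** b) t2 t1 (fun b => blin_comp (slice_blin T CG deps) (blin_amulr b)).
  move/total_nondeg; apply=> -[[a t'] b] /=.
  by exists a, (Se t' ** b); rewrite thE.
have E : th = @membed R CG.
  apply: (group_hom_uniq hth nth (@membed_hom R CG) (@membed_id_nondeg R CG) (gunit_unitary CG)).
  - move=> s; apply: (mextP hth nth (bd_u CG s)) => a b.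
    by rewrite -lmM uth.
  - by move=> s; apply: mext_membed_id; exact: bd_u.
apply: amulr_inj => x; rewrite -thE E /=.
exact: amulA.
Qed.

Section Coact.
Variable X : coaction CG T.
Local Notation h := (homtens T (@membed R X) dG).
Local Notation h' := (homtens T (@cdelta _ _ _ _ X) (@membed R CG)).
Local Notation TX := (T X CG).

Let hd := @cdelta_hom _ _ _ _ X.
Let nd := @cdelta_nondeg _ _ _ _ X.

Lemma bd_delta (a : X) : bd (cdelta a).
Proof. exact: bd_hom hd. Qed.

(* Apply id (x) id (x) eps to both sides of the coaction identity. *)
Lemma coact_counit (a : X) t : Se (lm (cdelta a) t) = a ** Se t.
Proof.
have [hdG ndG _] := comultP CG T.
have [hh hE] := homtensP T (@membed_hom R X) hdG.
have nh := homtens_nondeg T (@membed_hom R X) (@membed_id_nondeg R X) hdG ndG.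
have [hh' hE'] := homtensP T hd (@membed_hom R CG).
have nh' := homtens_nondeg T hd nd (@membed_hom R CG) (@membed_id_nondeg R CG).
have [has hasE] := tens_assocP T X CG CG.
have [P hP PE] := tmap_ex T (starhom_id X) (slice_hom CG heps).
have bS (A : cstarAlgType R) : blin (Se : T A CG -> A) by exact: slice_blin.
(* Slicing the last leg after reassociation is P = id (x) Se before it. *)
have SE : forall z, Se (tens_assoc T z) = P z.
  apply: (total_eq (@assoc_total R T X CG CG)).
  - exact: blin_comp (hom_blin has) (bS _).
  - exact: hom_blin.
  by move=> [b [c d]] /=; rewrite hasE PE !Se_tens tens_Z_r.
(* Right-hand side of the coaction identity: by [comult_counit], P undoes id (x) delta_G. *)
have PM z : P (lm (mext h (cdelta a)) z) = lm (cdelta a) (P z).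
  rewrite -{2}(mext_membed_id (bd_delta a)).
  apply: (mext_intertwine hh nh (@membed_hom R _) (@membed_id_nondeg R _) (K := id)) => //.
  - exact: hom_blin.
  - move=> t' w.
    rewrite (homtens_intertwine (phi2 := @membed R X) (psi2 := @membed R CG)
      (k0 := id) (k1 := id) (l0 := id) (l1 := Se) (K := id) (L := P))//.
    + by rewrite (homtens_membed (starhom_id X) (starhom_id CG) (starhom_id (T X CG))).
    + exact: membed_hom.
    + exact: membed_hom.
    + exact: membed_hom.
    + exact: blin_id.
    + exact: hom_blin.
    + exact: comult_counit.
  - exact: bd_delta.
  - exact: bd_delta.
have hass : starhom (fun t : T X (T CG CG) => membed (tens_assoc T t)) by exact: hom_membed.
have nass : Defs.nondegenerate (fun t : T X (T CG CG) => membed (tens_assoc T t)).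
  apply: membed_nondeg; apply: (total_cspan (@assoc_total' R T X CG CG)) => -[[b c] d] /=.
  by exists (tens (T X (T CG CG)) b (tens (T CG CG) c d)).
have bM : bd (mext h (cdelta a)) by apply: bd_mext => //; exact: bd_delta.
have NR w : Se (lm (mext h' (cdelta a)) w) = lm (cdelta a) (Se w).
  rewrite cdelta_coassoc -{2}(mext_membed_id (bd_delta a)).
  apply: (mext_intertwine hass nass (@membed_hom R _) (@membed_id_nondeg R _) (K := P)) => //.
  - by move=> z b /=; rewrite (starhom_mul (slice_hom _ heps)) SE.
  - exact: bd_delta.
(* Left-hand side: slicing the last leg of (delta (x) id)(t') gives delta(Se t'). *)
have S'E t' w : Se (lm (h' t') w) = lm (cdelta (Se t')) (Se w).
  have bdh t2 : bd (h' t2) by exact: bd_hom.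
  move: t'; apply: tens_eq.
  - exact: blin_comp (homm_blin _ hh') (bS _).
  - exact: blin_comp (bS X) (homm_blin _ hd).
  move=> b c; rewrite hE' Se_tens (linZ (starhom_linear hd)) lmZ.
  have [r _ hr] := bd_mtens T (bd_delta b) (bd_membed c).
  have [r' _ hr'] := bd_delta b.
  move: w; apply: tens_eq.
  - exact: blin_comp (blin_lm hr) (bS _).
  - have := blin_comp (bS TX) (blin_scaleD (eps c : C) (blin_lm hr') (blin0 _ _)).
    by under eq_fun do rewrite /= addr0.
  move=> x d; rewrite lm_mtens ?Se_tens ?(starhom_mul heps) ?lm_Z ?scalerA//.
  - exact: bd_delta.
  - exact: bd_membed.
apply: (@cdelta_inj _ _ _ _ X); apply: (mult_eq_total (f := fun w : T TX CG => Se w)).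
  apply: (@cspan_total _ _ _ _ (range (Se : T TX CG -> TX))) => [|y [w _ <-]]; last by exists w.
  by rewrite -subTset => y _; apply: cspan_in; exists (tens (T TX CG) y c1) => //; exact: Se_onto.
move=> w; rewrite -S'E -(lm_mext hh' nh' (bd_delta a)) NR S'E.
by rewrite (starhom_mul hd).
Qed.

(** The form in which the counit serves the quotient: for eps c = 1, slicing delta(a)(1 (x) c)
    recovers a. *)
Lemma coact_counit1 (a : X) c t : membed t = cdelta a ** mtens1 T X c -> Se t = (eps c : C) *: a.
Proof.
move=> ht; apply: amulr_inj => x.
have e : t ** tens TX x c1 = lm (cdelta a) (tens TX x (c ** c1)).
  by have := congr1 (fun m => lm m (tens TX x c1)) ht; rewrite /= lm_mtens1.
have := congr1 (Se : TX -> X) e; rewrite (starhom_mul (slice_hom X heps)) Se_onto => ->.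
rewrite coact_counit Se_tens (starhom_mul heps) epsc1 amulZr amulZl.
congr (_ *: _); exact: mulr1.
Qed.

End Coact.

End Counit.

(** * Coactions on ideals and quotients *)

Section Transfer.
Context (R : realType) (G : topGroupType) (CG : group_cstar R G) (T : min_tensors R).
Local Notation C := R[i].
Local Notation dG := (comult T (CG := CG)).

Section Two.
Variables (A1 A2 : cstarAlgType R).
Variables (d1 : A1 -> multiplier (T A1 CG)) (d2 : A2 -> multiplier (T A2 CG)).
Hypotheses (h1 : starhom d1) (n1 : Defs.nondegenerate d1).
Hypotheses (h2 : starhom d2) (n2 : Defs.nondegenerate d2).
Variables (k0 : A1 -> A2) (K : T A1 CG -> T A2 CG) (K3 : T (T A1 CG) CG -> T (T A2 CG) CG).
Hypotheses (hk : starhom k0) (hK : starhom K) (hK3 : starhom K3).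
Hypothesis KE : forall a c, K (tens (T A1 CG) a c) = tens (T A2 CG) (k0 a) c.
Hypothesis K3E : forall t c, K3 (tens (T (T A1 CG) CG) t c) = tens (T (T A2 CG) CG) (K t) c.
Hypothesis inter : forall a t, K (lm (d1 a) t) = lm (d2 (k0 a)) (K t).

Let bd1' a : bd (d1 a). Proof. exact: bd_hom. Qed.
Let bd2' a : bd (d2 a). Proof. exact: bd_hom. Qed.

(** For an ideal, A1 = I and [K] is the inclusion of I (x) C*(G); for a quotient, A2 = A/I and [K]
    is q (x) id. The coaction identity is pulled back along an injective [K3] in the first case and
    pushed forward along a [K3] of dense range in the second. *)
Lemma coassoc_transfer_left a w :
  K3 (lm (mext (homtens T d1 (@membed R CG)) (d1 a)) w) =
  lm (mext (homtens T d2 (@membed R CG)) (d2 (k0 a))) (K3 w).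
Proof.
have [H1 _] := homtensP T h1 (@membed_hom R CG).
have [H2 _] := homtensP T h2 (@membed_hom R CG).
apply: (mext_intertwine (K := K)) => //.
- exact: (homtens_nondeg T h1 n1 (@membed_hom R CG) (@membed_id_nondeg R CG)).
- exact: (homtens_nondeg T h2 n2 (@membed_hom R CG) (@membed_id_nondeg R CG)).
- exact: hom_blin.
apply: (homtens_intertwine h1 (@membed_hom R CG) h2 (@membed_hom R CG)
   (hom_blin hK) (hom_blin hK3) KE K3E) => //.
Qed.

Lemma coassoc_transfer_right a w :
  K3 (lm (mext (fun t => membed (tens_assoc T t))
      (mext (homtens T (@membed R A1) dG) (d1 a))) w) =
  lm (mext (fun t => membed (tens_assoc T t))
      (mext (homtens T (@membed R A2) dG) (d2 (k0 a)))) (K3 w).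
Proof.
have [hd nd _] := comultP CG T.
have [H1 _] := homtensP T (@membed_hom R A1) hd.
have [H2 _] := homtensP T (@membed_hom R A2) hd.
have m1 := homtens_nondeg T (@membed_hom R A1) (@membed_id_nondeg R A1) hd nd.
have m2 := homtens_nondeg T (@membed_hom R A2) (@membed_id_nondeg R A2) hd nd.
have [a1 e1] := tens_assocP T A1 CG CG.
have [a2 e2] := tens_assocP T A2 CG CG.
have [K' hK' K'E] := tmapl_ex T (T CG CG) hk.
have nas (A : cstarAlgType R) : Defs.nondegenerate (fun t : T A (T CG CG) => membed (tens_assoc T t)).
  apply: membed_nondeg; apply: (total_cspan (@assoc_total' R T A CG CG)) => -[[b c] d] /=.
  exists (tens (T A (T CG CG)) b (tens (T CG CG) c d)) => //.
  by have [_ ->] := tens_assocP T A CG CG.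
have KK z : K3 (tens_assoc T z) = tens_assoc T (K' z).
  move: z; apply: (total_eq (@assoc_total R T A1 CG CG)).
  - exact: blin_comp (hom_blin a1) (hom_blin hK3).
  - exact: blin_comp (hom_blin hK') (hom_blin a2).
  by move=> [b [c d]] /=; rewrite e1 K3E KE K'E e2.
apply: (mext_intertwine (K := K')) => //.
- exact: hom_membed.
- exact: hom_membed.
- exact: hom_blin.
- by move=> z b /=; rewrite (starhom_mul hK3) KK.
- exact: bd_mext.
- exact: bd_mext.
move=> z; apply: (mext_intertwine (K := K)) => //; first exact: hom_blin.
apply: (homtens_intertwine (@membed_hom R A1) hd (@membed_hom R A2) hd
   (hom_blin hK) (hom_blin hK') KE K'E) => //.
by move=> b c /=; rewrite (starhom_mul hk).
Qed.

End Two.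

Section Build.
Variables (A : cstarAlgType R) (d : A -> multiplier (T A CG)).
Hypothesis hd : starhom d.
Hypothesis htilde : forall a c, exists t, membed t = d a ** mtens1 T A c.

Lemma mtens1_star (c : CG) : star (mtens1 T A c) = mtens1 T A (star c).
Proof.
rewrite /mtens1 mtens_star ?star1m ?membed_star//; [exact: bd1|exact: bd_membed].
Qed.

(** The condition on (1 (x) c) delta(a) is the adjoint of that on delta(star a)(1 (x) star c). *)
Lemma build_tilde a : Mtilde T A CG (d a).
Proof.
move=> c; split; first by have [t ht] := htilde a c; exists t.
have [t ht] := htilde (star a) (star c); exists (star t) => //.
by rewrite membed_star ht starM mtens1_star starK (starhom_star hd) starK.
Qed.

Lemma nr_tilde a c t : membed t = d a ** mtens1 T A c -> nr t <= nr a * nr c.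
Proof.
move=> h; apply: bnd_membed_le; first by rewrite mulr_ge0 ?nr_ge0.
rewrite h; apply: bndM; rewrite ?nr_ge0//; first exact: hom_mbnd.
by rewrite -[nr c]mul1r; apply: bnd_mtens; rewrite ?nr_ge0//; [exact: bnd1|exact: bnd_membed].
Qed.

(** Approximating a by a v^*, the element delta(a)(1 (x) c) is close to delta(a) s, where s =
    delta(v^* )(1 (x) c) lies in A (x) C*(G). *)
Lemma build_nondeg :
  cspan [set t : T A CG | exists a c, membed t = d a ** mtens1 T A c] = setT ->
  Defs.nondegenerate d.
Proof.
move=> hD; rewrite /Defs.nondegenerate -subTset => t0 _.
have : cspan [set t : T A CG | exists a c, membed t = d a ** mtens1 T A c] t0 by rewrite hD.
apply: (cspan_map (blin_id _)) => t [a [c ht]]; apply: cspan_lim => e e0.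
have e1 : 0 < e / (nr c + 1) by rewrite divr_gt0// ltr_wpDl ?nr_ge0.
have [v hv] := approx_mul (star a) e1.
have [s hs] := htilde (star v) c.
exists (lm (d a) s); first by apply: cspan_in; exists a, s.
have /nr_tilde h : membed (t - lm (d a) s) = d (a - a ** star v) ** mtens1 T A c.
  rewrite membedB ht -membed_lm hs (linB (starhom_linear hd)) (starhom_mul hd).
  by rewrite amulBl amulA.
apply: le_lt_trans h _; rewrite -nr_star starB starM starK mulrC.
apply: (@le_lt_trans _ _ ((nr c + 1) * nr (star a - v ** star a))).
  by rewrite ler_wpM2r ?nr_ge0// lerDl.
by rewrite mulrC -ltr_pdivlMr// ltr_wpDl// nr_ge0.
Qed.

End Build.

Lemma mtens1_total (A : cstarAlgType R) :
  total (fun p : A * (CG * CG) => tens (T A CG) p.1 (p.2.1 ** p.2.2)).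
Proof.
have tc : total (fun p : CG * CG => p.1 ** p.2).
  apply: cspan_total (@membed_id_nondeg R CG) _ => x [a [b ->]].
  by exists (a, b).
have := @total_nestr R _ _ CG (T A CG) _ (fun a c => tens (T A CG) a c) tc (@tens_total R T A CG).
by apply=> a; exact: blin_tensr.
Qed.

(** The elements (1 (x) c)(a (x) e) are total, because products c e span a dense subspace of
    C*(G). *)
Lemma mtens1_ext (A : cstarAlgType R) (m n : multiplier (T A CG)) :
  (forall c, m ** mtens1 T A c = n ** mtens1 T A c) -> m = n.
Proof.
move=> h; apply: (mult_eq_total (@mtens1_total A)) => -[a [c e]] /=.
by have := congr1 (fun m => lm m (tens (T A CG) a e)) (h c); rewrite /= lm_mtens1.
Qed.

(** By [mtens1_ext] at most one element satisfies the description [Mtilde_ext], so equivariance can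
    be checked on the elements delta(a)(1 (x) c). *)
Lemma coact_hom_ex (X Y : coaction CG T) (phi : X -> Y) (F : T X CG -> T Y CG) :
  starhom phi -> starhom F -> (forall a d, F (tens (T X CG) a d) = tens (T Y CG) (phi a) d) ->
  (forall a c t, membed t = cdelta a ** mtens1 T X c ->
     membed (F t) = cdelta (phi a) ** mtens1 T Y c) ->
  exists f : coact_hom X Y, forall a, f a = phi a.
Proof.
move=> hp hF FE h.
have E a : cdelta (phi a) = Mtilde_ext T phi (cdelta a).
  have HT t : homtens T (fun a => membed (phi a)) (@membed R CG) t = membed (F t).
    exact: (homtens_membed hp (starhom_id CG) hF FE).
  apply/esym; apply: xget_unique.
    split; first exact: cdelta_tilde.
    by move=> c t ht; rewrite HT (h a c t (esym ht)).
  move=> n [_ hn]; apply: mtens1_ext => c; have [t ht] := delta_tilde a c.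
  by rewrite (hn c t (esym ht)) HT (h a c t ht).
by exists (CoactHom hp E).
Qed.

End Transfer.

Section IdealStar.
Context (R : realType) (A : cstarAlgType R) (I : set A).
Hypothesis hI : ideal I.
Local Notation C := R[i].

Lemma ideal_is_sub : is_sub I.
Proof. by split; [exact: ideal0|exact: idealP]. Qed.

(** x is approximated by u x with u self-adjoint in I, so star x is approximated by star x ** u. *)
Lemma ideal_star x : I x -> I (star x).
Proof.
move=> Ix; apply/((closedP I).1 (ideal_closed hI)) => e e0.
have [|u [Iu us _ _ hu]] := @approx_unit R A I [:: x] e hI e0.
  by move=> c; rewrite inE => /eqP ->.
exists (star x ** u); first exact: idealMl.
by rewrite -nr_star starB starK starM starK us hu// mem_head.
Qed.

End IdealStar.

(** * A closed ideal as a C*-algebra *)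

Section IdealAlg.
Context (R : realType) (A : cstarAlgType R) (I : set A).
Hypothesis hI : ideal I.
Local Notation C := R[i].

Definition ialg := subL_of (ideal_is_sub hI).
HB.instance Definition _ := GRing.Lmodule.on ialg.
Implicit Types x y z : ialg.

Definition ival x : A := subv x.
Definition imk a (Ia : I a) : ialg := smk (ideal_is_sub hI) Ia.

Lemma ivalP x : I (ival x). Proof. exact: subvP. Qed.
Lemma ival_inj : injective ival. Proof. exact: subv_inj. Qed.

Definition imul x y := imk (idealMl hI (ival x) (ivalP y)).
Definition istar x := imk (ideal_star hI (ivalP x)).

Fact imulA : associative imul.
Proof. by move=> x y z; apply: ival_inj; exact: amulA. Qed.
Fact imulDl : left_distributive imul +%R.
Proof. by move=> x y z; apply: ival_inj; exact: amulDl. Qed.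
Fact imulDr : right_distributive imul +%R.
Proof. by move=> x y z; apply: ival_inj; exact: amulDr. Qed.
Fact imulZl (k : C) x y : imul (k *: x) y = k *: imul x y.
Proof. by apply: ival_inj; exact: amulZl. Qed.
Fact imulZr (k : C) x y : imul x (k *: y) = k *: imul x y.
Proof. by apply: ival_inj; exact: amulZr. Qed.
Fact istarK : involutive istar.
Proof. by move=> x; apply: ival_inj; exact: starK. Qed.
Fact istarD x y : istar (x + y) = istar x + istar y.
Proof. by apply: ival_inj; exact: starD. Qed.
Fact istarZ (k : C) x : istar (k *: x) = Num.conj k *: istar x.
Proof. by apply: ival_inj; exact: starZ. Qed.
Fact istarM x y : istar (imul x y) = imul (istar y) (istar x).
Proof. by apply: ival_inj; exact: starM. Qed.
HB.instance Definition _ := Lmodule_isStarAlgebra.Build R ialg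
  imulA imulDl imulDr imulZl imulZr istarK istarD istarZ istarM.

Definition inorm x : C := `|ival x|.
Fact inormD x y : inorm (x + y) <= inorm x + inorm y. Proof. exact: ler_normD. Qed.
Fact inormZ (k : C) x : inorm (k *: x) = `|k| * inorm x. Proof. exact: normrZ. Qed.
Fact inorm_eq0 x : inorm x = 0 -> x = 0.
Proof. by move=> /eqP; rewrite normr_eq0 => /eqP h; apply: ival_inj. Qed.
HB.instance Definition _ := Lmodule_isNormed.Build C ialg inormD inormZ inorm_eq0.

Lemma nr_ival x : nr (ival x) = nr x. Proof. by []. Qed.

Fact ialg_complete (u : nat -> ialg) : cau u -> exists l, cvs u l.
Proof.
move=> cu; have [l hl] := @complete_cvs R A (ival \o u) cu.
have Il : I l.
  apply/((closedP I).1 (ideal_closed hI)) => e e0; have [N hN] := hl e e0.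
  by exists (ival (u N)); [exact: ivalP|rewrite nrBC; exact: hN].
by exists (imk Il).
Qed.
HB.instance Definition _ := Uniform_isComplete.Build ialg (seq_complete ialg_complete).

Fact inorm_amul x y : `|x ** y| <= `|x| * `|y|. Proof. exact: (norm_amul (ival x)). Qed.
Fact inorm_star x : `|star x ** x| = `|x| ^+ 2. Proof. exact: (norm_star_amul (ival x)). Qed.
HB.instance Definition _ := StarAlgebra_isCstarAlgebra.Build R ialg inorm_amul inorm_star.

Lemma ival_hom : starhom (ival : ialg -> A). Proof. by []. Qed.

End IdealAlg.

(** * The quotient C*-algebra by a closed ideal *)

Section Quotient.
Context (R : realType) (A : cstarAlgType R) (I : set A).
Hypothesis hI : ideal I.
Local Notation C := R[i].

Definition coset a : set A := [set x | I (x - a)].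
Record qalg_of (h : ideal I) : Type := Qalg { qset : set A; qsetP : exists a, qset = coset a }.
Definition qalg := qalg_of hI.
Implicit Types x y z : qalg.

Definition qmk a : qalg := Qalg hI (ex_intro _ a erefl).

Let I0 : I 0 := ideal0 hI.
Let ID a b : I a -> I b -> I (a + b).
Proof. by move=> h h'; rewrite -[a]scale1r; apply: (idealP hI). Qed.
Let IN a : I a -> I (- a). Proof. exact: (is_subN (ideal_is_sub hI)). Qed.
Let IZ (k : C) a : I a -> I (k *: a). Proof. exact: (is_subZ (ideal_is_sub hI)). Qed.

Lemma qmk_eq a b : qmk a = qmk b <-> I (a - b).
Proof.
split=> [e|h].
  have : qset (qmk a) a by rewrite /= /coset /= subrr.
  by rewrite e.
have e : coset a = coset b.
  apply/seteqP; split=> x; rewrite /coset /= => hx.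
    have -> : x - b = (x - a) + (a - b) by lmod.
    exact: ID.
  have -> : x - a = (x - b) - (a - b) by lmod.
  by apply: ID => //; exact: IN.
rewrite /qmk; move: (ex_intro _ a _) (ex_intro _ b _).
by rewrite -e => p q; congr Qalg; exact: Prop_irrelevance.
Qed.

Lemma qmk_surj x : exists a, x = qmk a.
Proof.
case: x => S [a e]; exists a; subst S.
by rewrite /qmk; congr Qalg; exact: Prop_irrelevance.
Qed.

Definition qrep x : A := proj1_sig (cid (qmk_surj x)).
Lemma qrepK x : qmk (qrep x) = x.
Proof. exact: esym (proj2_sig (cid (qmk_surj x))). Qed.
Lemma qrepP a : I (qrep (qmk a) - a). Proof. by apply/qmk_eq; exact: qrepK. Qed.

HB.instance Definition _ := gen_eqMixin qalg.
HB.instance Definition _ := gen_choiceMixin qalg.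

Definition qadd x y := qmk (qrep x + qrep y).
Definition qopp x := qmk (- qrep x).
Definition qscale (k : C) x := qmk (k *: qrep x).
Definition qmul x y := qmk (qrep x ** qrep y).
Definition qstar x := qmk (star (qrep x)).

Lemma qaddE a b : qadd (qmk a) (qmk b) = qmk (a + b).
Proof.
apply/qmk_eq; have -> : qrep (qmk a) + qrep (qmk b) - (a + b) =
  (qrep (qmk a) - a) + (qrep (qmk b) - b) by lmod.
by apply: ID; exact: qrepP.
Qed.
Lemma qoppE a : qopp (qmk a) = qmk (- a).
Proof.
apply/qmk_eq; have -> : - qrep (qmk a) - - a = - (qrep (qmk a) - a) by lmod.
by apply: IN; exact: qrepP.
Qed.
Lemma qscaleE (k : C) a : qscale k (qmk a) = qmk (k *: a).
Proof. by apply/qmk_eq; rewrite -scalerBr; apply: IZ; exact: qrepP. Qed.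
Lemma qmulE a b : qmul (qmk a) (qmk b) = qmk (a ** b).
Proof.
apply/qmk_eq; have -> : qrep (qmk a) ** qrep (qmk b) - a ** b =
  (qrep (qmk a) - a) ** qrep (qmk b) + a ** (qrep (qmk b) - b).
  by rewrite !amulE; lmod.
by apply: ID; [apply: (Defs.idealMr hI)|apply: (idealMl hI)]; exact: qrepP.
Qed.
Lemma qstarE a : qstar (qmk a) = qmk (star a).
Proof. by apply/qmk_eq; rewrite -starB; apply: ideal_star => //; exact: qrepP. Qed.

Let qE := (qaddE, qoppE, qscaleE, qmulE, qstarE).
Ltac qlift := repeat (let x := fresh "x" in move=> x; case: (qmk_surj x) => ? ->; clear x).

Fact qaddA : associative qadd.
Proof. by qlift; rewrite !qE addrA. Qed.
Fact qaddC : commutative qadd.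
Proof. by qlift; rewrite !qE addrC. Qed.
Fact qadd0 : left_id (qmk 0) qadd.
Proof. by qlift; rewrite !qE add0r. Qed.
Fact qaddN : left_inverse (qmk 0) qopp qadd.
Proof. by qlift; rewrite !qE addNr. Qed.
HB.instance Definition _ := GRing.isZmodule.Build qalg qaddA qaddC qadd0 qaddN.
Fact qscaleA (k l : C) x : qscale k (qscale l x) = qscale (k * l) x.
Proof. by move: x; qlift; rewrite !qE scalerA. Qed.
Fact qscale1 : left_id 1 qscale.
Proof. by qlift; rewrite !qE scale1r. Qed.
Fact qscaleDr : right_distributive qscale +%R.
Proof.
move=> k x y; change (qscale k (qadd x y) = qadd (qscale k x) (qscale k y)).
by move: x y; qlift; rewrite !qE scalerDr.
Qed.
Fact qscaleDl x : {morph qscale^~ x : k l / k + l}.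
Proof.
move=> k l; change (qscale (k + l) x = qadd (qscale k x) (qscale l x)).
by move: x; qlift; rewrite !qE scalerDl.
Qed.
HB.instance Definition _ := GRing.Zmodule_isLmodule.Build C qalg
  qscaleA qscale1 qscaleDr qscaleDl.

Lemma qmkD a b : qmk (a + b) = qmk a + qmk b. Proof. exact: esym (qaddE a b). Qed.
Lemma qmkZ (k : C) a : qmk (k *: a) = k *: qmk a. Proof. exact: esym (qscaleE k a). Qed.
Lemma qmk_lin : linear qmk. Proof. by move=> k a b; rewrite qmkD qmkZ. Qed.

Fact qmulA : associative qmul.
Proof. by qlift; rewrite !qE amulA. Qed.
Fact qmulDl : left_distributive qmul +%R.
Proof. by qlift; rewrite -qmkD !qE amulDl qmkD. Qed.
Fact qmulDr : right_distributive qmul +%R.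
Proof. by qlift; rewrite -qmkD !qE amulDr qmkD. Qed.
Fact qmulZl (k : C) x y : qmul (k *: x) y = k *: qmul x y.
Proof. by move: x y; qlift; rewrite -qmkZ !qE amulZl qmkZ. Qed.
Fact qmulZr (k : C) x y : qmul x (k *: y) = k *: qmul x y.
Proof. by move: x y; qlift; rewrite -qmkZ !qE amulZr qmkZ. Qed.
Fact qstarK : involutive qstar.
Proof. by qlift; rewrite !qE starK. Qed.
Fact qstarD x y : qstar (x + y) = qstar x + qstar y.
Proof. by move: x y; qlift; rewrite -qmkD !qE starD qmkD. Qed.
Fact qstarZ (k : C) x : qstar (k *: x) = Num.conj k *: qstar x.
Proof. by move: x; qlift; rewrite -qmkZ !qE starZ qmkZ. Qed.
Fact qstarM x y : qstar (qmul x y) = qmul (qstar y) (qstar x).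
Proof. by move: x y; qlift; rewrite !qE starM. Qed.
HB.instance Definition _ := Lmodule_isStarAlgebra.Build R qalg
  qmulA qmulDl qmulDr qmulZl qmulZr qstarK qstarD qstarZ qstarM.

Lemma qmkM a b : qmk (a ** b) = qmk a ** qmk b. Proof. exact: esym (qmulE a b). Qed.
Lemma qmk_star a : qmk (star a) = star (qmk a). Proof. exact: esym (qstarE a). Qed.
Lemma qmk_hom : starhom qmk.
Proof. by split; [exact: qmk_lin|exact: qmkM|exact: qmk_star]. Qed.

Lemma qmk_eq0 a : qmk a = 0 <-> I a.
Proof. by rewrite -[0]/(qmk 0) qmk_eq subr0. Qed.

Let S x : set R := [set r | exists2 a, x = qmk a & r = nr a].
Definition qn x : R := inf (S x).

Let S0 x : S x !=set0.
Proof. by have [a ->] := qmk_surj x; exists (nr a), a. Qed.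
Let Slb x : has_lbound (S x).
Proof. by exists 0 => _ [a _ ->]; exact: nr_ge0. Qed.
Lemma qn_le a : qn (qmk a) <= nr a.
Proof. by apply: ge_inf; [exact: Slb|exists a]. Qed.
Lemma qn_ge0 x : 0 <= qn x.
Proof. by apply: lb_le_inf => // _ [a _ ->]; exact: nr_ge0. Qed.
Lemma qn_adh x (e : R) : 0 < e -> exists2 a, x = qmk a & nr a < qn x + e.
Proof.
move=> e0; have [_ [a h ->] h'] := inf_adherent e0 (conj (S0 x) (Slb x)).
by exists a.
Qed.

Lemma qnD x y : qn (x + y) <= qn x + qn y.
Proof.
apply: (@le_eps _ _ _ 2) => e e0.
have [a -> ha] := qn_adh x e0; have [b -> hb] := qn_adh y e0.
rewrite -qmkD; apply: le_trans (qn_le _) _.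
by have := nrD a b; have := qn_le a; lra.
Qed.

Let qnZ_le (k : C) x : qn (k *: x) <= nr k * qn x.
Proof.
apply: (@le_eps _ _ _ (nr k)) => e e0; have [a -> ha] := qn_adh x e0.
rewrite -qmkZ; apply: le_trans (qn_le _) _; rewrite nrZ -mulrDr ler_wpM2l ?nr_ge0//.
exact: ltW.
Qed.

Lemma qnZ (k : C) x : qn (k *: x) = nr k * qn x.
Proof.
apply/le_anti; rewrite qnZ_le /=.
have [->|k0] := eqVneq k 0; first by rewrite nr0 mul0r qn_ge0.
have nk : 0 < nr k.
  by rewrite lt_def nr_ge0 andbT; apply: contra_neq k0; exact: nr_eq0.
have := qnZ_le k^-1 (k *: x); rewrite scalerA mulVf// scale1r.
have -> : nr k^-1 = (nr k)^-1.
  by apply: (mulfI (lt0r_neq0 nk)); rewrite -nrM !mulfV ?nr1// gt_eqF.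
by rewrite mulrC ler_pdivlMr// mulrC.
Qed.

Lemma qn_eq0 x : qn x = 0 -> x = 0.
Proof.
have [a ->] := qmk_surj x => h; apply/qmk_eq0.
apply/((closedP I).1 (ideal_closed hI)) => e e0.
have [b /qmk_eq ab hb] := qn_adh (qmk a) e0; exists (a - b) => //.
by move: hb; rewrite h add0r; have -> : a - (a - b) = b by lmod.
Qed.

Definition qnorm x : C := (qn x)%:C%C.
Fact qnormD x y : qnorm (x + y) <= qnorm x + qnorm y.
Proof. by rewrite /qnorm -rmorphD lecR qnD. Qed.
Fact qnormZ (k : C) x : qnorm (k *: x) = `|k| * qnorm x.
Proof. by rewrite /qnorm qnZ rmorphM /= -nrE. Qed.
Fact qnorm_eq0 x : qnorm x = 0 -> x = 0.
Proof. by move=> /complexI; exact: qn_eq0. Qed.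
HB.instance Definition _ := Lmodule_isNormed.Build C qalg qnormD qnormZ qnorm_eq0.

Lemma nr_qn x : nr x = qn x. Proof. by []. Qed.

Let fast_cau (x : nat -> A) : (forall k, nr (x k.+1 - x k) <= 2^-1 ^+ k) -> cau x.
Proof.
move=> hx; pose q : R := 2^-1.
have q0 k : 0 <= q ^+ k by rewrite exprn_ge0// invr_ge0.
have B n k : nr (x (n + k)%N - x n) <= 2 * q ^+ n - 2 * q ^+ (n + k)%N.
  elim: k => [|k IH]; first by rewrite addn0 !subrr nr0.
  have := nr_tri (x (n + k)%N) (x (n + k).+1) (x n); rewrite addnS.
  have := hx (n + k)%N; rewrite -/q.
  have -> : q ^+ (n + k).+1 = q ^+ (n + k)%N / 2 by rewrite exprS mulrC.
  by move: IH; move: (nr _) (nr _) (nr _) => *; lra.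
move=> e e0; have e4 : 0 < e / 4 by rewrite divr_gt0.
have [N hN] := iv_small e4; exists N => m n Nm Nn.
have D p : (N <= p)%N -> nr (x p - x N) < e / 2.
  move=> Np; have := B N (p - N)%N; rewrite subnKC// => /le_lt_trans; apply.
  have h1 : q ^+ N <= iv R N.
    by rewrite /q /iv exprVn lef_pV2 ?posrE ?exprn_gt0// -natrX ler_nat ltn_expl.
  by have := q0 p; lra.
have := nr_tri (x N) (x m) (x n); rewrite (nrBC (x N)).
by have := D m Nm; have := D n Nn; lra.
Qed.

(** Along a subsequence with gaps below 2^-k each term is lifted within 2^-k of the lift of its
    predecessor. The lifts are Cauchy by [fast_cau], and the class of their limit is the limit
    sought. *)
Fact qalg_complete (u : nat -> qalg) : cau u -> exists l, cvs u l.
Proof.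
move=> cu; pose q : R := 2^-1.
have q0 k : 0 < q ^+ k by rewrite exprn_gt0// invr_gt0.
have /choice[N0 hN0] : forall k, exists N, forall m n, (N <= m)%N -> (N <= n)%N -> nr (u m - u n) < q ^+ k.
  by move=> k; exact: cu.
pose N := fix N k := if k is k'.+1 then maxn (N k').+1 (N0 k) else N0 0%N.
have NS k : (N k <= N k.+1)%N by rewrite /= (leq_trans (leqnSn _))// leq_maxl.
have kN k : (k <= N k)%N.
  by elim: k => // k IH /=; rewrite (leq_trans _ (leq_maxl _ _)).
have N0N k : (N0 k <= N k)%N by case: k => //= k; rewrite leq_maxr.
have step k a : u (N k) = qmk a -> exists b, u (N k.+1) = qmk b /\ nr (b - a) <= q ^+ k.
  move=> e; have h := hN0 k _ _ (leq_trans (N0N k) (NS k)) (N0N k).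
  have d0 : 0 < q ^+ k - nr (u (N k.+1) - u (N k)) by rewrite subr_gt0.
  have [c hc hn] := qn_adh (u (N k.+1) - u (N k)) d0.
  exists (c + a); split; first by rewrite qmkD -hc -e subrK.
  by rewrite addrK; move: hn; rewrite -nr_qn; move: (nr _) (nr _) => r s; lra.
have [a0 ha0] := qmk_surj (u (N 0%N)).
(* One lifting step as a total function of index and current lift, with junk value 0 off the
   sequence, so that it can be iterated. *)
have /choice[F hF] : forall p : nat * A, exists b, u (N p.1) = qmk p.2 ->
    u (N p.1.+1) = qmk b /\ nr (b - p.2) <= q ^+ p.1.
  move=> [k a]; have [e|ne] := pselect (u (N k) = qmk a).
    by have [b hb] := step k a e; exists b.
  by exists 0.
pose x := fix x k := if k is k'.+1 then F (k', x k') else a0.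
have hx k : u (N k) = qmk (x k).
  by elim: k => // k IH; have [] := hF (k, x k) IH.
have cx : cau x by apply: fast_cau => k; have [] := hF (k, x k) (hx k).
have [l hl] := complete_cvs cx; exists (qmk l) => e e0.
have e2 : 0 < e / 2 by rewrite divr_gt0.
have [M hM] := hl _ e2; have [K hK] := cu _ e2.
exists K => n Kn; pose k := maxn M K.
have Kk : (K <= N k)%N.
  by apply: leq_trans (leq_maxr M K) _; exact: kN.
have := hK n (N k) Kn Kk; have := hM k (leq_maxl M K).
have : nr (u (N k) - qmk l) <= nr (x k - l).
  by rewrite hx -(linB qmk_lin); exact: qn_le.
by have := nr_tri (u (N k)) (u n) (qmk l); lra.
Qed.
HB.instance Definition _ := Uniform_isComplete.Build qalg (seq_complete qalg_complete).

Lemma qnM x y : qn (x ** y) <= qn x * qn y.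
Proof.
have h e : 0 < e -> qn (x ** y) <= (qn x + e) * (qn y + e).
  move=> e0; have [a -> ha] := qn_adh x e0; have [b -> hb] := qn_adh y e0.
  rewrite -qmkM; apply: le_trans (qn_le _) _; apply: le_trans (nr_amul _ _) _.
  by apply: ler_pM; rewrite ?nr_ge0 ?ltW.
apply: (@le_eps _ _ _ (qn x + qn y + 1)) => d d0.
wlog d1 : d d0 / d <= 1.
  move=> hw; have [|d1] := leP d 1; first exact: hw.
  apply: le_trans (hw 1 ltr01 (lexx _)) _; rewrite lerD2l ler_wpM2l ?(ltW d1)//.
  by rewrite !addr_ge0 ?qn_ge0.
apply: le_trans (h d d0) _; have : d * d <= d * 1 by rewrite ler_wpM2l// ltW.
by rewrite mulrDl !mulrDr; lra.
Qed.

Let qn_star_le x : qn (star x) <= qn x.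
Proof.
apply: (@le_eps _ _ _ 1) => e e0; rewrite mul1r; have [a -> ha] := qn_adh x e0.
by rewrite -qmk_star; apply: le_trans (qn_le _) _; rewrite nr_star ltW.
Qed.

(* With an approximate unit u of I, |a - a u|^2 = |(1 - u) a* a (1 - u)| where
   a* a may be altered by elements of I. *)
Lemma qn_cstar x : qn (star x ** x) = qn x ^+ 2.
Proof.
apply/le_anti/andP; split.
  rewrite expr2; apply: le_trans (qnM _ _) _.
  by rewrite ler_wpM2r ?qn_ge0.
apply: (@le_eps _ _ _ 2) => e e0; have [a ->] := qmk_surj x.
rewrite -qmk_star -qmkM; have [b /qmk_eq hb hbn] := qn_adh (qmk (star a ** a)) e0.
set i := _ - _ in hb.
have [|v [Iv vs v1 _ hv]] := @approx_unit R A I [:: i] e hI e0.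
  by move=> c; rewrite inE => /eqP ->.
have {}hv : nr (i - v ** i) < e by apply: hv; rewrite mem_head.
have L (y : A) : lm (mone A - membed v) y = y - v ** y by rewrite lmB.
have bl (y : A) : nr (y - v ** y) <= nr y by rewrite -L -[leRHS]mul1r; exact: v1.
have br (y : A) : nr (y - y ** v) <= nr y.
  by rewrite -nr_star starB starM vs -(nr_star y) bl.
have -> : qmk a = qmk (a - a ** v).
  apply/qmk_eq; have -> : a - (a - a ** v) = a ** v by lmod.
  exact: idealMl.
have h1 : qn (qmk (a - a ** v)) ^+ 2 <= nr (a - a ** v) ^+ 2.
  by rewrite ler_sqr ?nnegrE ?qn_ge0 ?nr_ge0// qn_le.
apply: le_trans h1 _; rewrite -nr_star_amul.
have -> : star (a - a ** v) ** (a - a ** v) =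
   (b - v ** b) - (b - v ** b) ** v + ((i - v ** i) - (i - v ** i) ** v).
  have e2 : star a ** a = b + i by rewrite /i; lmod.
  have -> : star (a - a ** v) ** (a - a ** v) =
      star a ** a - v ** (star a ** a) - (star a ** a - v ** (star a ** a)) ** v.
    by rewrite starB starM vs !amulBl !amulBr !amulA; lmod.
  by rewrite e2; clearbody i; rewrite !(amulDr, amulDl, amulNl); lmod.
apply: le_trans (nrD _ _) _.
have := br (b - v ** b); have := bl b; have := br (i - v ** i).
by lra.
Qed.

Fact qnorm_amul x y : `|x ** y| <= `|x| * `|y|.
Proof. by rewrite !nrE -rmorphM lecR; exact: qnM. Qed.
Fact qnorm_star x : `|star x ** x| = `|x| ^+ 2.
Proof. by rewrite !nrE -rmorphXn; congr _%:C%C; exact: qn_cstar. Qed.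
HB.instance Definition _ := StarAlgebra_isCstarAlgebra.Build R qalg qnorm_amul qnorm_star.

End Quotient.

(** * Isometric homomorphisms and restriction of multipliers *)

Section Sub.
Context (R : realType).
Local Notation C := R[i].

Lemma isom_inj (A B : cstarAlgType R) (K : A -> B) : starhom K -> (forall a, nr (K a) = nr a) -> injective K.
Proof.
move=> hK iK x y e; apply/eqP; rewrite -subr_eq0; apply/eqP/nr_eq0.
by rewrite -iK (linB (starhom_linear hK)) e subrr nr0.
Qed.

Lemma isom_range (A B : cstarAlgType R) (K : A -> B) : starhom K -> (forall a, nr (K a) = nr a) ->
  forall y, (forall e : R, 0 < e -> exists x, nr (y - K x) < e) -> exists x, K x = y.
Proof.
move=> hK iK y hy; have lK := starhom_linear hK.
have /choice[x hx] : forall n : nat, exists x, nr (y - K x) < iv R n by move=> n; apply: hy; exact: iv_gt0.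
have cy : cvs (fun n => K (x n)) y.
  move=> e e0; have [N hN] := iv_small e0; exists N => n Nn.
  by rewrite nrBC; apply: lt_trans (hx n) _; apply: le_lt_trans (iv_le R Nn) hN.
have [l hl] : exists l, cvs x l.
  apply: complete_cvs => e e0; have [N hN] := cvs_cau cy e0; exists N => m n Nm Nn.
  by rewrite -iK (linB lK); exact: hN.
exists l; apply: cvs_uniq cy.
by apply: (@cvs_lip R _ _ _ 1) hl => a b; rewrite mul1r -(linB lK) iK.
Qed.

Lemma isom_cspan_range (A B : cstarAlgType R) (K : A -> B) : starhom K -> (forall a, nr (K a) = nr a) ->
  forall y, cspan (range K) y -> exists x, K x = y.
Proof.
move=> hK iK y /cspanP h; apply: (isom_range hK iK) => e e0; have [s [hs hx]] := h e e0.
suff [x hx'] : exists x, K x = lci id s by exists x; rewrite hx'.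
elim: s hs {hx} => [|p s IH] hs.
  by exists 0; rewrite /lci big_nil (lin0 (starhom_linear hK)).
have [x hx] : exists x, K x = lci id s.
  by apply: IH => q qs; apply: hs; rewrite in_cons qs orbT.
have [v _ hv] := hs p (mem_head _ _); exists (p.1 *: v + x).
by rewrite (starhom_linear hK) hx /lci big_cons hv.
Qed.

(** K a is close to v K a, and m (v K a) = (m v) K a lies in the range of K by the ideal property;
    that range is closed because K is isometric. The adjoint of m restricts likewise. *)
Lemma restrict_ex (A B : cstarAlgType R) (K : A -> B) (m : multiplier B) :
  starhom K -> (forall a, nr (K a) = nr a) ->
  (forall b a, exists a', K a' = b ** K a) -> bd m ->
  exists k : multiplier A, forall a, K (lm k a) = lm m (K a).
Proof.
move=> hK iK idl bm.
have H n : bd n -> forall a, exists a', K a' = lm n (K a).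
  move=> [r r0 hn] a; apply: (isom_range hK iK) => e e0.
  have e1 : 0 < e / (r + 1) by rewrite divr_gt0// ltr_wpDl.
  have [v hv] := approx_mul (K a) e1.
  have [a' ha'] := idl (lm n v) a; exists a'.
  rewrite ha' -lmA -lm_B; apply: le_lt_trans (hn _) _; rewrite mulrC.
  apply: (@le_lt_trans _ _ (nr (K a - v ** K a) * (r + 1))).
    by rewrite ler_wpM2l ?nr_ge0// lerDl.
  by rewrite -ltr_pdivlMr// ltr_wpDl.
have [L hL] := choice (H m bm); have [L' hL'] := choice (H _ (bd_star bm)).
have cent x y : x ** L y = star (L' (star x)) ** y.
  apply: (isom_inj hK iK); rewrite !(starhom_mul hK) (starhom_star hK) hL hL'.
  by rewrite (starhom_star hK) -lm_star starK.
by exists (Multiplier cent).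
Qed.

Lemma isom_cspan (V W : normedModType C) (K : V -> W) (S : set V) x : linear K ->
  (forall v, nr (K v) = nr v) -> cspan (K @` S) (K x) -> cspan S x.
Proof.
move=> lK iK /cspanP h; apply/cspanP => e e0; have [s [hs hx]] := h e e0.
suff [s' [h1 h2]] : exists s' : seq (C * V), (forall p, p \in s' -> S p.2) /\ K (lci id s') = lci id s.
  by exists s'; split=> //; rewrite -iK (linB lK) h2.
elim: s hs {hx} => [|p s IH] hs; first by exists [::]; rewrite /lci !big_nil (lin0 lK).
have [s' [h1 h2]] : exists s' : seq (C * V), (forall p, p \in s' -> S p.2) /\ K (lci id s') = lci id s.
  by apply: IH => q qs; apply: hs; rewrite in_cons qs orbT.
have [v Sv hv] := hs p (mem_head _ _).
exists ((p.1, v) :: s'); split.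
  by move=> q; rewrite in_cons => /orP[/eqP -> //|]; exact: h1.
by rewrite /lci !big_cons -!/(lci _ _) lK h2 /= hv.
Qed.

End Sub.

(** * The coaction on a strongly invariant ideal *)

Section IdealCoaction.
Context (R : realType) (G : topGroupType) (CG : group_cstar R G) (T : min_tensors R).
Variables (X : coaction CG T) (I : set X).
Hypotheses (hI : ideal I) (sI : strongly_invariant I).
Local Notation C := R[i].
Local Notation J := (ialg hI).
Local Notation iota := (@ival _ _ _ hI).

Let hd := @cdelta_hom _ _ _ _ X.

(** I (x) C*(G) sits isometrically in A (x) C*(G) by [tmap_isom]; products of elementary tensors
    show that its closed range absorbs left multiplication. *)
Lemma ideal_tens_ex : exists K : T J CG -> T X CG, [/\ starhom K,
  forall a c, K (tens (T J CG) a c) = tens (T X CG) (iota a) c,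
  forall t, nr (K t) = nr t &
  forall s t, exists t', K t' = s ** K t].
Proof.
have [K hK KE] := tmapl_ex T CG (@ival_hom _ _ _ hI).
have iK := @tmap_isom R T J CG X iota K (@ival_hom _ _ _ hI) (@nr_ival _ _ _ hI) hK KE.
exists K; split=> // s t; apply: (isom_cspan_range hK iK).
have : cspan [set x | exists a c, x = tens (T J CG) a c] t by rewrite tens_dense.
apply: (cspan_map (blin_comp (hom_blin hK) (blin_amull s))) => _ [a [c ->]] /=.
have : cspan [set x | exists b d, x = tens (T X CG) b d] s by rewrite tens_dense.
apply: (cspan_map (blin_amulr (K (tens (T J CG) a c)))) => _ [b [d ->]].
apply: cspan_in; rewrite KE tens_mul.
have Ib : I (b ** iota a) by apply: (idealMl hI); exact: ivalP.
by exists (tens (T J CG) (imk hI Ib) (d ** c)); rewrite ?KE.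
Qed.

Lemma ideal_coaction : exists (Y : coaction CG T) (f : coact_hom Y X),
  injective f /\ range f = I.
Proof.
have [K [hK KE iK idl]] := ideal_tens_ex.
have injK := isom_inj hK iK.
have bdX a : bd (cdelta (a : X)) by exact: bd_delta.
have /choice[dJ hdJ] : forall a : J, exists k : multiplier (T J CG),
    forall w, K (lm k w) = lm (cdelta (iota a)) (K w).
  by move=> a; exact: restrict_ex.
have hJ : starhom dJ.
  split.
  - move=> k a b; apply: multiplierP => w; apply: injK.
    rewrite hdJ lmD lmZ (starhom_linear hK) !hdJ.
    by rewrite -lmZ -lmD -(starhom_linear hd).
  - move=> a b; apply: multiplierP => w; apply: injK.
    by rewrite lmM !hdJ -lmM -(starhom_mul hd).
  - move=> a; apply: multiplierP => w; apply: amull_inj => x.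
    rewrite -[x]starK; move: (star x) => y; rewrite [RHS]lm_star starK; apply: injK.
    rewrite !(starhom_mul hK) !(starhom_star hK) !hdJ.
    by rewrite (starhom_star (@ival_hom _ _ _ hI)) (starhom_star hd) lm_star starK.
have KM c w : K (lm (mtens1 T J c) w) = lm (mtens1 T X c) (K w).
  have [r _ h1] := bd_mtens1 T J c; have [r' _ h2] := bd_mtens1 T X c.
  move: w; apply: tens_eq; [exact: blin_comp (blin_lm h1) (hom_blin hK)|exact: blin_comp (hom_blin hK) (blin_lm h2)|].
  by move=> a d; rewrite lm_mtens1 !KE lm_mtens1.
(* strong invariance puts delta(a)(1 (x) c) in the range of K *)
have res (a : J) c t : membed t = cdelta (iota a) ** mtens1 T X c ->
    exists2 t', K t' = t & membed t' = dJ a ** mtens1 T J c.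
  move=> ht; have [t' ht'] : exists t', K t' = t.
    apply: (isom_cspan_range hK iK).
    have : cspan [set t : T X CG | exists a c, I a /\ t = tens (T X CG) a c] t.
      by rewrite -sI; apply: cspan_in; exists (iota a), c; split=> //; exact: ivalP.
    apply: (cspan_map (blin_id _)) => _ [b [d [Ib ->]]]; apply: cspan_in.
    by exists (tens (T J CG) (imk hI Ib) d) => //; rewrite KE.
  exists t' => //; apply: multiplierP => w; apply: injK.
  by rewrite lmM hdJ KM -lmM -ht -ht' /= (starhom_mul hK).
have tilde (a : J) c : exists t, membed t = dJ a ** mtens1 T J c.
  have [t ht] := delta_tilde (iota a) c; have [t' _ h] := res a c t ht.
  by exists t'.
have dense : cspan [set t : T J CG | exists a c, membed t = dJ a ** mtens1 T J c] = setT.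
  rewrite -subTset => w _; apply: (isom_cspan (starhom_linear hK) iK).
  have : cspan [set t : T X CG | exists a c, I a /\ membed t = cdelta a ** mtens1 T X c] (K w).
    rewrite sI; have : cspan [set x | exists a c, x = tens (T J CG) a c] w by rewrite tens_dense.
    apply: (cspan_map (hom_blin hK)) => _ [a [c ->]]; apply: cspan_in.
    by exists (iota a), c; split; [exact: ivalP|rewrite KE].
  apply: (cspan_map (blin_id _)) => t [a [c [Ia ht]]]; apply: cspan_in.
  have [t' h1 h2] := res (imk hI Ia) c t ht; exists t' => //.
  by exists (imk hI Ia), c.
(* delta(a) kills the range of K. For b in I that range contains delta(b)(1 (x) c), so delta(a b) =
   0 and a b = 0; then b = a^* is taken. *)
have injJ0 a : dJ a = 0 -> a = 0.
  move=> a0; apply: (@ival_inj _ _ _ hI).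
  have z w : lm (cdelta (iota a)) (K w) = 0.
    by rewrite -hdJ a0 lm_zero (lin0 (starhom_linear hK)).
  have zb (b : J) : iota a ** iota b = 0.
    apply: (@cdelta_inj _ _ _ _ X); rewrite (starhom_mul hd) (lin0 (@lin_delta _ _ _ _ X)).
    apply: mtens1_ext => c; rewrite amul0l -amulA.
    have [t ht] := delta_tilde (iota b) c; have [t' h1 h2] := res b c t ht.
    rewrite -ht -h1; apply: multiplierP => s /=.
    rewrite lmA z amul0l //.
  apply: nr_eq0; apply/eqP; rewrite -sqrf_eq0 -nr_amul_star.
  by rewrite (zb (star a)) nr0.
have injJ : injective dJ.
  move=> a b e; apply/eqP; rewrite -subr_eq0; apply/eqP/injJ0.
  by rewrite (linB (starhom_linear hJ)) e subrr.
have nJ := build_nondeg hJ tilde dense.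
have [K3 hK3 K3E] := tmapl_ex T CG hK.
have iK3 := tmap_isom (@hK) iK hK3 K3E.
have coassoc a : mext (homtens T dJ (@membed R CG)) (dJ a) =
    mext (fun t => membed (tens_assoc T t)) (mext (homtens T (@membed R J) (comult T (CG := CG))) (dJ a)).
  apply: multiplierP => w; apply: (isom_inj hK3 iK3).
  rewrite (coassoc_transfer_left hJ nJ hd (@cdelta_nondeg _ _ _ _ X) hK hK3 KE K3E hdJ).
  rewrite (coassoc_transfer_right hJ hd (@ival_hom _ _ _ hI) hK hK3 KE K3E hdJ).
  by rewrite cdelta_coassoc.
pose Y := Coaction hJ injJ nJ (build_tilde hJ tilde) coassoc dense.
have [|f hf] := @coact_hom_ex _ _ _ _ Y X iota K (@ival_hom _ _ _ hI) hK KE.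
  move=> a c t ht; have [s hs] := delta_tilde (iota a) c; have [t' h1 h2] := res a c s hs.
  by rewrite -hs -h1; congr membed; congr K; apply: membed_inj; rewrite ht.
exists Y, f; split.
  by move=> a b; rewrite !hf; exact: ival_inj.
apply/seteqP; split=> [_ [a _ <-]|x Ix]; first by rewrite hf; exact: ivalP.
by exists (imk hI Ix) => //; rewrite hf.
Qed.

End IdealCoaction.

(** * The coaction on the quotient by a strongly invariant ideal *)

Section QuotientCoaction.
Context (R : realType) (G : topGroupType) (CG : group_cstar R G) (T : min_tensors R).
Variables (X : coaction CG T) (I : set X).
Hypotheses (hI : ideal I) (sI : strongly_invariant I).
Local Notation C := R[i].
Local Notation B := (qalg hI).
Local Notation q := (qmk hI).

Let hd := @cdelta_hom _ _ _ _ X.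

Lemma quotient_coaction : exists (Y : coaction CG T) (f : coact_hom X Y),
  [set a | f a = 0] = I /\ range f = setT.
Proof.
have hq := qmk_hom hI; have [Q hQ QE] := tmapl_ex T CG hq.
have qs b : exists a, b = q a := qmk_surj b.
have QT : cspan (range Q) = setT.
  apply: (total_cspan (@tens_total R T B CG)) => -[b c] /=.
  by have [a ->] := qs b; exists (tens (T X CG) a c) => //; rewrite QE.
have tQ : total Q by apply: (cspan_total QT) => _ [t _ <-]; exists t.
have hmQ : starhom (fun t => membed (Q t)) by exact: hom_membed.
have nQ : Defs.nondegenerate (fun t => membed (Q t)) by exact: membed_nondeg.
pose ext := mext (fun t => membed (Q t)).
have extE m t : bd m -> lm (ext m) (Q t) = Q (lm m t).
  move=> bm; apply: amulr_inj => b; rewrite -lmA.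
  exact: (lm_mext hmQ nQ bm).
have extP m n : bd m -> (forall t, lm n (Q t) = Q (lm m t)) -> ext m = n.
  by move=> bm h; apply: (mult_eq_total tQ) => t; rewrite extE.
have bdX (a : X) : bd (cdelta a) by exact: bd_delta.
(* For a in I, strong invariance puts delta(a)(1 (x) c) in the closed span of I (x) C*(G), which Q
   kills; so the choice of representatives in [dB] is immaterial. *)
have Q0 (a : X) t : I a -> Q (lm (cdelta a) t) = 0.
  move=> Ia; have [r _ hr] := bdX a.
  move: t; apply: (total_eq (@mtens1_total _ _ CG T X)).
  - exact: blin_comp (blin_lm hr) (hom_blin hQ).
  - exact: blin0.
  move=> [x [c e]] /=; have [t ht] := delta_tilde a c.
  rewrite -lm_mtens1 -lmM -ht /= (starhom_mul hQ).
  suff -> : Q t = 0 by rewrite amul0l.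
  have : cspan [set t : T X CG | exists a c, I a /\ t = tens (T X CG) a c] t.
    by rewrite -sI; apply: cspan_in; exists a, c.
  apply: (cspan_ind (P := fun t => Q t = 0)).
  - by move=> y hy; apply: (closed_eq (hom_blin hQ) (blin0 _ _)).
  - exact: lin0 (starhom_linear hQ).
  - by move=> k y y' h h'; rewrite (starhom_linear hQ) h h' scaler0 addr0.
  - move=> _ [b [d [Ib ->]]]; rewrite QE (_ : q b = 0) ?tens_0_l//.
    exact/qmk_eq0.
pose dB (b : B) := ext (cdelta (qrep b)).
have dBE a : dB (q a) = ext (cdelta a).
  apply: extP => // t; rewrite extE//; apply/eqP; rewrite -subr_eq0.
  rewrite -(linB (starhom_linear hQ)) -lmB -(linB (starhom_linear hd)).
  by apply/eqP; apply: Q0; apply/qmk_eq; rewrite qrepK.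
have dBQ a t : lm (dB (q a)) (Q t) = Q (lm (cdelta a) t) by rewrite dBE extE.
have hB : starhom dB.
  split.
  - move=> k b b'; have [a ->] := qs b; have [a' ->] := qs b'.
    apply: (mult_eq_total tQ) => t; rewrite -qmkZ -qmkD lmD lmZ !dBQ.
    by rewrite (starhom_linear hd) lmD lmZ (starhom_linear hQ).
  - move=> b b'; have [a ->] := qs b; have [a' ->] := qs b'.
    by apply: (mult_eq_total tQ) => t; rewrite -qmkM lmM !dBQ (starhom_mul hd) lmM.
  - move=> b; have [a ->] := qs b; rewrite -qmk_star !dBE (starhom_star hd).
    by rewrite /ext mext_star.
have QM c w : Q (lm (mtens1 T X c) w) = lm (mtens1 T B c) (Q w).
  have [r _ h1] := bd_mtens1 T X c; have [r' _ h2] := bd_mtens1 T B c.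
  move: w; apply: tens_eq; [exact: blin_comp (blin_lm h1) (hom_blin hQ)|exact: blin_comp (hom_blin hQ) (blin_lm h2)|].
  by move=> a d; rewrite lm_mtens1 !QE lm_mtens1.
have res (a : X) c t : membed t = cdelta a ** mtens1 T X c -> membed (Q t) = dB (q a) ** mtens1 T B c.
  move=> ht; apply: (mult_eq_total tQ) => w.
  by rewrite lmM -QM dBQ -lmM -ht /= (starhom_mul hQ).
have tilde b c : exists t, membed t = dB b ** mtens1 T B c.
  have [a ->] := qs b; have [t ht] := delta_tilde a c.
  by exists (Q t); exact: res.
have dense : cspan [set t : T B CG | exists a c, membed t = dB a ** mtens1 T B c] = setT.
  rewrite -subTset => w _; have : cspan (range Q) w by rewrite QT.
  apply: (cspan_map (blin_id _)) => _ [t _ <-].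
  have : cspan [set t : T X CG | exists a c, membed t = cdelta a ** mtens1 T X c] t.
    by rewrite cdelta_dense.
  apply: (cspan_map (hom_blin hQ)) => s [a [c hs]]; apply: cspan_in.
  by exists (q a), c; exact: res.
have nB := build_nondeg hB tilde dense.
have [eps [heps epsu [c1 epsc1]]] := counit_ex CG.
(* Since eps c1 = 1, slicing Q(delta(a)(1 (x) c1)) by eps gives q(a). *)
have injB0 b : dB b = 0 -> b = 0.
  have [a ->] := qs b => d0; have [t ht] := delta_tilde a c1.
  have Qt0 : Q t = 0 by apply: membed_inj; rewrite (res _ _ _ ht) d0 amul0l membed0.
  have deps : dual (A := CG) eps by apply/dual_blin; exact: hom_blin.
  have := slice_tmap t hq hQ QE deps; rewrite Qt0 (lin0 (slice_blin T B deps).1).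
  by rewrite (coact_counit1 heps epsu epsc1 ht) epsc1 scale1r => <-.
have injB : injective dB.
  move=> a b e; apply/eqP; rewrite -subr_eq0; apply/eqP/injB0.
  by rewrite (linB (starhom_linear hB)) e subrr.
have [K3 hK3 K3E] := tmapl_ex T CG hQ.
have t3 : total K3.
  apply: (@cspan_total _ _ _ _ (range K3)); last by move=> _ [t _ <-]; exists t.
  have := @total_nestl R _ _ (T B CG) (T (T B CG) CG) Q (fun a c => tens (T (T B CG) CG) a c) tQ
    (@tens_total R T _ CG) (@blin_tensl R T _ CG).
  by move=> /total_cspan; apply=> -[t c] /=; exists (tens (T (T X CG) CG) t c) => //; rewrite K3E.
have inter a t : Q (lm (cdelta a) t) = lm (dB (q a)) (Q t) by rewrite dBQ.
have coassoc b : mext (homtens T dB (@membed R CG)) (dB b) =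
    mext (fun t => membed (tens_assoc T t)) (mext (homtens T (@membed R B) (comult T (CG := CG))) (dB b)).
  have [a ->] := qs b; apply: (mult_eq_total t3) => w.
  rewrite -(coassoc_transfer_left hd (@cdelta_nondeg _ _ _ _ X) hB nB hQ hK3 QE K3E inter).
  rewrite -(coassoc_transfer_right hd hB hq hQ hK3 QE K3E inter).
  by rewrite cdelta_coassoc.
pose Y := Coaction hB injB nB (build_tilde hB tilde) coassoc dense.
have [f hf] := @coact_hom_ex _ _ _ _ X Y q Q hq hQ QE res.
exists Y, f; split.
  by apply/seteqP; split=> a /=; rewrite hf; [move/qmk_eq0|move=> h; apply/qmk_eq0].
by rewrite -subTset => b _; have [a ->] := qs b; exists a.
Qed.

End QuotientCoaction.

(** * From exactness to the inclusion *)

Section Main.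
Context (R : realType) (G : topGroupType) (CG : group_cstar R G) (T : min_tensors R).

Lemma inclusion_of_exact (E : set (CG -> R[i])) (tauE : tau_functor T E) :
  exact_functor tauE ->
  forall (X : coaction CG T) (I : set X), ideal I -> strongly_invariant I ->
     [set a : X | forall f, E f -> I (cdot f a)] `<=`
     [set x + y | x in I & y in annihilated E (X := X)].
Proof.
move=> ex X I hI sI a ha.
have [Y [phi [ip rp]]] := ideal_coaction hI sI.
have [Z [psi [kp sp]]] := quotient_coaction hI sI.
have se : short_exact phi psi by split=> //; rewrite rp kp.
have [_ rk _] := ex _ _ _ _ _ se.
(* The class of a dies in Z^E because f . psi(a) = psi(f . a) = 0 for f in E. *)
have : range (fmor tauE phi) (tauQ tauE X a).
  rewrite rk /= tauQ_natural.
  have : [set c | tauQ tauE Z c = 0] (psi a).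
    rewrite tauQ_ker => f Ef; rewrite (exact_cdot_psi se).
    by have := ha f Ef; rewrite -kp.
  by move=> h; rewrite (_ : tauQ tauE Z _ = 0).
move=> [y _ hy]; have : range (tauQ tauE Y) y by rewrite tauQ_surj.
move=> [b _ hb]; rewrite -hb tauQ_natural in hy.
have Ib : I (phi b) by rewrite -rp; exists b.
exists (phi b) => //; exists (a - phi b); last by lmod.
have : [set c | tauQ tauE X c = 0] (a - phi b).
  by rewrite /= (linB (chom_lin (tauQ tauE X))) hy subrr.
by rewrite tauQ_ker.
Qed.

End Main.

Theorem proposition6p7 (R : realType) (G : topGroupType)
    (G_hausdorff : hausdorff_space G) (G_lc : locally_compact [set: G])
    (CG : group_cstar R G) (T : min_tensors R)
    (E : set (CG -> R[i])) (E_large : large_ideal E)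
    (tauE : tau_functor T E) :
  exact_functor tauE <->
  (forall (X : coaction CG T) (I : set X),
     ideal I -> strongly_invariant I ->
     [set a : X | forall f, E f -> I (cdot f a)] `<=`
     [set x + y | x in I & y in annihilated E (X := X)]).
Proof.
split=> [ex|H]; first exact: (inclusion_of_exact ex).
exact: (exact_of_inclusion tauE H).
Qed.
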